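(* The following hold. (1) $\mathsf{List}_{2^{\mathbb{N}},<\omega}$ and $\mathsf{wList}_{2^{\mathbb{N}},\le\omega}$ are Weihrauch incomparable, and $\mathsf{wList}_{2^{\mathbb{N}},\le\omega}\equiv_{\mathrm{W}}\mathsf{wList}_{2^{\mathbb{N}}}$. (2) $\mathsf{wList}_{2^{\mathbb{N}},\le\omega}<_{\mathrm{W}}\mathsf{List}_{2^{\mathbb{N}}}$ and $\mathsf{List}_{2^{\mathbb{N}},<\omega}<_{\mathrm{W}}\mathsf{List}_{2^{\mathbb{N}}}$. (3) $\mathsf{List}_{2^{\mathbb{N}}}<_{\mathrm{W}}\mathsf{UC}_{\mathbb{N}^{\mathbb{N}}}\equiv_{\mathrm{W}}\mathsf{wList}_{\mathbb{N}^{\mathbb{N}}}\equiv_{\mathrm{W}}\mathsf{List}_{\mathbb{N}^{\mathbb{N}}}$. Moreover all the problems involved are cylinders, so all the reductions mentioned above are strong Weihrauch reductions.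
   Context: A represented space is a set $X$ with a partial surjection $\delta_X:\subseteq\mathbb{N}^{\mathbb{N}}\to X$; $p$ is a name of $x$ if $\delta_X(p)=x$. A problem is a partial multi-valued function $f:\subseteq X\rightrightarrows Y$ between represented spaces. $f\le_{\mathrm{W}} g$ (Weihrauch reducibility) means that there are computable partial maps $\Phi,\Psi:\subseteq\mathbb{N}^{\mathbb{N}}\to\mathbb{N}^{\mathbb{N}}$ such that for every name $p$ of some $x\in\mathrm{dom}(f)$, $\Phi(p)$ is a name of some $y\in\mathrm{dom}(g)$, and for every name $q$ of an element of $g(y)$, $\Psi(p*q)$ is a name of an element of $f(x)$, where $p*q$ is the interleaving of $p$ and $q$. Strong reducibility $\le_{\mathrm{sW}}$ is the same with $\Psi(q)$ in place of $\Psi(p*q)$. $f\equiv_{\mathrm{W}}g$ means reducibility both ways (similarly $\equiv_{\mathrm{sW}}$); $f<_{\mathrm{W}}g$ means $f\le_{\mathrm{W}}g$ and $g\not\le_{\mathrm{W}}f$; incomparable means $f\not\le_{\mathrm{W}}g$ and $g\not\le_{\mathrm{W}}f$. The parallel product is $(f\times g)(x,y)=f(x)\times g(y)$; $f$ is a cylinder if $f\equiv_{\mathrm{sW}}f\times\mathrm{id}$, with $\mathrm{id}$ the identity on $\mathbb{N}^{\mathbb{N}}$. A tree is a nonempty subset $T$ of $\mathbb{N}^{<\mathbb{N}}$ closed under initial segments; a binary tree is a tree contained in $2^{<\mathbb{N}}$; $[T]$ is its set of infinite paths. $\mathcal{A}(\mathbb{N}^{\mathbb{N}})$ (resp. $\mathcal{A}(2^{\mathbb{N}})$)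 is the represented space of closed subsets of Baire space (resp. Cantor space), a name of $C$ being (the characteristic function of) a tree (resp. binary tree) $T$ with $[T]=C$; this is equivalent to the usual negative representation. $\mathbb{N}$, $\mathbb{N}^{\mathbb{N}}$, $2^{\mathbb{N}}$, $2=\{0,1\}$, products and (finite or infinite) sequence spaces carry the standard representations. For $\mathcal{X}\in\{2^{\mathbb{N}},\mathbb{N}^{\mathbb{N}}\}$, the problems $\mathsf{wList}_{\mathcal{X}}:\subseteq\mathcal{A}(\mathcal{X})\rightrightarrows(2\times\mathcal{X})^{\mathbb{N}}$ and $\mathsf{List}_{\mathcal{X}}:\subseteq\mathcal{A}(\mathcal{X})\rightrightarrows\mathbb{N}\times(2\times\mathcal{X})^{\mathbb{N}}$ have domain $\{A:|A|\le\aleph_0\}$ and $\mathsf{wList}_{\mathcal{X}}(A)=\{(b_i,x_i)_{i\in\mathbb{N}}: A=\{x_i:b_i=1\}\}$, $\mathsf{List}_{\mathcal{X}}(A)=\{(n,(b_i,x_i)_{i\in\mathbb{N}}): A=\{x_i:b_i=1\}\text{ and }((n=0\wedge|A|=\aleph_0)\vee(n>0\wedge|A|=n-1))\}$. $\mathsf{List}_{2^{\mathbb{N}},<\omega}:\subseteq\mathcal{A}(2^{\mathbb{N}})\rightrightarrows(2^{\mathbb{N}})^{<\mathbb{N}}$ has domain $\{A:|A|<\aleph_0\}$ and maps $A$ to $\{(p_i)_{i<n}:A=\{p_i:i<n\}\}$. $\mathsf{wList}_{2^{\mathbb{N}},\le\omega}:\subseteq\mathcal{A}(2^{\mathbb{N}})\rightrightarrows(2^{\mathbb{N}})^{\mathbb{N}}$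 has domain $\{A:|A|\le\aleph_0,\ A\ne\emptyset\}$ and maps $A$ to $\{(p_i)_{i\in\mathbb{N}}:A=\{p_i:i\in\mathbb{N}\}\}$. $\mathsf{UC}_{\mathbb{N}^{\mathbb{N}}}:\subseteq\mathcal{A}(\mathbb{N}^{\mathbb{N}})\to\mathbb{N}^{\mathbb{N}}$ maps each closed singleton $\{x\}$ to $x$ (domain: the singletons). *)

(* Defs.v *)
From HB Require Import structures.
From Stdlib Require Import Cantor.
From mathcomp Require Import all_boot.
From mathcomp Require Import all_classical.
From mathcomp Require Import topology.

Set Implicit Arguments.
Unset Strict Implicit.
Unset Printing Implicit Defensive.

Local Open Scope classical_set_scope.
Local Open Scope card_scope.

Definition baire := nat -> nat.

Definition cpair (m n : nat) : nat := Cantor.to_nat (m, n).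

(* Kleene's schemata for functions that are partial recursive in an oracle,
   for unary functions: several arguments are passed as one Cantor pair.      *)
Inductive code :=
| Zero | Succ | Fst | Snd | Oracle
| Pair of code & code
| Comp of code & code
| PrimRec of code & code
| Mu of code.

Fixpoint iterates (init : nat -> Prop) (step : nat -> nat -> nat -> Prop)
    (k n : nat) : Prop :=
  if k is j.+1 then exists2 r, iterates init step j r & step j r n else init n.

(* [eval p c m n]: program [c] with oracle [p] halts on input [m] with output
   [n].  [PrimRec c d] on <a, k> iterates r(0) = c(a), r(j+1) = d<a, <j, r(j)>>;
   [Mu c] on a searches the least k such that c<a, k> = 0.                    *)
Fixpoint eval (p : baire) (c : code) (m n : nat) {struct c} : Prop :=
  match c with
  | Zero => n = 0
  | Succ => n = m.+1
  | Fst => n = (Cantor.of_nat m).1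
  | Snd => n = (Cantor.of_nat m).2
  | Oracle => n = p m
  | Pair c d => exists i j, [/\ eval p c m i, eval p d m j & n = cpair i j]
  | Comp c d => exists2 k, eval p d m k & eval p c k n
  | PrimRec c d =>
      let: (a, k) := Cantor.of_nat m in
      iterates (eval p c a) (fun j r => eval p d (cpair a (cpair j r))) k n
  | Mu c => eval p c (cpair m n) 0 /\
            forall k, k < n -> exists r, eval p c (cpair m k) r.+1
  end.

Lemma eval_inj p c m n n' : eval p c m n -> eval p c m n' -> n = n'.
Proof.
elim: c m n n' => [||||
  |c IHc d IHd|c IHc d IHd|c IHc d IHd|c IHc] m n n' /=; try by move=> -> ->.
- by move=> [i [j [ci dj ->]]] [i' [j' [ci' dj' ->]]];
    rewrite (IHc _ _ _ ci ci') (IHd _ _ _ dj dj').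
- by move=> [k dk ck] [k' dk' ck']; rewrite (IHd _ _ _ dk' dk) in ck';
    exact: IHc ck ck'.
- case: Cantor.of_nat => a k.
  elim: k n n' => [|k IHk] n n' /=; first exact: IHc.
  by move=> [r rr dr] [r' rr' dr']; rewrite (IHk _ _ rr' rr) in dr';
    exact: IHd dr dr'.
- move=> [cn ltn] [cn' ltn'].
  case: (ltngtP n n') => // [/ltn'|/ltn] [r cr].
    by have := IHc _ _ _ cn cr.
  by have := IHc _ _ _ cn' cr.
Qed.

(* Partial maps on Baire space are total maps to [option]; as usual in
   computable analysis, the program may do anything outside the domain.       *)
Definition computable (F : baire -> option baire) :=
  exists c : code, forall p q, F p = Some q -> forall n, eval p c n (q n).

Definition interleave (p q : baire) : baire :=
  fun n => if odd n then q n./2 else p n./2.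

(* [name p x] is the graph of the partial surjection, i.e. [p] is a name of
   [x].                                                                       *)
Record repSpace := RepSpace {
  carrier :> Type;
  name : baire -> carrier -> Prop;
  name_inj : forall p x y, name p x -> name p y -> x = y;
  name_surj : forall x, exists p, name p x }.

Lemma rep_nat_inj p (x y : nat) : p 0 = x -> p 0 = y -> x = y.
Proof. by move=> ->. Qed.
Lemma rep_nat_surj (x : nat) : exists p : baire, p 0 = x.
Proof. by exists (fun=> x). Qed.
Definition rep_nat : repSpace := RepSpace rep_nat_inj rep_nat_surj.

Lemma rep_bool_inj p (x y : bool) : p 0 = x :> nat -> p 0 = y :> nat -> x = y.
Proof. by move=> ->; case: x y => [] []. Qed.
Lemma rep_bool_surj (x : bool) : exists p : baire, p 0 = x.
Proof. by exists (fun=> x). Qed.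
Definition rep_bool : repSpace := RepSpace rep_bool_inj rep_bool_surj.

Section Prod.
Variables X Y : repSpace.
Definition prod_name (p : baire) (z : X * Y) :=
  name (fun n => p n.*2) z.1 /\ name (fun n => p n.*2.+1) z.2.
Lemma prod_name_inj p z z' : prod_name p z -> prod_name p z' -> z = z'.
Proof.
case: z z' => [x y] [x' y'] [/= px py] [/= px' py'].
by rewrite (name_inj px px') (name_inj py py').
Qed.
Lemma prod_name_surj z : exists p, prod_name p z.
Proof.
have [[p pz] [q qz]] := (name_surj z.1, name_surj z.2).
exists (interleave p q); split; rewrite /interleave.
  by under eq_fun do rewrite odd_double doubleK.
by under eq_fun do rewrite /= odd_double uphalf_double.
Qed.
Definition rep_prod : repSpace := RepSpace prod_name_inj prod_name_surj.
End Prod.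

Section Seq.
Variable X : repSpace.

Definition seq_name (p : baire) (u : nat -> X) :=
  forall i, name (fun n => p (cpair i n)) (u i).
Lemma seq_name_inj p u v : seq_name p u -> seq_name p v -> u = v.
Proof. by move=> pu pv; apply/funext => i; exact: name_inj (pu i) (pv i). Qed.
Lemma seq_name_surj u : exists p, seq_name p u.
Proof.
have [q qu] := choice (fun i => name_surj (u i)).
exists (fun m => q (Cantor.of_nat m).1 (Cantor.of_nat m).2) => i.
by rewrite (_ : (fun n => _) = q i) //; apply/funext => n;
  rewrite Cantor.cancel_of_to.
Qed.
Definition rep_seq : repSpace := RepSpace seq_name_inj seq_name_surj.

(* Finite sequences: the length first, then the entries.                      *)
Definition fseq_name (p : baire) (s : seq X) :=
  p 0 = size s /\
  forall i x, onth s i = Some x -> name (fun n => p (cpair i n).+1) x.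
Lemma fseq_name_inj p s t : fseq_name p s -> fseq_name p t -> s = t.
Proof.
move=> [ps pns] [pt pnt]; have st : size s = size t by rewrite -ps -pt.
case: s ps pns st => [|x0 s] ps pns st; first by case: t st {pt pnt}.
apply: (@eq_from_nth _ x0) => // i ilt.
apply: (@name_inj _ (fun n => p (cpair i n).+1)).
- by apply: pns; rewrite onthE (nth_map x0).
- by apply: pnt; rewrite onthE (nth_map x0) // -st.
Qed.
Lemma fseq_name_surj s : exists p, fseq_name p s.
Proof.
have [q qs] : exists q : nat -> baire,
    forall i x, onth s i = Some x -> name (q i) x.
  suff /choice[q qP] : forall i, exists r : baire,
    forall x, onth s i = Some x -> name r x by exists q.
  move=> i.
  case: onth => [x|]; last by exists id.
  by have [r rx] := name_surj x; exists r => _ [<-].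
exists (fun m => if m is k.+1
  then q (Cantor.of_nat k).1 (Cantor.of_nat k).2 else size s); split=> // i x /qs.
by rewrite (_ : (fun n => _) = q i) //; apply/funext => n;
  rewrite Cantor.cancel_of_to.
Qed.
Definition rep_fseq : repSpace := RepSpace fseq_name_inj fseq_name_surj.
End Seq.

(* The alphabets of interest are [nat] and [bool]; [enc] encodes letters.     *)
Record alphabet := Alphabet {
  letter :> pdiscreteTopologicalType;
  enc : letter -> nat;
  enc_inj : injective enc }.

Definition nat_alphabet : alphabet := Alphabet (@inj_id nat).

Lemma nat_of_bool_inj : injective nat_of_bool.
Proof. by move=> [] []. Qed.
Definition bool_alphabet : alphabet := Alphabet nat_of_bool_inj.

Section Alphabet.
Variable S : alphabet.

Definition seqspace : topologicalType := prod_topology (fun _ : nat => letter S).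

Definition seqspace_name (p : baire) (x : seqspace) := forall n, p n = enc (x n).
Lemma seqspace_name_inj p x y : seqspace_name p x -> seqspace_name p y -> x = y.
Proof.
by move=> px py; apply/funext => n; apply: (@enc_inj S); rewrite -px -py.
Qed.
Lemma seqspace_name_surj x : exists p, seqspace_name p x.
Proof. by exists (fun n => enc (x n)). Qed.
Definition rep_seqspace : repSpace :=
  RepSpace seqspace_name_inj seqspace_name_surj.

Definition tree (T : set (seq S)) :=
  T !=set0 /\ forall s t, T (s ++ t) -> T s.

Definition paths (T : set (seq S)) : set seqspace :=
  [set x | forall n, T (mkseq x n)].

(* [p] is the characteristic function of [T], viewed as a set of finite
   sequences of natural numbers and hence of codes of such sequences.         *)
Definition char_fun (p : baire) (T : set (seq S)) :=
  forall n, p n = `[< exists2 s, T s & n = CodeSeq.code (map (@enc S) s) >].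

Record closedSet := ClosedSet {
  pts :> set seqspace;
  pts_closed : closed pts }.

Definition closed_name (p : baire) (A : closedSet) :=
  exists T, [/\ tree T, char_fun p T & paths T = A].

Lemma char_fun_inj p T U : char_fun p T -> char_fun p U -> T = U.
Proof.
suff sub T' U' : char_fun p T' -> char_fun p U' -> T' `<=` U'.
  by move=> pT pU; apply/seteqP; split; [exact: sub pT pU|exact: sub pU pT].
move=> pT pU s Ts; have := pU (CodeSeq.code (map (@enc S) s)).
rewrite pT asboolT; last by exists s.
by case: asboolP => // -[t Ut /(can_inj CodeSeq.codeK)/(inj_map (@enc_inj S)) ->].
Qed.

Lemma closed_name_inj p A B : closed_name p A -> closed_name p B -> A = B.
Proof.
move=> [T [_ pT TA]] [U [_ pU UB]]; have := char_fun_inj pT pU => TU.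
case: A B TA UB => [A Acl] [B Bcl] /= TA UB.
have AB : A = B by rewrite -TA -UB TU.
by case: B / AB Bcl UB => Bcl _; congr ClosedSet; exact: Prop_irrelevance.
Qed.

Lemma closed_name_surj A : exists p, closed_name p A.
Proof.
pose T : set (seq S) := [set s | s = [::] \/ exists2 x, pts A x & s = mkseq x (size s)].
exists (fun n => `[< exists2 s, T s & n = CodeSeq.code (map (@enc S) s) >]).
exists T; split=> //.
  split; first by exists [::]; left.
  move=> s t [/(congr1 size)/eqP|[x Ax]].
    by rewrite size_cat addn_eq0 => /andP[/nilP -> _]; left.
  move=> st; right; exists x => //.
  have := congr1 (take (size s)) st.
  rewrite take_size_cat // => {1}->; rewrite /mkseq -map_take take_iota.
  by rewrite size_cat (minn_idPl _) // leq_addr.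
apply/seteqP; split=> [x Tx|x Ax n]; last first.
  by right; exists x => //; rewrite size_mkseq.
have [y yP] : exists y : nat -> seqspace,
    forall n, pts A (y n) /\ mkseq x n.+1 = mkseq (y n) n.+1.
  suff /choice[y yP] : forall n, exists z : seqspace,
    pts A z /\ mkseq x n.+1 = mkseq z n.+1 by exists y.
  move=> n.
  have [|[z Az]] := Tx n.+1; first by [].
  by rewrite size_mkseq; exists z.
apply: (@closed_cvg _ _ \oo _ y (pts A) (@pts_closed A) _ x).
  by apply: nearW => n; have [] := yP n.
apply/cvg_sup => i U; rewrite (@nbhsE (initial_topology _)) => -[B [[C oC <-] Cx] BU].
exists i.+1 => // n /= lt_in; apply: BU; rewrite /preimage /= in Cx *.
have [_ /(congr1 (nth point ^~ i))] := yP n.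
by rewrite !nth_mkseq ?(leqW lt_in) ?(ltnW lt_in) // => xy; rewrite /proj -xy.
Qed.
Definition rep_closed : repSpace := RepSpace closed_name_inj closed_name_surj.
End Alphabet.

Arguments pts {S}.

Definition rep_baire : repSpace := rep_seqspace nat_alphabet.

(* Only the values of [sol] on [dom] matter.                                 *)
Record problem (X Y : repSpace) := Problem {
  dom : set X;
  sol : X -> set Y;
  sol_nonempty : forall x, dom x -> sol x !=set0 }.

Section Reducibility.
Variables (X Y Z W : repSpace) (f : problem X Y) (g : problem Z W).

Definition leW := exists Phi Psi : baire -> option baire,
  [/\ computable Phi, computable Psi &
   forall p x, name p x -> dom f x ->
     exists r z, [/\ Phi p = Some r, name r z, dom g z &
       forall q w, name q w -> sol g z w ->
         exists s y, [/\ Psi (interleave p q) = Some s, name s y & sol f x y]]].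

Definition lesW := exists Phi Psi : baire -> option baire,
  [/\ computable Phi, computable Psi &
   forall p x, name p x -> dom f x ->
     exists r z, [/\ Phi p = Some r, name r z, dom g z &
       forall q w, name q w -> sol g z w ->
         exists s y, [/\ Psi q = Some s, name s y & sol f x y]]].
End Reducibility.

Section Derived.
Variables (X Y Z W : repSpace) (f : problem X Y) (g : problem Z W).
Definition eqW := leW f g /\ leW g f.
Definition eqsW := lesW f g /\ lesW g f.
Definition ltW := leW f g /\ ~ leW g f.
Definition incomparableW := ~ leW f g /\ ~ leW g f.

Lemma prod_nonempty (z : X * Z) : (dom f `*` dom g) z ->
  (sol f z.1 `*` sol g z.2) !=set0.
Proof.
by case=> /sol_nonempty[y fy] /sol_nonempty[w gw]; exists (y, w).
Qed.
Definition prod_problem : problem (rep_prod X Z) (rep_prod Y W) :=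
  @Problem (rep_prod X Z) (rep_prod Y W) (dom f `*` dom g)
    (fun z => sol f z.1 `*` sol g z.2) prod_nonempty.
End Derived.

Lemma id_nonempty (x : rep_baire) : setT x -> [set x] !=set0.
Proof. by exists x. Qed.
Definition id_problem : problem rep_baire rep_baire :=
  @Problem rep_baire rep_baire setT (fun x => [set x]) id_nonempty.

Definition cylinder X Y (f : problem X Y) := eqsW f (prod_problem f id_problem).

Section Lists.
Variable S : alphabet.

(* The space of (b_i, x_i)_i, and the set { x_i | b_i = 1 } it lists.         *)
Definition rep_bseq := rep_seq (rep_prod rep_bool (rep_seqspace S)).

Definition listed (u : rep_bseq) : set (seqspace S) :=
  [set (u i).2 | i in [set i | (u i).1]].

Lemma countable_listed (A : set (seqspace S)) :
  countable A -> exists u, A = listed u.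
Proof.
move=> /pfcard_geP[->|[f]].
  by exists (fun=> (false, point)); apply/seteqP; split=> // x [i].
exists (fun i => (true, f i)).
transitivity (range f); first by rewrite image_eq.
by apply/seteqP; split=> x [i _ <-]; exists i.
Qed.

Lemma wList_nonempty (A : closedSet S) :
  countable (pts A) -> [set u | pts A = listed u] !=set0.
Proof. exact: countable_listed. Qed.
Definition wList : problem (rep_closed S) rep_bseq :=
  @Problem (rep_closed S) rep_bseq
    [set A | countable (pts A)]
    (fun A => [set u | pts A = listed u]) wList_nonempty.

Definition List_sol (A : closedSet S) : set (nat * rep_bseq) :=
  [set nu | pts A = listed nu.2 /\
    (nu.1 = 0 /\ pts A #= [set: nat] \/
     0 < nu.1 /\ pts A #= `I_(nu.1 - 1))].
Lemma List_nonempty (A : closedSet S) : countable (pts A) -> List_sol A !=set0.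
Proof.
move=> cA; have [u Au] := countable_listed cA.
have [/finite_setP[n An]|infA] := pselect (finite_set (pts A)).
  by exists (n.+1, u); split=> //; right; rewrite /= subn1.
by exists (0, u); split=> //; left; split=> //; exact: eq_card_nat.
Qed.
Definition List : problem (rep_closed S) (rep_prod rep_nat rep_bseq) :=
  @Problem (rep_closed S) (rep_prod rep_nat rep_bseq)
    [set A | countable (pts A)] List_sol List_nonempty.
End Lists.

Notation rep_cantor := (rep_seqspace bool_alphabet).

Lemma List_lt_omega_nonempty (A : closedSet bool_alphabet) :
  finite_set (pts A) -> [set s : seq (seqspace _) | pts A = [set` s]] !=set0.
Proof. by move=> /finite_seqP. Qed.
Definition List_lt_omega : problem (rep_closed bool_alphabet) (rep_fseq rep_cantor) :=
  @Problem (rep_closed bool_alphabet) (rep_fseq rep_cantor)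
    [set A | finite_set (pts A)]
    (fun A => [set s : seq (seqspace _) | pts A = [set` s]])
    List_lt_omega_nonempty.

Lemma wList_le_omega_nonempty (A : closedSet bool_alphabet) :
  countable (pts A) /\ pts A !=set0 -> [set u : nat -> seqspace _ | pts A = range u] !=set0.
Proof.
move=> [/pfcard_geP[->|[f] _]]; first by case.
by exists f; rewrite /= image_eq.
Qed.
Definition wList_le_omega : problem (rep_closed bool_alphabet) (rep_seq rep_cantor) :=
  @Problem (rep_closed bool_alphabet) (rep_seq rep_cantor)
    [set A | countable (pts A) /\ pts A !=set0]
    (fun A => [set u : nat -> seqspace _ | pts A = range u]) wList_le_omega_nonempty.

Lemma UC_nonempty (A : closedSet nat_alphabet) :
  (exists x, pts A = [set x]) -> [set x | pts A = [set x]] !=set0.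
Proof. by []. Qed.
Definition UC_baire : problem (rep_closed nat_alphabet) rep_baire :=
  @Problem (rep_closed nat_alphabet) rep_baire
    [set A | exists x, pts A = [set x]]
    (fun A => [set x | pts A = [set x]]) UC_nonempty.

(* Main.v *)
From Stdlib Require Import Cantor.
From mathcomp Require Import all_boot zify.
From mathcomp Require Import all_classical topology.
Require Import Defs.

(** The reductions between the problems on Cantor space rest on one gadget: any list
    of the closed set [{0 y'} u 1 A], where [y'] codes the graph of [y], contains
    besides a list of [A] the further point [y] of Baire space.

    For [List S <= UC], remove from a tree, transfinitely often, the nodes without
    two incompatible extensions. The set of paths is countable iff this ends with
    the empty tree, and then every path is eventually a chain of nodes of constant
    rank. The relation "[r] has smaller rank than [s]" is the only solution [L] of
      [L r s <-> exists t0, t1 incompatible above s, ~ L t0 r /\ ~ L t1 r],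
    so it is read off the unique path of a computable tree of Skolem functions.
    On top of it a few further quantifiers, again Skolemized, tell which nodes lie
    on a path with all later nodes of the same rank, and count the paths.

    The separations only use the continuity of computable maps.
    - [List_lt_omega] is not reducible to [wList_le_omega]: that a finite part of
      a list is correct is a closed condition, so by Baire category one finite part
      would bound the length of the answer on an open set of finite instances.
    - [wList_le_omega] is not reducible to [List_lt_omega]: after a finite amount of
      advice that isolates the finitely many paths, the answer would be continuous.
    - [UC] is not reducible to [List] on Cantor space: a tree can refer to its own
      characteristic function, hence there is an instance [p] of [UC] whose
      solution [z] diagonalizes, at the position [2 k], against the answers computed
      from a list of [Phi p] that comes with the cardinality [k]. *)

Set Implicit Arguments.
Unset Strict Implicit.
Unset Printing Implicit Defensive.

Local Open Scope classical_set_scope.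
Local Open Scope card_scope.

(** * Uniformly computable functionals *)

Definition pfst n := (Cantor.of_nat n).1.
Definition psnd n := (Cantor.of_nat n).2.

Lemma pfstE m n : pfst (cpair m n) = m.
Proof. by rewrite /pfst /cpair Cantor.cancel_of_to. Qed.

Lemma psndE m n : psnd (cpair m n) = n.
Proof. by rewrite /psnd /cpair Cantor.cancel_of_to. Qed.

Definition pairE := (pfstE, psndE).

Lemma cpairK n : cpair (pfst n) (psnd n) = n.
Proof. by rewrite /cpair /pfst /psnd -surjective_pairing Cantor.cancel_to_of. Qed.

Lemma cpair_ge m n : m + n <= cpair m n.
Proof. by rewrite /cpair; have := Cantor.to_nat_non_decreasing m n; lia. Qed.

Lemma pfst_le n : pfst n <= n.
Proof. by have := cpair_ge (pfst n) (psnd n); rewrite cpairK; lia. Qed.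

Lemma psnd_le n : psnd n <= n.
Proof. by have := cpair_ge (pfst n) (psnd n); rewrite cpairK; lia. Qed.

Lemma cpair_mono m n m' n' : m <= m' -> n <= n' -> cpair m n <= cpair m' n'.
Proof.
rewrite /cpair => mm nn.
have := Cantor.to_nat_spec m n; have := Cantor.to_nat_spec m' n'; nia.
Qed.

Section Comp.
Variable D : set baire.

(* A program with several arguments receives them as nested Cantor pairs.     *)
Definition ucomputable (F : baire -> nat -> nat) :=
  exists c, forall p, D p -> forall n, eval p c n (F p n).

Implicit Types F G : baire -> nat -> nat.

Lemma comp_ext F G : ucomputable F -> (forall p, D p -> F p =1 G p) -> ucomputable G.
Proof. by move=> [c cF] FG; exists c => p Dp n; rewrite -FG //; exact: cF. Qed.

(** There is no schema for the identity; it is recovered by pairing the two projections again. *)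
Lemma comp_id : ucomputable (fun _ n => n).
Proof.
by exists (Comp Fst (Pair (Pair Fst Snd) Zero)) => p _ n /=; exists (cpair n 0);
  [exists n, 0; split=> //; exists (pfst n), (psnd n); rewrite cpairK
  |rewrite -/(pfst _) pfstE].
Qed.

Lemma comp_comp F G : ucomputable F -> ucomputable G -> ucomputable (fun p n => F p (G p n)).
Proof.
by move=> [c cF] [d dG]; exists (Comp c d) => p Dp n; exists (G p n);
  [exact: dG|exact: cF].
Qed.

Lemma comp_succ F : ucomputable F -> ucomputable (fun p n => (F p n).+1).
Proof. by apply: (comp_comp (F := fun _ n => n.+1)); exists Succ. Qed.

Lemma comp_const k : ucomputable (fun _ _ => k).
Proof. by elim: k => [|k]; [exists Zero|exact: comp_succ]. Qed.

Lemma comp_oracle F : ucomputable F -> ucomputable (fun p n => p (F p n)).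
Proof. by apply: (comp_comp (F := fun p n => p n)); exists Oracle. Qed.

Lemma comp_fst F : ucomputable F -> ucomputable (fun p n => pfst (F p n)).
Proof. by apply: (comp_comp (F := fun _ n => pfst n)); exists Fst. Qed.

Lemma comp_snd F : ucomputable F -> ucomputable (fun p n => psnd (F p n)).
Proof. by apply: (comp_comp (F := fun _ n => psnd n)); exists Snd. Qed.

Lemma comp_pair F G : ucomputable F -> ucomputable G -> ucomputable (fun p n => cpair (F p n) (G p n)).
Proof.
move=> [c cF] [d dG]; exists (Pair c d) => p Dp n.
by exists (F p n), (G p n); split=> //; [exact: cF|exact: dG].
Qed.

(** The bridge from [PrimRec] to [iteri]. The input [n] is carried along as the first component, so
    the step may depend on it; the arithmetic operations and bounded searches below are
    instances. *)
Lemma comp_iteri (K B : baire -> nat -> nat) (S : baire -> nat -> nat -> nat -> nat) :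
  ucomputable K -> ucomputable (fun p e => S p (pfst e) (pfst (psnd e)) (psnd (psnd e))) ->
  ucomputable B -> ucomputable (fun p n => iteri (K p n) (S p n) (B p n)).
Proof.
move=> cK [d dS] [c cB].
suff cI : ucomputable (fun p m => iteri (psnd m) (S p (pfst m)) (B p (pfst m))).
  have := comp_comp cI (comp_pair comp_id cK).
  by move/comp_ext; apply=> p _ n; rewrite !pairE.
exists (PrimRec c d) => p Dp m /=; rewrite /pfst /psnd.
case: (Cantor.of_nat m) => a k /=; elim: k => [|k IHk] /=; first exact: cB.
exists (iteri k (S p a) (B p a)) => //.
by have := dS p Dp (cpair a (cpair k (iteri k (S p a) (B p a)))); rewrite !pairE.
Qed.

Lemma comp_pred F : ucomputable F -> ucomputable (fun p n => (F p n).-1).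
Proof.
move=> cF; apply: (@comp_ext (fun p n => iteri (F p n) (fun j _ => j) 0)).
  apply: (comp_iteri (S := fun _ _ j _ => j)) => //; last exact: comp_const.
  by apply/comp_fst/comp_snd/comp_id.
by move=> p _ n; case: (F p n).
Qed.

Lemma comp_if (b : baire -> nat -> bool) F G :
  ucomputable (fun p n => b p n) -> ucomputable F -> ucomputable G ->
  ucomputable (fun p n => if b p n then F p n else G p n).
Proof.
move=> cb cF cG.
apply: (@comp_ext (fun p n => iteri (b p n) (fun _ _ => F p n) (G p n))).
  apply: (comp_iteri (S := fun p n _ _ => F p n)) => //.
  by apply: comp_comp cF _; apply/comp_fst/comp_id.
by move=> p _ n; case: (b p n).
Qed.

Lemma comp_ifb (a b c : baire -> nat -> bool) :
  ucomputable (fun p n => a p n) -> ucomputable (fun p n => b p n) -> ucomputable (fun p n => c p n) ->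
  ucomputable (fun p n => if a p n then b p n else c p n).
Proof.
move=> ca cb cc; apply: comp_ext (comp_if ca cb cc) _ => p _ n.
by case: (a p n).
Qed.

Lemma comp_add F G : ucomputable F -> ucomputable G -> ucomputable (fun p n => F p n + G p n).
Proof.
move=> cF cG; apply: (@comp_ext (fun p n => iteri (F p n) (fun _ r => r.+1) (G p n))).
  apply: (comp_iteri (S := fun _ _ _ r => r.+1)) => //.
  by apply/comp_succ/comp_snd/comp_snd/comp_id.
by move=> p _ n; elim: (F p n) => //= k ->.
Qed.

Lemma comp_sub F G : ucomputable F -> ucomputable G -> ucomputable (fun p n => F p n - G p n).
Proof.
move=> cF cG; apply: (@comp_ext (fun p n => iteri (G p n) (fun _ r => r.-1) (F p n))).
  apply: (comp_iteri (S := fun _ _ _ r => r.-1)) => //.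
  by apply/comp_pred/comp_snd/comp_snd/comp_id.
by move=> p _ n; elim: (G p n) => [|k] /=; lia.
Qed.

Lemma comp_mul F G : ucomputable F -> ucomputable G -> ucomputable (fun p n => F p n * G p n).
Proof.
move=> cF cG.
apply: (@comp_ext (fun p n => iteri (F p n) (fun _ r => G p n + r) 0)).
  apply: (comp_iteri (S := fun p n _ r => G p n + r)) => //; last exact: comp_const.
  apply: comp_add; last by apply/comp_snd/comp_snd/comp_id.
  by apply: comp_comp cG _; apply/comp_fst/comp_id.
by move=> p _ n; elim: (F p n) => //= k ->; rewrite mulSn.
Qed.

Lemma comp_exp2 F : ucomputable F -> ucomputable (fun p n => 2 ^ F p n).
Proof.
move=> cF; apply: (@comp_ext (fun p n => iteri (F p n) (fun _ r => r + r) 1)).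
  apply: (comp_iteri (S := fun _ _ _ r => r + r)) => //; last exact: comp_const.
  by apply: comp_add; apply/comp_snd/comp_snd/comp_id.
by move=> p _ n; elim: (F p n) => //= k ->; rewrite expnS; lia.
Qed.

Lemma comp_double F : ucomputable F -> ucomputable (fun p n => (F p n).*2).
Proof.
by move=> cF; apply: comp_ext (comp_add cF cF) _ => p _ n; rewrite addnn.
Qed.

Lemma comp_eq0 F : ucomputable F -> ucomputable (fun p n => F p n == 0).
Proof.
move=> cF; apply: (@comp_ext (fun p n => iteri (F p n) (fun _ _ => 0) 1)).
  by apply: (comp_iteri (S := fun _ _ _ _ => 0)) => //; exact: comp_const.
by move=> p _ n; case: (F p n).
Qed.

Lemma comp_leq F G : ucomputable F -> ucomputable G -> ucomputable (fun p n => F p n <= G p n).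
Proof. by move=> cF cG; apply/comp_eq0/comp_sub. Qed.

Lemma comp_neg (b : baire -> nat -> bool) :
  ucomputable (fun p n => b p n) -> ucomputable (fun p n => ~~ b p n).
Proof. by move=> /comp_eq0/comp_ext; apply=> p _ n; case: (b p n). Qed.

Lemma comp_and (a b : baire -> nat -> bool) :
  ucomputable (fun p n => a p n) -> ucomputable (fun p n => b p n) ->
  ucomputable (fun p n => a p n && b p n).
Proof.
by move=> ca cb; apply: comp_ext (comp_mul ca cb) _ => p _ n; rewrite mulnb.
Qed.

Lemma comp_or (a b : baire -> nat -> bool) :
  ucomputable (fun p n => a p n) -> ucomputable (fun p n => b p n) ->
  ucomputable (fun p n => a p n || b p n).
Proof.
move=> ca cb; have := comp_neg (comp_and (comp_neg ca) (comp_neg cb)).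
by move/comp_ext; apply=> p _ n; rewrite negb_and !negbK.
Qed.

Lemma comp_implb (a b : baire -> nat -> bool) :
  ucomputable (fun p n => a p n) -> ucomputable (fun p n => b p n) ->
  ucomputable (fun p n => a p n ==> b p n).
Proof.
move=> ca cb; apply: comp_ext (comp_or (comp_neg ca) cb) _ => p _ n.
by rewrite implybE.
Qed.

Lemma comp_eq F G : ucomputable F -> ucomputable G -> ucomputable (fun p n => F p n == G p n).
Proof.
move=> cF cG; apply: comp_ext (comp_and (comp_leq cF cG) (comp_leq cG cF)) _.
by move=> p _ n; rewrite eqn_leq.
Qed.

Lemma comp_find (P : baire -> nat -> nat -> bool) B :
  ucomputable (fun p e => P p (pfst e) (psnd e)) -> ucomputable B ->
  ucomputable (fun p n => find (P p n) (iota 0 (B p n))).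
Proof.
(* The invariant is [r = find (P p n) (iota 0 j)], so [j <= r] means that nothing has been found
   below [j]. *)
move=> cP cB; apply: (@comp_ext (fun p n =>
  iteri (B p n) (fun j r => if j <= r then if P p n j then j else j.+1 else r) 0)).
  apply: (comp_iteri (S := fun p n j r =>
    if j <= r then if P p n j then j else j.+1 else r)) => //; last exact: comp_const.
  have cj : ucomputable (fun p e => pfst (psnd e)) by apply/comp_fst/comp_snd/comp_id.
  have cr : ucomputable (fun p e => psnd (psnd e)) by apply/comp_snd/comp_snd/comp_id.
  apply: comp_if => //; first exact: comp_leq.
  apply: comp_if => //; last exact: comp_succ.
  have := comp_comp cP (comp_pair (comp_fst comp_id) cj).
  by move/comp_ext; apply=> p _ e /=; rewrite !pairE.
move=> p _ n; elim: (B p n) => // k; rewrite [iteri k.+1 _ _]/= => ->.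
rewrite -[in RHS]addn1 iotaD find_cat has_find size_iota /= add0n.
have := find_size (P p n) (iota 0 k); rewrite size_iota.
by case: ltngtP => // _ _; case: (P p n k); rewrite ?addn0 ?addn1.
Qed.

Lemma comp_has (P : baire -> nat -> nat -> bool) B :
  ucomputable (fun p e => P p (pfst e) (psnd e)) -> ucomputable B ->
  ucomputable (fun p n => has (P p n) (iota 0 (B p n))).
Proof.
move=> cP cB; have := comp_leq (comp_succ (comp_find cP cB)) cB.
by move/comp_ext; apply=> p _ n; rewrite has_find size_iota.
Qed.

Lemma comp_all (P : baire -> nat -> nat -> bool) B :
  ucomputable (fun p e => P p (pfst e) (psnd e)) -> ucomputable B ->
  ucomputable (fun p n => all (P p n) (iota 0 (B p n))).
Proof.
move=> cP cB; have := comp_neg (comp_has (P := fun p n i => ~~ P p n i) (comp_neg cP) cB).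
by move/comp_ext; apply=> p _ n; rewrite -all_predC; congr nat_of_bool;
  apply: eq_all => i /=; rewrite negbK.
Qed.

Lemma comp_half F : ucomputable F -> ucomputable (fun p n => (F p n)./2).
Proof.
apply: (comp_comp (F := fun _ n => n./2)).
apply: (@comp_ext (fun _ n => find (fun k => n <= k.*2.+1) (iota 0 n))).
  apply: (comp_find (P := fun _ n k => n <= k.*2.+1)); last exact: comp_id.
  by apply: comp_leq; [|apply/comp_succ/comp_double];
    [apply: comp_fst|apply: comp_snd]; exact: comp_id.
move=> p _ n; case: (findP (fun k => n <= k.*2.+1) (iota 0 n)) => [|k].
  case: n => // n /hasPn/(_ n.+1./2); rewrite mem_iota.
  by have := odd_double_half n.+1; lia.
rewrite size_iota => kn /(_ 0); rewrite nth_iota // => nk before.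
case: k => [|k] in kn nk before *; first by lia.
by have := before 0 k (ltnSn k); rewrite nth_iota; lia.
Qed.

Lemma comp_odd F : ucomputable F -> ucomputable (fun p n => odd (F p n)).
Proof.
move=> cF; have := comp_sub cF (comp_double (comp_half cF)).
by move/comp_ext; apply=> p _ n; have := odd_double_half (F p n); lia.
Qed.

(* Junk value 0 if no [k] satisfies [P].                                      *)
Definition least (P : pred nat) : nat :=
  if pselect (exists k, P k) is left exP then ex_minn exP else 0.

Lemma leastP (P : pred nat) : (exists k, P k) ->
  P (least P) /\ forall k, k < least P -> ~~ P k.
Proof.
move=> exP; rewrite /least; case: pselect => // {}exP.
case: ex_minnP => m Pm min_m; split=> // k; apply: contraTN => Pk.
by rewrite -leqNgt min_m.
Qed.

(** Unbounded search by [Mu]. It is total only because every [p] in [D] provides witnesses, which is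
    why computability is stated relative to a domain. *)
Lemma comp_least (P : baire -> nat -> nat -> bool) :
  (forall p, D p -> forall n, exists k, P p n k) ->
  ucomputable (fun p e => P p (pfst e) (psnd e)) -> ucomputable (fun p n => least (P p n)).
Proof.
move=> exP /comp_neg[c cP]; exists (Mu c) => p Dp n.
have [Pl minl] := leastP (exP p Dp n); split=> [|k /minl nPk].
  by have := cP p Dp (cpair n (least (P p n))); rewrite !pairE Pl.
by exists 0; have := cP p Dp (cpair n k); rewrite !pairE nPk.
Qed.

End Comp.

(** * Codes of finite sequences *)

Definition csize n := size (CodeSeq.decode n).
Definition cnth n i := nth 0 (CodeSeq.decode n) i.
Definition chd n := head 0 (CodeSeq.decode n).
Definition ctl n := CodeSeq.code (behead (CodeSeq.decode n)).
Definition cmk (f : nat -> nat) k := CodeSeq.code (mkseq f k).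

Lemma find_iota_uniq (P : pred nat) m b :
  m < b -> P m -> (forall k, P k -> k = m) -> find P (iota 0 b) = m.
Proof.
move=> mb Pm uniqm; case: (findP P (iota 0 b)) => [/hasPn/(_ m)|k].
  by rewrite mem_iota mb Pm => /(_ isT).
by rewrite size_iota => kb /(_ 0); rewrite nth_iota // => /uniqm.
Qed.

Section CompSeq.
Variable D : set baire.
Implicit Types F G : baire -> nat -> nat.

(** The code of [a :: s] is [2 ^ a * m.*2.+1] with [m] the code of [s]. Since it bounds both [a] and
    [m], head and tail are found by bounded search. *)
Lemma code_cons_bound a m : (a <= 2 ^ a * m.*2.+1) && (m <= 2 ^ a * m.*2.+1).
Proof. by have := ltn_expl a (ltnSn 1); nia. Qed.

Lemma decode_cons a m : CodeSeq.decode (2 ^ a * m.*2.+1) = a :: CodeSeq.decode m.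
Proof. by rewrite -[RHS]CodeSeq.codeK /= CodeSeq.decodeK. Qed.

Lemma comp_ctl F : ucomputable D F -> ucomputable D (fun p n => ctl (F p n)).
Proof.
apply: (comp_comp (F := fun _ n => ctl n)).
apply: (@comp_ext D (fun _ n => if n == 0 then 0 else
  find (fun m => has (fun a => n == 2 ^ a * m.*2.+1) (iota 0 n.+1)) (iota 0 n.+1))).
  apply: comp_if; [by apply/comp_eq0/comp_id|exact: comp_const|].
  apply: (comp_find (P := fun _ n m =>
    has (fun a => n == 2 ^ a * m.*2.+1) (iota 0 n.+1))); last first.
    exact/comp_succ/comp_id.
  apply: (comp_has (P := fun _ e a => pfst e == 2 ^ a * (psnd e).*2.+1)).
    apply: comp_eq; first by do 2!apply: comp_fst; exact: comp_id.
    apply: comp_mul; first by apply/comp_exp2/comp_snd/comp_id.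
    by apply/comp_succ/comp_double/comp_snd/comp_fst/comp_id.
  exact/comp_succ/comp_fst/comp_id.
move=> p _ n; case: eqP => [->//|n0].
case dec_n: (CodeSeq.decode n) => [|a s].
  by case: n0; rewrite -[n]CodeSeq.decodeK dec_n.
have def_n : n = 2 ^ a * (CodeSeq.code s).*2.+1.
  by rewrite -[n]CodeSeq.decodeK dec_n.
have /andP[a_le s_le] := code_cons_bound a (CodeSeq.code s).
rewrite [RHS]/ctl dec_n [behead _]/=.
apply: find_iota_uniq => [||m /hasP[a' _ /eqP]]; first by rewrite def_n ltnS.
  by apply/hasP; exists a; rewrite ?mem_iota /= ?ltnS; rewrite {1}def_n.
move=> /(congr1 CodeSeq.decode); rewrite dec_n !decode_cons => -[_ ->].
by rewrite CodeSeq.decodeK.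
Qed.

Lemma comp_chd F : ucomputable D F -> ucomputable D (fun p n => chd (F p n)).
Proof.
apply: (comp_comp (F := fun _ n => chd n)).
apply: (@comp_ext D (fun _ n => if n == 0 then 0 else
  find (fun a => n == 2 ^ a * (ctl n).*2.+1) (iota 0 n.+1))).
  apply: comp_if; [by apply/comp_eq0/comp_id|exact: comp_const|].
  apply: (comp_find (P := fun _ n a => n == 2 ^ a * (ctl n).*2.+1)); last first.
    exact/comp_succ/comp_id.
  apply: comp_eq; first by apply: comp_fst; exact: comp_id.
  apply: comp_mul; first by apply/comp_exp2/comp_snd/comp_id.
  by apply/comp_succ/comp_double/comp_ctl/comp_fst/comp_id.
move=> p _ n; case: eqP => [->//|n0].
case dec_n: (CodeSeq.decode n) => [|a s].
  by case: n0; rewrite -[n]CodeSeq.decodeK dec_n.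
have def_n : n = 2 ^ a * (CodeSeq.code s).*2.+1.
  by rewrite -[n]CodeSeq.decodeK dec_n.
have /andP[a_le s_le] := code_cons_bound a (CodeSeq.code s).
rewrite /ctl /chd dec_n [behead _]/= [head _ _]/=.
apply: find_iota_uniq => [||a' /eqP]; first by rewrite def_n ltnS.
  by rewrite {1}def_n.
by move=> /(congr1 CodeSeq.decode); rewrite dec_n decode_cons => -[->].
Qed.

Lemma decode_iter_ctl n i :
  CodeSeq.decode (iteri i (fun _ => ctl) n) = drop i (CodeSeq.decode n).
Proof.
elim: i => [|i IHi]; first by rewrite drop0.
by rewrite /= /ctl IHi CodeSeq.codeK -drop1 drop_drop add1n.
Qed.

Lemma comp_iter_ctl F G :
  ucomputable D F -> ucomputable D G -> ucomputable D (fun p n => iteri (F p n) (fun _ => ctl) (G p n)).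
Proof.
move=> cF cG; apply: (comp_iteri (S := fun _ _ _ r => ctl r)) => //.
by apply/comp_ctl/comp_snd/comp_snd/comp_id.
Qed.

Lemma comp_cnth F G :
  ucomputable D F -> ucomputable D G -> ucomputable D (fun p n => cnth (F p n) (G p n)).
Proof.
move=> cF cG; have := comp_chd (comp_iter_ctl cG cF); move/comp_ext; apply.
by move=> p _ n; rewrite /chd decode_iter_ctl -nth0 nth_drop addn0.
Qed.

Lemma csize_le n : csize n <= n.
Proof.
rewrite -[in leqRHS](CodeSeq.decodeK n) /csize.
elim: (CodeSeq.decode n) => //= a s IHs.
by have := ltn_expl a (ltnSn 1); nia.
Qed.

Lemma decode_eq0 n : (n == 0) = (CodeSeq.decode n == [::]).
Proof. by rewrite -(can_eq CodeSeq.decodeK). Qed.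

Lemma comp_csize F : ucomputable D F -> ucomputable D (fun p n => csize (F p n)).
Proof.
apply: (comp_comp (F := fun _ n => csize n)).
apply: (@comp_ext D (fun _ n =>
  find (fun k => iteri k (fun _ => ctl) n == 0) (iota 0 n.+1))).
  apply: (comp_find (P := fun _ n k => iteri k (fun _ => ctl) n == 0)).
    by apply/comp_eq0/comp_iter_ctl; [apply/comp_snd|apply/comp_fst]; exact: comp_id.
  exact/comp_succ/comp_id.
move=> p _ n.
have eq0 k : (iteri k (fun _ => ctl) n == 0) = (csize n <= k).
  by rewrite decode_eq0 decode_iter_ctl -size_eq0 size_drop subn_eq0.
rewrite (eq_find eq0); case: (findP _ (iota 0 n.+1)) => [/hasPn/(_ n)|k].
  by rewrite mem_iota leqnn csize_le => /(_ isT).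
rewrite size_iota => kn /(_ 0); rewrite nth_iota // add0n => lek before.
apply/eqP; rewrite eqn_leq lek andbT leqNgt; apply/negP => ltk.
have := before 0 (csize n) ltk; rewrite nth_iota ?leqnn //.
exact: leq_trans ltk (ltnW kn).
Qed.

Lemma comp_cmk (f : baire -> nat -> nat -> nat) F :
  ucomputable D (fun p e => f p (pfst e) (psnd e)) -> ucomputable D F ->
  ucomputable D (fun p n => cmk (f p n) (F p n)).
Proof.
move=> cf cF; apply: (@comp_ext D (fun p n =>
  iteri (F p n) (fun j r => 2 ^ f p n (F p n - j.+1) * r.*2.+1) 0)).
  apply: (comp_iteri (S := fun p n j r => 2 ^ f p n (F p n - j.+1) * r.*2.+1)) => //.
    apply: comp_mul; last first.
      by apply/comp_succ/comp_double/comp_snd/comp_snd/comp_id.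
    apply: comp_exp2.
    have cj : ucomputable D (fun _ e => pfst (psnd e)) by apply/comp_fst/comp_snd/comp_id.
    have cn := comp_fst (comp_id D).
    have := comp_comp cf (comp_pair cn (comp_sub (comp_comp cF cn) (comp_succ cj))).
    by move/comp_ext; apply=> p _ n; rewrite !pairE.
  exact: comp_const.
move=> p _ n; rewrite /cmk /mkseq.
suff H k : k <= F p n ->
    iteri k (fun j r => 2 ^ f p n (F p n - j.+1) * r.*2.+1) 0 =
    CodeSeq.code (map (f p n) (iota (F p n - k) k)) by rewrite H // subnn.
elim: k => // k IHk ltk /=; rewrite IHk ?(ltnW ltk) //.
by have -> : (F p n - k.+1).+1 = F p n - k by lia.
Qed.

End CompSeq.

(** * Weihrauch reductions *)

(** Syntax-directed proofs of computability: the outermost operation of the value selects the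
    closure lemma. *)
Ltac comp1 :=
  cbv beta;
  lazymatch goal with
  | |- ucomputable ?D (fun _ n => n) => exact (@comp_id D)
  | |- ucomputable ?D (fun _ _ => ?k) => exact (@comp_const D k)
  | |- ucomputable ?D (fun p n => p (@?F p n)) => apply (@comp_oracle D F)
  | |- ucomputable ?D (fun p n => (@?F p n).+1) => apply (@comp_succ D F)
  | |- ucomputable ?D (fun p n => (@?F p n).-1) => apply (@comp_pred D F)
  | |- ucomputable ?D (fun p n => (@?F p n).*2) => apply (@comp_double D F)
  | |- ucomputable ?D (fun p n => (@?F p n)./2) => apply (@comp_half D F)
  | |- ucomputable ?D (fun p n => pfst (@?F p n)) => apply (@comp_fst D F)
  | |- ucomputable ?D (fun p n => psnd (@?F p n)) => apply (@comp_snd D F)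
  | |- ucomputable ?D (fun p n => cpair (@?F p n) (@?G p n)) => apply (@comp_pair D F G)
  | |- ucomputable ?D (fun p n => (@?F p n) + (@?G p n)) => apply (@comp_add D F G)
  | |- ucomputable ?D (fun p n => (@?F p n) - (@?G p n)) => apply (@comp_sub D F G)
  | |- ucomputable ?D (fun p n => (@?F p n) * (@?G p n)) => apply (@comp_mul D F G)
  | |- ucomputable ?D (fun p n => csize (@?F p n)) => apply (@comp_csize D F)
  | |- ucomputable ?D (fun p n => ctl (@?F p n)) => apply (@comp_ctl D F)
  | |- ucomputable ?D (fun p n => chd (@?F p n)) => apply (@comp_chd D F)
  | |- ucomputable ?D (fun p n => cnth (@?F p n) (@?G p n)) => apply (@comp_cnth D F G)
  | |- ucomputable ?D (fun p n => cmk (@?F p n) (@?G p n)) => apply (@comp_cmk D F G)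
  | |- ucomputable ?D (fun p n => match @?b p n with true => @?F p n | false => @?G p n end) =>
      apply (@comp_if D b F G)
  | |- ucomputable ?D (fun p n => nat_of_bool match @?b p n with true => @?F p n | false => @?G p n end) =>
      apply (@comp_ifb D b F G)
  | |- ucomputable ?D (fun p n => find (@?P p n) (iota 0 (@?B p n))) =>
      apply (@comp_find D P B)
  | |- ucomputable ?D (fun p n => nat_of_bool (has (@?P p n) (iota 0 (@?B p n)))) =>
      apply (@comp_has D P B)
  | |- ucomputable ?D (fun p n => nat_of_bool (all (@?P p n) (iota 0 (@?B p n)))) =>
      apply (@comp_all D P B)
  | |- ucomputable ?D (fun p n => nat_of_bool (~~ @?F p n)) => apply (@comp_neg D F)
  | |- ucomputable ?D (fun p n => nat_of_bool (@?F p n && @?G p n)) => apply (@comp_and D F G)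
  | |- ucomputable ?D (fun p n => nat_of_bool (@?F p n || @?G p n)) => apply (@comp_or D F G)
  | |- ucomputable ?D (fun p n => nat_of_bool (@?F p n ==> @?G p n)) => apply (@comp_implb D F G)
  | |- ucomputable ?D (fun p n => nat_of_bool (@?F p n == @?G p n)) => apply (@comp_eq D F G)
  | |- ucomputable ?D (fun p n => nat_of_bool (@?F p n <= @?G p n)) => apply (@comp_leq D F G)
  | |- ucomputable ?D (fun p n => nat_of_bool (odd (@?F p n))) => apply (@comp_odd D F)
  | |- ucomputable ?D (fun p n => least (@?P p n)) => apply (@comp_least D P)
  end.
Ltac comp := repeat comp1.

Lemma comp_sub_dom D E F : (forall p, D p -> E p) -> ucomputable E F -> ucomputable D F.
Proof. by move=> DE [c cF]; exists c => p /DE; exact: cF. Qed.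

(** Composition of functionals: every oracle query of [c] is answered by running [d]. *)
Fixpoint subst_oracle (d c : code) : code :=
  match c with
  | Oracle => d
  | Pair a b => Pair (subst_oracle d a) (subst_oracle d b)
  | Comp a b => Comp (subst_oracle d a) (subst_oracle d b)
  | PrimRec a b => PrimRec (subst_oracle d a) (subst_oracle d b)
  | Mu a => Mu (subst_oracle d a)
  | _ => c
  end.

Lemma eval_subst_oracle p q d c m n : (forall k, eval p d k (q k)) ->
  eval q c m n -> eval p (subst_oracle d c) m n.
Proof.
move=> dq; elim: c m n => [||||
  |a IHa b IHb|a IHa b IHb|a IHa b IHb|a IHa] m n //=.
- by move=> ->.
- by move=> [i [j [/IHa ai /IHb bj ->]]]; exists i, j.
- by move=> [k /IHb bk /IHa ak]; exists k.
- case: (Cantor.of_nat m) => x k; elim: k n => [|k IHk] n /=; first exact: IHa.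
  by move=> [r /IHk rr /IHb br]; exists r.
- by move=> [/IHa a0 lt]; split=> // k /lt[r /IHa ar]; exists r.
Qed.

Lemma comp_subst (D E : set baire) F G :
  ucomputable D F -> ucomputable E G -> (forall p, D p -> E (F p)) -> ucomputable D (fun p => G (F p)).
Proof.
move=> [d dF] [c cG] DE; exists (subst_oracle d c) => p Dp n.
by apply: (@eval_subst_oracle p (F p)); [exact: dF|apply: cG; exact: DE].
Qed.

Definition evenpart (p : baire) : baire := fun n => p n.*2.
Definition oddpart (p : baire) : baire := fun n => p n.*2.+1.

Lemma evenpart_interleave p q : evenpart (interleave p q) = p.
Proof.
by apply/funext => n; rewrite /evenpart /interleave odd_double doubleK.
Qed.

Lemma oddpart_interleave p q : oddpart (interleave p q) = q.
Proof.
by apply/funext => n; rewrite /oddpart /interleave /= odd_double uphalf_double.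
Qed.

Definition interleaveK := (evenpart_interleave, oddpart_interleave).

Lemma comp_evenpart D : ucomputable D evenpart.
Proof. by rewrite /evenpart; comp. Qed.

Lemma comp_oddpart D : ucomputable D oddpart.
Proof. by rewrite /oddpart; comp. Qed.

Lemma comp_interleave D F G :
  ucomputable D F -> ucomputable D G -> ucomputable D (fun p => interleave (F p) (G p)).
Proof.
move=> cF cG; rewrite /interleave; comp; [apply: comp_comp cG _|apply: comp_comp cF _].
  by comp.
by comp.
Qed.

Definition restrict (D : set baire) (F : baire -> baire) (p : baire) :=
  if pselect (D p) is left _ then Some (F p) else None.

Lemma restrictT D F p : D p -> restrict D F p = Some (F p).
Proof. by rewrite /restrict; case: pselect. Qed.

Lemma computable_restrict D F : ucomputable D F -> computable (restrict D F).
Proof.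
move=> [c cF]; exists c => p q; rewrite /restrict; case: pselect => // Dp [<-].
exact: cF.
Qed.

(** Allows the reductions to be handled through total functionals together with an explicit
    domain. *)
Lemma computableE F : computable F -> exists D G, ucomputable D G /\ F = restrict D G.
Proof.
move=> [c cF]; exists [set p | isSome (F p)], (fun p => odflt id (F p)); split.
  exists c => p /= Fp n; case def_q: (F p) Fp => [q|//] _ /=; exact: cF.
apply/funext => p; rewrite /restrict; case: pselect => /=; by case: (F p).
Qed.

Section Reductions.
Variables (X Y Z W : repSpace) (f : problem X Y) (g : problem Z W).

Lemma lesWE : lesW f g <-> exists (D E : set baire) (Phi Psi : baire -> baire),
  [/\ ucomputable D Phi, ucomputable E Psi & forall p x, name p x -> dom f x ->
    D p /\ exists z, [/\ name (Phi p) z, dom g z & forall q w, name q w ->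
      sol g z w -> E q /\ exists y, name (Psi q) y /\ sol f x y]].
Proof.
split=> [[F [G [/computableE[D [Phi [cPhi ->]]] /computableE[E [Psi [cPsi ->]]] red]]]|].
  exists D, E, Phi, Psi; split=> // p x px fx; have := red p x px fx.
  rewrite /restrict; case: pselect => [Dp|_] [r [z [//] [<-] rz gz sol_z]].
  split=> //; exists z; split=> // q w qw gw; have := sol_z q w qw gw.
  by case: pselect => [Eq|_] [s [y [//] [<-] sy fy]]; split=> //; exists y.
move=> [D [E [Phi [Psi [cPhi cPsi red]]]]].
exists (restrict D Phi), (restrict E Psi); split; try exact: computable_restrict.
move=> p x px fx; have [Dp [z [rz gz sol_z]]] := red p x px fx.
exists (Phi p), z; rewrite restrictT //; split=> // q w qw gw.
have [Eq [y [sy fy]]] := sol_z q w qw gw.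
by exists (Psi q), y; rewrite restrictT.
Qed.

Lemma leWE : leW f g <-> exists (D E : set baire) (Phi Psi : baire -> baire),
  [/\ ucomputable D Phi, ucomputable E Psi & forall p x, name p x -> dom f x ->
    D p /\ exists z, [/\ name (Phi p) z, dom g z & forall q w, name q w ->
      sol g z w -> E (interleave p q) /\
        exists y, name (Psi (interleave p q)) y /\ sol f x y]].
Proof.
split=> [[F [G [/computableE[D [Phi [cPhi ->]]] /computableE[E [Psi [cPsi ->]]] red]]]|].
  exists D, E, Phi, Psi; split=> // p x px fx; have := red p x px fx.
  rewrite /restrict; case: pselect => [Dp|_] [r [z [//] [<-] rz gz sol_z]].
  split=> //; exists z; split=> // q w qw gw; have := sol_z q w qw gw.
  by case: pselect => [Eq|_] [s [y [//] [<-] sy fy]]; split=> //; exists y.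
move=> [D [E [Phi [Psi [cPhi cPsi red]]]]].
exists (restrict D Phi), (restrict E Psi); split; try exact: computable_restrict.
move=> p x px fx; have [Dp [z [rz gz sol_z]]] := red p x px fx.
exists (Phi p), z; rewrite restrictT //; split=> // q w qw gw.
have [Eq [y [sy fy]]] := sol_z q w qw gw.
by exists (Psi (interleave p q)), y; rewrite restrictT.
Qed.

Lemma lesW_leW : lesW f g -> leW f g.
Proof.
move=> /lesWE[D [E [Phi [Psi [cPhi cPsi red]]]]]; apply/leWE.
exists D, [set r | E (oddpart r)], Phi, (fun r => Psi (oddpart r)); split=> //.
  by apply: comp_subst (comp_oddpart _) cPsi _.
move=> p x px fx; have [Dp [z [rz gz sol_z]]] := red p x px fx.
by split=> //; exists z; split=> // q w; rewrite /= oddpart_interleave; exact: sol_z.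
Qed.

End Reductions.

Lemma lesW_trans X Y Z W U V (f : problem X Y) (g : problem Z W) (h : problem U V) :
  lesW f g -> lesW g h -> lesW f h.
Proof.
move=> /lesWE[D [E [Phi [Psi [cPhi cPsi red]]]]].
move=> /lesWE[D' [E' [Phi' [Psi' [cPhi' cPsi' red']]]]]; apply/lesWE.
exists [set p | D p /\ D' (Phi p)], [set q | E' q /\ E (Psi' q)].
exists (fun p => Phi' (Phi p)), (fun q => Psi (Psi' q)); split.
- by apply: comp_subst cPhi' _ => [|p []//]; apply: comp_sub_dom cPhi => p [].
- by apply: comp_subst cPsi _ => [|p []//]; apply: comp_sub_dom cPsi' => p [].
move=> p x px fx; have [Dp [z [rz gz sol_z]]] := red p x px fx.
have [Dp' [z' [rz' gz' sol_z']]] := red' _ z rz gz.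
split=> //; exists z'; split=> // q w qw hw.
have [Eq' [y [sy gy]]] := sol_z' q w qw hw.
by have [Eq [y' sy']] := sol_z _ y sy gy; split=> //; exists y'.
Qed.

Lemma leW_trans X Y Z W U V (f : problem X Y) (g : problem Z W) (h : problem U V) :
  leW f g -> leW g h -> leW f h.
Proof.
move=> /leWE[D [E [Phi [Psi [cPhi cPsi red]]]]].
move=> /leWE[D' [E' [Phi' [Psi' [cPhi' cPsi' red']]]]]; apply/leWE.
(* For [r = interleave p q], [I r] joins the intermediate instance [Phi p] with the answer [q], and
   [J r] joins [p] with the resulting answer to that intermediate instance. *)
pose I r := interleave (Phi (evenpart r)) (oddpart r).
pose J r := interleave (evenpart r) (Psi' (I r)).
pose DI := [set r | [/\ D (evenpart r), E' (I r) & E (J r)]].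
have cI : ucomputable DI I.
  apply: comp_interleave (comp_oddpart _).
  by apply: comp_subst (comp_evenpart _) cPhi _ => p [].
have cJ : ucomputable DI J.
  apply: comp_interleave; first exact: comp_evenpart.
  by apply: comp_subst cI cPsi' _ => p [].
exists [set p | D p /\ D' (Phi p)], DI, (fun p => Phi' (Phi p)), (fun r => Psi (J r)).
split.
- by apply: comp_subst cPhi' _ => [|p []//]; apply: comp_sub_dom cPhi => p [].
- by apply: comp_subst cJ cPsi _ => p [].
move=> p x px fx; have [Dp [z [rz gz sol_z]]] := red p x px fx.
have [Dp' [z' [rz' gz' sol_z']]] := red' _ z rz gz.
split=> //; exists z'; split=> // q w qw hw.
have [Eq' [y [sy gy]]] := sol_z' q w qw hw.
have [Eq [y' [sy' fy']]] := sol_z _ y sy gy.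
rewrite /DI /J /I /= !interleaveK; split=> //.
by exists y'.
Qed.

Lemma lesW_prod_id X Y Z W (f : problem X Y) (g : problem Z W) :
  lesW f g -> lesW (prod_problem f id_problem) (prod_problem g id_problem).
Proof.
move=> /lesWE[D [E [Phi [Psi [cPhi cPsi red]]]]]; apply/lesWE.
exists [set p | D (evenpart p)], [set q | E (evenpart q)].
exists (fun p => interleave (Phi (evenpart p)) (oddpart p)).
exists (fun q => interleave (Psi (evenpart q)) (oddpart q)).
split; try by apply: comp_interleave (comp_oddpart _);
  apply: comp_subst (comp_evenpart _) _ _; [eassumption|].
move=> p [x a] [/= px pa] [/= fx _].
have [Dp [z [rz gz sol_z]]] := red _ x px fx.
split=> //; exists (z, a); split=> //.
  by split; rewrite -/(evenpart _) -/(oddpart _) interleaveK.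
move=> q [w b] [/= qw qb] [/= gw ba]; rewrite {b}ba in qb.
have [Eq [y [sy fy]]] := sol_z _ w qw gw; split=> //.
by exists (y, a); split=> //; split; rewrite -/(evenpart _) -/(oddpart _) interleaveK.
Qed.

(** The second factor needs some input; the name [p] itself is a computable choice. *)
Lemma lesW_prod_id_r X Y (f : problem X Y) : lesW f (prod_problem f id_problem).
Proof.
apply/lesWE; exists setT, setT, (fun p => interleave p p), evenpart; split.
- by apply: comp_interleave; apply/comp_oracle/comp_id.
- exact: comp_evenpart.
move=> p x px fx; split=> //; exists (x, p); split=> //=.
  by split; rewrite -/(evenpart _) -/(oddpart _) interleaveK.
by move=> q [y a] [/= qy _] [/= fxy _]; split=> //; exists y.
Qed.

Lemma cylinderP X Y (f : problem X Y) :
  lesW (prod_problem f id_problem) f -> cylinder f.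
Proof. by split=> //; exact: lesW_prod_id_r. Qed.

Lemma eqsW_cylinder X Y Z W (f : problem X Y) (g : problem Z W) :
  eqsW f g -> cylinder g -> cylinder f.
Proof.
move=> [fg gf] [_ gid]; apply: cylinderP.
exact: lesW_trans (lesW_prod_id fg) (lesW_trans gid gf).
Qed.

Lemma mkseqS T (f : nat -> T) n : mkseq f n.+1 = f 0 :: mkseq (fun i => f i.+1) n.
Proof. by rewrite /mkseq /= -[1]addn0 iotaDl -map_comp. Qed.

Lemma eq_in_mkseq T (f g : nat -> T) n :
  (forall i, i < n -> f i = g i) -> mkseq f n = mkseq g n.
Proof. by move=> fg; apply/eq_in_map => i; rewrite mem_iota => /fg. Qed.

(** * Names of closed sets *)

Section Trees.
Variable S : alphabet.
Implicit Types (T : set (seq S)) (x : seqspace S) (s : seq S).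

Definition scode s := CodeSeq.code (map (@enc S) s).

Lemma decode_scode s : CodeSeq.decode (scode s) = map (@enc S) s.
Proof. exact: CodeSeq.codeK. Qed.

Lemma scode_inj : injective scode.
Proof.
move=> s t /(congr1 CodeSeq.decode); rewrite !decode_scode.
by move/(inj_map (@enc_inj S)).
Qed.

Lemma char_fun_scode p T s : char_fun p T -> p (scode s) = `[< T s >].
Proof.
move=> ->; congr nat_of_bool; apply: asbool_equiv_eq; split=> [[t Tt]|Ts].
  by move/scode_inj ->.
by exists s.
Qed.

Lemma char_fun_eq1 p T n : char_fun p T -> p n == 1 -> exists2 s, T s & n = scode s.
Proof. by move=> ->; case: asboolP. Qed.

Lemma char_funE p T (t : nat -> bool) :
  (forall n, p n = t n) -> (forall s, T s -> t (scode s)) ->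
  (forall n, t n -> exists2 s, T s & n = scode s) -> char_fun p T.
Proof.
move=> pt Tt tT n; rewrite pt; congr nat_of_bool; apply/idP/asboolP => [/tT //|].
by move=> [s Ts ->]; exact: Tt.
Qed.

Lemma tree_mkseq T x m n : tree T -> m <= n -> T (mkseq x n) -> T (mkseq x m).
Proof.
move=> [_ clT] /subnKC <-; rewrite /mkseq iotaD map_cat; exact: clT.
Qed.

Lemma tree_nil T : tree T -> T [::].
Proof. by move=> [[s Ts] clT]; exact: (clT [::] s). Qed.

Lemma nbhs_mkseq x n : nbhs x [set y : seqspace S | mkseq y n = mkseq x n].
Proof.
elim: n => [|n IHn]; first by apply: filterE.
have : nbhs x ((proj n : seqspace S -> S) @^-1` [set x n]).
  apply: open_nbhs_nbhs; split=> //.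
  apply: (@open_comp _ _ (proj n : seqspace S -> S)) => [y _|].
    exact: proj_continuous.
  exact: discrete_open.
apply: filterS2 IHn => y yx1 yx2; rewrite /= -[n.+1]addn1 /mkseq !iotaD !map_cat /=.
by congr (_ ++ [:: _]).
Qed.

Lemma closed_paths T : closed (paths T).
Proof.
move=> x clTx n; have [y [Ty /= <-]] := clTx _ (nbhs_mkseq x n).
exact: Ty.
Qed.

Definition pathSet T : closedSet S := ClosedSet (closed_paths (T := T)).

Lemma pathSet_name p T : tree T -> char_fun p T -> closed_name p (pathSet T).
Proof. by exists T. Qed.

End Trees.

(** * Adjoining a coded point to a closed subset of Cantor space *)

Section Adjoin.

(* Coding [y] by its graph makes decoding a plain search, see [cgraph_decode]. *)
Definition cgraph (y : baire) : seqspace bool_alphabet :=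
  fun i => y (pfst i) == psnd i.

Definition bcons (b : bool) (x : seqspace bool_alphabet) : seqspace bool_alphabet :=
  fun i => if i is j.+1 then x j else b.

Definition btail (x : seqspace bool_alphabet) : seqspace bool_alphabet := fun i => x i.+1.

Lemma bconsK b : cancel (bcons b) btail.
Proof. by []. Qed.

Lemma btailK x : bcons (x 0) (btail x) = x.
Proof. by apply/funext => -[]. Qed.

Lemma cgraph_least y n : least (fun m => cgraph y (cpair n m)) = y n.
Proof.
have [|] := @leastP (fun m => cgraph y (cpair n m)).
  by exists (y n); rewrite /cgraph !pairE.
by rewrite {1}/cgraph !pairE => /eqP.
Qed.

(** The letter [true] leads into a copy of [T], the letter [false] onto the single branch
    [cgraph y]. *)
Definition adjoin_tree (T : set (seq bool)) (y : baire) : set (seq bool) :=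
  [set s | [\/ s = [::], exists2 t, T t & s = true :: t
           | exists n, s = false :: mkseq (cgraph y) n]].

(** Decides membership in [adjoin_tree]: [0] codes the empty string, and otherwise the head of the
    code selects the test. *)
Definition adjoin (p y : baire) : baire := fun n =>
  [|| n == 0, (chd n == 1) && (p (ctl n) == 1) |
   (chd n == 0) && all (fun i => cnth (ctl n) i == (y (pfst i) == psnd i))
                       (iota 0 (csize (ctl n)))].

Lemma scode_cons (S : alphabet) a (s : seq S) :
  ctl (scode (a :: s)) = scode s /\ chd (scode (a :: s)) = enc a.
Proof. by rewrite /ctl /chd decode_scode. Qed.

Lemma adjoin_tree_tree T y : tree (T : set (seq bool_alphabet)) ->
  tree (adjoin_tree T y : set (seq bool_alphabet)).
Proof.
move=> treeT; split; first by exists [::]; constructor.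
move=> [|b s] t; first by constructor.
case=> [//|[u Tu [-> def_u]]|[n [-> def_u]]]; [constructor 2|constructor 3].
  by exists s => //; apply: (treeT.2 s t); rewrite def_u.
exists (size s); congr (_ :: _).
have := congr1 (take (size s)) def_u; rewrite take_size_cat // => {1}->.
rewrite /mkseq -map_take take_iota; congr (map _ (iota _ _)).
by have := congr1 size def_u; rewrite size_cat size_mkseq => <-; apply/minn_idPl/leq_addr.
Qed.

Lemma adjoin_char (p y : baire) (T : set (seq bool_alphabet)) :
  tree T -> char_fun p T ->
  char_fun (adjoin p y) (adjoin_tree T y : set (seq bool_alphabet)).
Proof.
move=> treeT pT; apply: (char_funE (fun n => erefl)) => [s|n].
  case=> [->//|[t Tt ->]|[n ->]].
    have [-> ->] := scode_cons (S := bool_alphabet) true t.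
    by rewrite (char_fun_scode _ pT) asboolT // orbT.
  have [-> ->] := scode_cons (S := bool_alphabet) false (mkseq (cgraph y) n).
  apply/or3P/Or33; rewrite eqxx /= /csize /cnth decode_scode size_map size_mkseq.
  apply/allP => i; rewrite mem_iota => /andP[_ ilt].
  by rewrite (nth_map false) ?size_mkseq // nth_mkseq.
case/or3P => [/eqP->|/andP[/eqP hd1 ptl]|/andP[/eqP hd0 /allP gr]].
- by exists [::]; first constructor.
- have [t Tt tlE] := char_fun_eq1 pT ptl.
  exists (true :: t); first by constructor 2; exists t.
  rewrite -[n]CodeSeq.decodeK; congr CodeSeq.code; move: hd1 tlE; rewrite /chd /ctl.
  case: (CodeSeq.decode n) => //= a s -> /(congr1 CodeSeq.decode).
  by rewrite decode_scode CodeSeq.codeK => ->.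
(* The empty string also has [chd 0 = 0], by the default value of [head], so it has to be split off
   here. *)
have [->|n0] := eqVneq n 0; first by exists [::]; first constructor.
exists (false :: mkseq (cgraph y) (csize (ctl n))); first by constructor 3; eexists.
rewrite -[n in LHS]CodeSeq.decodeK; congr CodeSeq.code.
have := n0; rewrite decode_eq0; move: hd0 gr.
rewrite /chd /csize /cnth /ctl CodeSeq.codeK.
case: (CodeSeq.decode n) => //= a s -> gr _; congr (_ :: _).
apply: (@eq_from_nth _ 0) => [|i ilt]; first by rewrite size_map size_mkseq.
rewrite (nth_map false) ?size_mkseq // nth_mkseq //.
by apply/eqP/gr; rewrite mem_iota.
Qed.

Lemma adjoin_paths T y : tree (T : set (seq bool_alphabet)) ->
  paths (adjoin_tree T y : set (seq bool_alphabet)) =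
  bcons false (cgraph y) |` (bcons true @` paths (T : set (seq bool_alphabet))).
Proof.
move=> treeT; apply/seteqP; split=> [x Tx|x [->|[z Tz <-]] n]; last first.
- case: n => [|n]; first by constructor.
  by rewrite mkseqS; constructor 2; exists (mkseq z n); first exact: Tz.
- case: n => [|n]; first by constructor.
  by rewrite mkseqS; constructor 3; exists n.
rewrite -[x]btailK; case x0: (x 0); [right; exists (btail x) => // n|left].
  have := Tx n.+1; rewrite mkseqS x0 => -[//|[t Tt [->]]//|[m []//]].
congr bcons; apply/funext => n.
have := Tx n.+2; rewrite mkseqS x0 => -[//|[t _ []//]|[m [/[dup]]]].
move/(congr1 size); rewrite !size_mkseq => <- /(congr1 (nth false ^~ n)).
by rewrite !nth_mkseq.
Qed.

Definition adjoinSet (A : closedSet bool_alphabet) (y : baire) :=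
  bcons false (cgraph y) |` (bcons true @` pts A).

Lemma adjoin_name (p : baire) (A : closedSet bool_alphabet) y : closed_name p A ->
  exists2 B : closedSet bool_alphabet, closed_name (adjoin p y) B & pts B = adjoinSet A y.
Proof.
move=> [T [treeT pT TA]]; exists (@pathSet bool_alphabet (adjoin_tree T y)).
  by apply: pathSet_name; [exact: adjoin_tree_tree|exact: adjoin_char].
by rewrite /= adjoin_paths // TA.
Qed.

Lemma comp_adjoin D : ucomputable D (fun p => adjoin (evenpart p) (oddpart p)).
Proof. by rewrite /adjoin /evenpart /oddpart; comp. Qed.

End Adjoin.

(** * Lists in Cantor space *)

Section Cardinality.
Variable T : choiceType.
Implicit Types (A : set T) (s : seq T).

Lemma card_uniq s : uniq s -> [set` s] #= `I_(size s).
Proof.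
case: s => [_|x0 s uniq_s]; first by rewrite set_nil II0 card_eq00.
have -> : [set` x0 :: s] = nth x0 (x0 :: s) @` `I_(size (x0 :: s)).
  apply/seteqP; split=> [x /= xs|x [i ilt <-]]; last exact: mem_nth.
  by exists (index x (x0 :: s)); [rewrite /mkset index_mem|exact: nth_index].
apply: inj_card_eq => i j /set_mem ilt /set_mem jlt /eqP.
by rewrite nth_uniq // => /eqP.
Qed.

Lemma card_seqP A n :
  A #= `I_n <-> exists s, [/\ uniq s, size s = n & A = [set` s]].
Proof.
split=> [An|[s [uniq_s <- ->]]]; last exact: card_uniq.
have [s As] : exists s, A = [set` s] by apply/finite_seqP; exists n.
have {}As : A = [set` undup s] by rewrite As; apply/seteqP; split=> x /=; rewrite mem_undup.
exists (undup s); split=> //; first exact: undup_uniq.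
apply/card_eq_II; apply: card_eq_trans An; rewrite card_eq_sym As.
exact/card_uniq/undup_uniq.
Qed.

Lemma uniq_subset_finite A s n : uniq s -> [set` s] `<=` A -> A #= `I_n ->
  size s <= n /\ (size s = n -> A = [set` s]).
Proof.
move=> uniq_s sA /card_seqP[t [uniq_t <- At]].
have sub : {subset s <= t} by move=> x xs; have := sA x xs; rewrite At.
split=> [|sz]; first exact: uniq_leq_size.
rewrite At; apply/seteqP; split=> x /=; last exact: sub.
by rewrite (uniq_min_size uniq_s sub) // sz.
Qed.

End Cardinality.

(** Every pair of distinct members differs at some place; the depth is one more than the maximum of
    these places. *)
Lemma separating_depth (S : alphabet) (s : seq (seqspace S)) :
  exists d, forall x y, x \in s -> y \in s -> mkseq x d = mkseq y d -> x = y.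
Proof.
have [g gP] : exists g : seqspace S * seqspace S -> nat, forall xy,
    xy.1 <> xy.2 -> xy.1 (g xy) <> xy.2 (g xy).
  suff /choice[g gP] : forall xy : seqspace S * seqspace S,
    exists t, xy.1 <> xy.2 -> xy.1 t <> xy.2 t by exists g.
  move=> [x y] /=; have [->|xy] := pselect (x = y); first by exists 0.
  have /existsNP[t xyt] : ~ forall t, x t = y t by move=> /funext.
  by exists t.
exists (\max_(x <- s) \max_(y <- s) g (x, y)).+1 => x y xs ys xyd.
apply: contrapT => /(gP (x, y)) /= gxy; apply: gxy.
have lt_d : g (x, y) < (\max_(x <- s) \max_(y <- s) g (x, y)).+1.
  rewrite ltnS; apply: leq_trans (leq_bigmax_seq _ xs isT).
  exact: (leq_bigmax_seq _ ys isT).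
have := congr1 (fun t => nth point t (g (x, y))) xyd.
by rewrite !nth_mkseq.
Qed.

Section Separation.

(* [k] codes a finite sequence of pairwise distinct members of the list
   [(b, X)], together with a bound on the places where they differ.           *)
Definition sep (b : nat -> bool) (X : nat -> nat -> nat) (k : nat) : bool :=
  all (fun i => b (cnth (pfst k) i) && all (fun j =>
        has (fun t => X (cnth (pfst k) i) t != X (cnth (pfst k) j) t)
            (iota 0 (psnd k)))
      (iota 0 i))
    (iota 0 (csize (pfst k))).

Variables (S : alphabet) (u : rep_bseq S).
Variables (b : nat -> bool) (X : nat -> nat -> nat).
Hypothesis b_u : forall i, b i = (u i).1.
Hypothesis X_u : forall i t, b i -> X i t = enc ((u i).2 t).

Lemma sep_uniq k (s := [seq (u i).2 | i <- CodeSeq.decode (pfst k)]) :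
  sep b X k -> uniq s /\ [set` s] `<=` listed u.
Proof.
move=> /allP sepk; rewrite {}/s; set c := CodeSeq.decode _.
have sepn i : i < size c -> b (nth 0 c i) /\ forall j, j < i ->
    exists t, X (nth 0 c i) t != X (nth 0 c j) t.
  move=> ilt; have := sepk i; rewrite mem_iota => /(_ ilt)/andP[bi /allP sepi].
  split=> // j jlt; have := sepi j; rewrite mem_iota => /(_ jlt)/hasP[t _].
  by exists t.
split; last first.
  move=> x /mapP[_ /(nthP 0)[i ilt <-] ->]; exists (nth 0 c i) => //=.
  by rewrite -b_u; case: (sepn i ilt).
apply/(uniqP (u 0).2) => i j; rewrite !inE size_map.
wlog ij : i j / i < j => [hwlog ilt jlt|].
  have [lt_ij|lt_ji|//] := ltngtP i j; first exact: hwlog.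
  by move=> eq_ij; apply/esym/hwlog.
move=> ilt jlt; have [bj /(_ i ij)[t]] := sepn j jlt.
have [bi _] := sepn i ilt; rewrite !X_u // !(nth_map 0) // => /eqP Xt ut.
by case: Xt; rewrite ut.
Qed.

(** The certificate consists of positions of the members in the list and of a depth from
    [separating_depth]. *)
Lemma uniq_sep (s : seq (seqspace S)) : uniq s -> [set` s] `<=` listed u ->
  exists2 k, csize (pfst k) = size s & sep b X k.
Proof.
move=> uniq_s s_u.
have [f fP] : exists f : seqspace S -> nat, forall x, x \in s -> b (f x) /\ (u (f x)).2 = x.
  suff /choice[f fP] : forall x, exists i, x \in s -> b i /\ (u i).2 = x by exists f.
  move=> x; have [/s_u[i ui <-]|] := boolP (x \in s); last by exists 0.
  by exists i; rewrite b_u.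
have [d dP] := separating_depth s.
exists (cpair (CodeSeq.code (map f s)) d).
  by rewrite pfstE /csize CodeSeq.codeK size_map.
rewrite /sep !pairE /cnth /csize CodeSeq.codeK size_map.
apply/allP => i; rewrite mem_iota => /= ilt; rewrite add0n in ilt.
have x0 : seqspace S by case: (s) ilt.
rewrite (nth_map x0) //; have [bi ui] := fP _ (mem_nth x0 ilt); rewrite bi /=.
apply/allP => j; rewrite mem_iota add0n => /= jlt.
have jlt' := ltn_trans jlt ilt; rewrite (nth_map x0) //.
have [bj uj] := fP _ (mem_nth x0 jlt').
apply/hasP; apply: contrapT => eq_ij.
suff /eqP : nth x0 s i = nth x0 s j by rewrite nth_uniq // gtn_eqF.
apply: dP; [exact: mem_nth|exact: mem_nth|apply: eq_in_mkseq => t td].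
apply: contrapT => neq_t; apply: eq_ij; exists t; first by rewrite mem_iota.
by rewrite !X_u // ui uj; apply/eqP => /(@enc_inj S).
Qed.

End Separation.

Lemma bseq_nameP (S : alphabet) q (u : rep_bseq S) : name q u <->
  (forall i, q (cpair i 0) = (u i).1) /\
  (forall i n, q (cpair i n.*2.+1) = enc ((u i).2 n)).
Proof.
split=> [qu|[qb qX] i]; first by split=> [i|i n]; have [] := qu i.
by split=> [|n] /=; [exact: qb|exact: qX].
Qed.

(** Each entry of a name is itself an interleaving: its even places carry the bit, its odd places
    the point. *)
Definition bseq_of (b : nat -> nat) (X : nat -> nat -> nat) : baire := fun m =>
  if odd (psnd m) then X (pfst m) (psnd m)./2 else b (pfst m).

Lemma bseq_of_name (S : alphabet) (b : nat -> nat) X (u : rep_bseq S) :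
  (forall i, b i = (u i).1) -> (forall i n, X i n = enc ((u i).2 n)) ->
  name (bseq_of b X) u.
Proof.
move=> bu Xu; apply/bseq_nameP; split=> [i|i n]; rewrite /bseq_of !pairE //=.
by rewrite odd_double uphalf_double Xu.
Qed.

Lemma prod_nameI (X Y : repSpace) p q (x : X) (y : Y) :
  name p x -> name q y -> name (interleave p q : baire) ((x, y) : rep_prod X Y).
Proof. by split; rewrite -/(evenpart _) -/(oddpart _) interleaveK. Qed.

(** * Lists of an adjoined set and the strong reductions they yield *)

Lemma adjoinSet0 A y x : adjoinSet A y x -> x 0 = false -> x = bcons false (cgraph y).
Proof. by case=> // -[z _ <-]. Qed.

Lemma adjoinSet1 A y x : adjoinSet A y x -> x 0 = true -> pts A (btail x).
Proof. by case=> [->//|[z Az <-]]. Qed.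

Lemma adjoinSet_point A y : adjoinSet A y (bcons false (cgraph y)).
Proof. by left. Qed.

Lemma adjoinSet_bcons A y x : pts A x -> adjoinSet A y (bcons true x).
Proof. by right; exists x. Qed.

(** In row [n] of the graph only the bit at [y n] is set, so unbounded search finds it. The
    successor skips the leading letter [false]. *)
Lemma cgraph_decode (x y : baire) (g : nat -> nat) :
  (forall n, g n = bcons false (cgraph y) n) ->
  (forall n, exists m, g (cpair n m).+1 == 1) /\
  (fun n => least (fun m => g (cpair n m).+1 == 1)) = y.
Proof.
move=> gy; split=> [n|]; first by exists (y n); rewrite gy /= /cgraph !pairE eqxx.
apply/funext => n; rewrite -[RHS]cgraph_least; congr least.
by apply/funext => m; rewrite gy /=; case: cgraph.
Qed.

Lemma countable_adjoinSet A y : countable (pts A) -> countable (adjoinSet A y).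
Proof.
move=> /countable_injP[f f_inj]; apply/countable_injP.
exists (fun x => if x 0 then (f (btail x)).+1 else 0).
move=> _ _ /set_mem[->|[x Ax <-]] /set_mem[->|[z Az <-]] //= [].
by rewrite !bconsK => /f_inj -> //; exact: mem_set.
Qed.

Lemma finite_adjoinSet A y : finite_set (adjoinSet A y) <-> finite_set (pts A).
Proof.
split=> [fin|fin]; last by rewrite finite_setU; split=> //; exact: finite_image.
apply: sub_finite_set (finite_image btail fin) => x Ax.
by exists (bcons true x) => //; exact: adjoinSet_bcons.
Qed.

Lemma card_adjoinSet A y n : adjoinSet A y #= `I_n ->
  0 < n /\ pts A #= `I_n.-1.
Proof.
move=> An; have /finite_adjoinSet[k Ak] : finite_set (adjoinSet A y) by exists n.
suff nE : n = k.+1 by rewrite nE.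
have [s [uniq_s <- As]] := (card_seqP _ _).1 Ak.
apply/card_eq_II; rewrite card_eq_sym in An; apply: card_eq_trans An _.
apply/card_seqP; exists (bcons false (cgraph y) :: map (bcons true) s).
split=> /=; last first.
- apply/seteqP; split=> x; rewrite /adjoinSet As /= inE.
    by move=> [->|[z zs <-]]; rewrite ?eqxx // map_f // orbT.
  by move=> /orP[/eqP ->|/mapP[z zs ->]]; [left|right; exists z].
- by rewrite size_map.
rewrite (map_inj_uniq (can_inj (bconsK _))) uniq_s andbT.
by apply/mapP => -[z _ /(congr1 (fun x => x 0))].
Qed.

(** Entries with bit 0 are replaced by the first entry with bit 1, which exists because the set is
    nonempty. *)
Lemma wList_le_omega_wList : lesW wList_le_omega (wList bool_alphabet).
Proof.
pose i0 (q : baire) := least (fun i => q (cpair i 0) == 1).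
pose Psi (q : baire) : baire := fun m => if q (cpair (pfst m) 0) == 1
  then q (cpair (pfst m) (psnd m).*2.+1) else q (cpair (i0 q) (psnd m).*2.+1).
apply/lesWE; exists setT, [set q | exists i, q (cpair i 0) == 1], id, Psi; split.
- exact/comp_oracle/comp_id.
- by rewrite /Psi /i0; comp.
move=> p A pA [cA A0]; split=> //; exists A; split=> // q u /bseq_nameP[qb qX] Au.
have Eq : exists i, q (cpair i 0) == 1.
  by move: A0; rewrite Au => -[x [i ui _]]; exists i; rewrite qb ui.
split=> //; have [+ _] := leastP Eq; rewrite -/(i0 q) qb eqb1 => ui0.
exists (fun i => if (u i).1 then (u i).2 else (u (i0 q)).2); split=> [i n|].
  by rewrite /Psi !pairE qb eqb1; case: ifP => _; rewrite qX.
rewrite /= Au; apply/seteqP; split=> x; first by move=> [i /= ui <-]; exists i; rewrite ?ui.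
by move=> [i _ <-]; case: ifP => ui; [exists i|exists (i0 q)].
Qed.

(** The adjoined point makes every instance nonempty. In a list of the adjoined set, the first
    letter of an entry becomes its bit and the tail its point, while [y] is decoded from the first
    entry that begins with [false]. *)
Lemma wList_prod_id_wList_le_omega :
  lesW (prod_problem (wList bool_alphabet) id_problem) wList_le_omega.
Proof.
pose i0 (q : baire) := least (fun i => q (cpair i 0) == 0).
pose Psi (q : baire) : baire := interleave
  (bseq_of (fun i => q (cpair i 0)) (fun i n => q (cpair i n.+1)))
  (fun n => least (fun m => q (cpair (i0 q) (cpair n m).+1) == 1)).
pose E := [set q : baire | (exists i, q (cpair i 0) == 0) /\
  forall n, exists m, q (cpair (i0 q) (cpair n m).+1) == 1].
apply/lesWE; exists setT, E, (fun p => adjoin (evenpart p) (oddpart p)), Psi; split.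
- exact: comp_adjoin.
- rewrite /Psi /bseq_of /i0; apply: comp_interleave; comp => p [] //.
move=> p [A y] [/= pA py] [/= cA _]; split=> //.
have [B pB BE] := adjoin_name (oddpart p) pA; exists B.
have {}py : oddpart p = y by apply/funext => n; exact: py.
rewrite py in BE; split=> //.
  by rewrite /= BE; split; [exact: countable_adjoinSet|eexists; exact: adjoinSet_point].
move=> q w qw /= Bw; have {}qw i n : q (cpair i n) = w i n :> nat by exact: qw.
have wB i : adjoinSet A y (w i) by rewrite -BE Bw; exists i.
have [|i0E _] := @leastP (fun i => q (cpair i 0) == 0).
  have : adjoinSet A y (bcons false (cgraph y)) by exact: adjoinSet_point.
  by rewrite -BE Bw => -[i _ wi]; exists i; rewrite qw wi.
rewrite -/(i0 q) qw eqb0 in i0E.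
have wi0 := adjoinSet0 (wB (i0 q)) (negbTE i0E).
have [Eq decy] := @cgraph_decode y y (fun n => q (cpair (i0 q) n))
  (fun n => etrans (qw _ n) (congr1 (fun x => nat_of_bool (x n)) wi0)).
split; first by split=> //; exists (i0 q); rewrite qw eqb0.
exists ((fun i => (w i 0, btail (w i))), y); split.
  apply: prod_nameI; last by rewrite decy.
  by apply: bseq_of_name => [i|i n]; rewrite qw.
split=> //=; apply/seteqP; split=> x.
  move=> /(adjoinSet_bcons y); rewrite -BE Bw => -[i _ wi].
  by exists i; rewrite /= wi.
by move=> [i /= wi <-]; apply: adjoinSet1 (wB i) _.
Qed.

(** The adjoined point raises a finite cardinality by one, so the predecessor of the announced
    number is correct. A finite adjoined set announces at least 2, hence no clash with the code 0
    for infinite sets, and [0.-1 = 0] keeps that code. *)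
Lemma List_prod_id_List :
  lesW (prod_problem (List bool_alphabet) id_problem) (List bool_alphabet).
Proof.
pose first0 (q : baire) i := (q (cpair i 0).*2.+1 == 1) && (q (cpair i 1).*2.+1 == 0).
pose i0 (q : baire) := least (first0 q).
pose Psi (q : baire) : baire := interleave
  (interleave (fun _ => (q 0).-1)
     (bseq_of (fun i => (q (cpair i 0).*2.+1 == 1) && (q (cpair i 1).*2.+1 == 1))
        (fun i n => q (cpair i n.+1.*2.+1).*2.+1)))
  (fun n => least (fun m => q (cpair (i0 q) (cpair n m).+1.*2.+1).*2.+1 == 1)).
pose E := [set q : baire | (exists i, first0 q i) /\
  forall n, exists m, q (cpair (i0 q) (cpair n m).+1.*2.+1).*2.+1 == 1].
apply/lesWE; exists setT, E, (fun p => adjoin (evenpart p) (oddpart p)), Psi; split.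
- exact: comp_adjoin.
- rewrite /Psi /bseq_of /i0 /first0.
  apply: comp_interleave; first by apply: comp_interleave; comp.
  by comp => p [].
move=> p [A y] [/= pA py] [/= cA _]; split=> //.
have [B pB BE] := adjoin_name (oddpart p) pA; exists B.
have {}py : oddpart p = y by apply/funext => n; exact: py.
rewrite py in BE; split=> //; first by rewrite /= BE; exact: countable_adjoinSet.
move=> q [n u] [/= qn /bseq_nameP[qb qX]] /= [Bu Bn]; simpl in Bu, Bn.
have uB i : (u i).1 -> adjoinSet A y (u i).2 by rewrite -BE Bu => ui; exists i.
have first0E i : first0 q i = (u i).1 && ~~ (u i).2 0.
  by rewrite /first0 qb eqb1 -[1]/(0.*2.+1) qX eqb0.
have [|i0E _] := @leastP (first0 q).
  have : adjoinSet A y (bcons false (cgraph y)) by exact: adjoinSet_point.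
  by rewrite -BE Bu => -[i /= ui wi]; exists i; rewrite first0E ui wi.
have := i0E; rewrite -/(i0 q) first0E => /andP[/uB ui0B ui00].
have ui0 := adjoinSet0 ui0B (negbTE ui00).
have [Eq decy] := @cgraph_decode y y (fun n => q (cpair (i0 q) n.*2.+1).*2.+1)
  (fun n => etrans (qX _ n) (congr1 (fun x => nat_of_bool (x n)) ui0)).
split; first by split=> //; exists (i0 q).
exists ((n.-1, (fun i => ((u i).1 && (u i).2 0, btail (u i).2))), y); split.
  apply: prod_nameI; last by rewrite decy.
  apply: prod_nameI; first by rewrite /= -qn.
  apply: bseq_of_name => [i|i k]; rewrite /= ?qX //.
  by rewrite qb -[1]/(0.*2.+1) qX !eqb1.
split=> //=; split=> /=; last first.
  rewrite BE in Bn; case: Bn => [[-> Binf]|[n0 Bn]].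
    left; split=> //; apply: eq_card_nat => // /finite_adjoinSet => /(_ y) finB.
    by apply: infinite_nat; case: finB => k Bk; exists k;
      rewrite card_eq_sym in Binf; exact: card_eq_trans Binf Bk.
  by right; have := card_adjoinSet Bn; rewrite subn1; case: (n) n0 => [//|[|k]] _ [];
    rewrite ?subn1.
apply/seteqP; split=> x.
  move=> /(adjoinSet_bcons y); rewrite -BE Bu => -[i /= ui wi].
  by exists i; rewrite /= wi ?ui.
by move=> [i /= /andP[/uB uiB ui1] <-]; apply: adjoinSet1 uiB _.
Qed.

Lemma fseq_nameP (S : alphabet) q (s : seq (seqspace S)) x0 :
  name q (s : rep_fseq (rep_seqspace S)) <->
  q 0 = size s /\
  forall i n, i < size s -> q (cpair i n).+1 = enc (nth x0 s i n).
Proof.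
split=> [[q0 qs]|[q0 qs]]; split=> //.
  move=> i n ilt; apply: (qs i (nth x0 s i)).
  by rewrite onthE (nth_map x0).
move=> i x; rewrite onthE; have [ilt|ige] := ltnP i (size s); last first.
  by rewrite nth_default ?size_map.
by rewrite (nth_map x0) // => -[<-] n; exact: qs.
Qed.

Definition fseq_of (k : nat) (X : nat -> nat -> nat) : baire := fun m =>
  if m == 0 then k else X (pfst m.-1) (psnd m.-1).

Lemma fseq_of_name (S : alphabet) k X (s : seq (seqspace S)) x0 :
  k = size s -> (forall i n, i < size s -> X i n = enc (nth x0 s i n)) ->
  name (fseq_of k X) (s : rep_fseq (rep_seqspace S)).
Proof.
move=> ks Xs; apply/(fseq_nameP _ _ x0); split=> // i n ilt.
by rewrite /fseq_of /= !pairE Xs.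
Qed.

(** A finite list carries no bits, so the adjoined point cannot be masked: its occurrences are
    overwritten by the first entry that begins with [true], and if there is none the answer is the
    empty list. *)
Lemma List_lt_omega_prod_id :
  lesW (prod_problem List_lt_omega id_problem) List_lt_omega.
Proof.
pose hd (q : baire) i := q (cpair i 0).+1.
pose i0 (q : baire) := find (fun i => hd q i == 0) (iota 0 (q 0)).
pose i1 (q : baire) := find (fun i => hd q i == 1) (iota 0 (q 0)).
pose Psi (q : baire) : baire := interleave
  (fseq_of (if has (fun i => hd q i == 1) (iota 0 (q 0)) then q 0 else 0)
     (fun i n => if hd q i == 1 then q (cpair i n.+1).+1 else q (cpair (i1 q) n.+1).+1))
  (fun n => least (fun m => q (cpair (i0 q) (cpair n m).+1).+1 == 1)).
pose E := [set q : baire | forall n, exists m, q (cpair (i0 q) (cpair n m).+1).+1 == 1].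
apply/lesWE; exists setT, E, (fun p => adjoin (evenpart p) (oddpart p)), Psi; split.
- exact: comp_adjoin.
- rewrite /Psi /fseq_of /i0 /i1 /hd; apply: comp_interleave; first by comp.
  by comp => p.
move=> p [A y] [/= pA py] [/= finA _]; split=> //.
have [B pB BE] := adjoin_name (oddpart p) pA; exists B.
have {}py : oddpart p = y by apply/funext => n; exact: py.
rewrite py in BE; split=> //; first by rewrite /= BE; apply/finite_adjoinSet.
move=> q s /(fseq_nameP _ _ (bcons false (cgraph y)))[q0 qs] /= Bs.
set x0 := bcons false (cgraph y) in qs *.
have sB x : x \in s -> adjoinSet A y x by rewrite -BE Bs.
have hdE i : i < size s -> hd q i = nth x0 s i 0 by exact: qs.
have i0lt : i0 q < size s.
  have : adjoinSet A y x0 by exact: adjoinSet_point.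
  rewrite -BE Bs => /(nthP x0)[i ilt ix].
  rewrite -[ltnRHS]q0 -[ltnRHS](size_iota 0) -has_find; apply/hasP; exists i.
    by rewrite mem_iota q0.
  by rewrite hdE // ix.
have i0E : nth x0 s (i0 q) = x0.
  apply: adjoinSet0; first exact/sB/mem_nth.
  have := nth_find 0 (a := fun i => hd q i == 0) (s := iota 0 (q 0)).
  rewrite has_find size_iota -/(i0 q) q0 i0lt nth_iota // => /(_ isT).
  by rewrite hdE // eqb0 => /negbTE.
have [Eq decy] := @cgraph_decode y y (fun n => q (cpair (i0 q) n).+1)
  (fun n => etrans (qs _ n i0lt) (congr1 (fun x => nat_of_bool (x n)) i0E)).
split=> //.
pose h1 := has (fun i => hd q i == 1) (iota 0 (q 0)).
have h1P : reflect (exists2 x, x \in s & x 0) h1.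
  apply: (iffP hasP) => [[i]|[x /(nthP x0)[i ilt <-] ix]].
    rewrite mem_iota q0 => /= ilt; rewrite hdE // eqb1 => ix.
    by exists (nth x0 s i); first exact: mem_nth.
  by exists i; rewrite ?mem_iota ?q0 // hdE // ix.
have i1P : h1 -> i1 q < size s /\ nth x0 s (i1 q) 0.
  move=> h1T; have i1lt : i1 q < size s.
    by rewrite -[ltnRHS]q0 -[ltnRHS](size_iota 0) -has_find.
  split=> //; have := nth_find 0 h1T; rewrite nth_iota -/(i1 q) ?q0 //.
  by rewrite hdE // eqb1.
pose t := if h1 then
  [seq btail (if x 0 then x else nth x0 s (i1 q)) | x <- s] else [::].
exists (t, y); split; last first.
  split=> //=; apply/seteqP; split=> x.
    move=> /(adjoinSet_bcons y); rewrite -BE Bs => /= xs.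
    have h1T : h1 by apply/h1P; exists (bcons true x).
    by rewrite /t h1T; apply/mapP; exists (bcons true x).
  rewrite /t /=; case: ifP => // /i1P[i1lt i1E] /mapP[z zs ->].
  have [z0|_] := boolP (z 0); first by apply: adjoinSet1 z0; exact: sB.
  by apply: adjoinSet1 i1E; apply/sB/mem_nth.
apply: prod_nameI; last by rewrite decy.
apply: (fseq_of_name (x0 := x0)); first by rewrite -/h1 /t; case: ifP; rewrite ?size_map.
rewrite /t; case: ifP => // h1T i n; rewrite size_map => ilt.
rewrite (nth_map x0) // hdE // eqb1.
by case: ifP => _; rewrite qs //; case: (i1P h1T).
Qed.

(** Since the cardinality is announced, one can search for a certificate of that many pairwise
    distinct members; they exhaust the set. *)
Lemma List_lt_omega_List : lesW List_lt_omega (List bool_alphabet).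
Proof.
pose b (q : baire) i := q (cpair i 0).*2.+1 == 1.
pose X (q : baire) i t := q (cpair i t.*2.+1).*2.+1.
pose P (q : baire) k := (csize (pfst k) == (q 0).-1) && sep (b q) (X q) k.
pose w (q : baire) := least (P q).
pose Psi (q : baire) : baire :=
  fseq_of (q 0).-1 (fun i n => X q (cnth (pfst (w q)) i) n).
apply/lesWE; exists setT, [set q | exists k, P q k], id, Psi; split.
- exact/comp_oracle/comp_id.
- by rewrite /Psi /fseq_of /w /P /sep /X /b; comp.
move=> p A pA finA; split=> //; exists A; split=> //=; first exact: finite_set_countable.
move=> q [n u] [/= qn /bseq_nameP[qb qX]] [/= Au An].
have {An} [n0 An] : 0 < n /\ pts A #= `I_n.-1.
  case: An => [[_ Ainf]|[n0]]; last by rewrite subn1.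
  by case: finA => k Ak; case: infinite_nat; exists k; rewrite card_eq_sym in Ainf;
    exact: card_eq_trans Ainf Ak.
have bu i : b q i = (u i).1 by rewrite /b qb eqb1.
have Xu i t : b q i -> X q i t = enc ((u i).2 t : bool_alphabet) by rewrite /X qX.
have Eq : exists k, P q k.
  have [s [uniq_s size_s As]] := (card_seqP _ _).1 An.
  have s_u : [set` s] `<=` @listed bool_alphabet u by rewrite -Au As.
  have [k ks sepk] := @uniq_sep bool_alphabet u _ _ bu Xu _ uniq_s s_u.
  by exists k; rewrite /P ks size_s -qn eqxx.
split=> //; have [/andP[/eqP wn /(@sep_uniq bool_alphabet u _ _ bu Xu)[]]] := leastP Eq.
rewrite -/(w q) in wn *; set s := map _ _ => uniq_s s_u _.
have size_s : size s = n.-1 by rewrite size_map -/(csize _) wn qn.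
exists s; split; last first.
  rewrite -Au in s_u; have [_] := uniq_subset_finite uniq_s s_u An.
  exact.
apply: (@fseq_of_name bool_alphabet _ _ _ (u 0).2); first by rewrite size_s qn.
by move=> i k; rewrite size_map => ilt; rewrite /X qX (nth_map 0).
Qed.

Lemma wList_List (S : alphabet) : lesW (wList S) (List S).
Proof.
apply/lesWE; exists setT, setT, id, oddpart; split.
- exact/comp_oracle/comp_id.
- exact: comp_oddpart.
move=> p A pA cA; split=> //; exists A; split=> // q [n u] [/= _ qu] [/= Au _].
by split=> //; exists u.
Qed.

Lemma UC_wList : lesW UC_baire (wList nat_alphabet).
Proof.
pose Psi (q : baire) : baire := fun n =>
  q (cpair (least (fun i => q (cpair i 0) == 1)) n.*2.+1).
apply/lesWE; exists setT, [set q | exists i, q (cpair i 0) == 1], id, Psi; split.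
- exact/comp_oracle/comp_id.
- by rewrite /Psi; comp.
move=> p A pA /= [x Ax]; split=> //; exists A; split=> //.
  by rewrite /= Ax; exact: countable1.
move=> q u /bseq_nameP[qb qX] /= Au.
have Eq : exists i, q (cpair i 0) == 1.
  have : pts A x by rewrite Ax.
  by rewrite Au => -[i /= ui _]; exists i; rewrite qb ui.
split=> //; have [+ _] := leastP Eq; rewrite qb eqb1 => ui.
exists (u (least (fun i => q (cpair i 0) == 1))).2; split=> [n|].
  by rewrite /Psi qX.
have : pts A (u (least (fun i => q (cpair i 0) == 1))).2 by rewrite Au; eexists; eauto.
by rewrite /= Ax => /= ->.
Qed.

(** The entries at even places, [uphalf (size s)] of them, form a node of [T]; those at odd places
    follow [y]. *)
Definition interleave_tree (T : set (seq nat)) (y : baire) : set (seq nat) :=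
  [set s | T (mkseq (fun i => nth 0 s i.*2) (uphalf (size s))) /\
           forall i, i < size s -> odd i -> nth 0 s i = y i./2].

Lemma mkseq_evens (s t : seq nat) : prefix s t ->
  mkseq (fun i => nth 0 s i.*2) (uphalf (size s)) =
  mkseq (fun i => nth 0 t i.*2) (uphalf (size s)).
Proof.
move=> /prefixP[r ->]; apply: eq_in_mkseq => i ilt.
by rewrite nth_cat ifT //; lia.
Qed.

(** If [x] is the unique path of [T], then [interleave x y] is the unique path of the interleaved
    tree, and it is already a name of the pair. *)
Lemma UC_prod_id_UC : lesW (prod_problem UC_baire id_problem) UC_baire.
Proof.
pose Phi (p : baire) : baire := fun n =>
  (p (cmk (fun i => cnth n i.*2) ((csize n).+1./2)).*2 == 1) &&
  all (fun i => ~~ odd i || (cnth n i == p i./2.*2.+1)) (iota 0 (csize n)).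
apply/lesWE; exists setT, setT, Phi, id; split.
- by rewrite /Phi; comp.
- exact/comp_oracle/comp_id.
move=> p [A y] [/= [T [treeT pT TA]] py] [/= [x Ax] _]; split=> //.
have {}py n : p n.*2.+1 = y n by exact: py.
pose U : set (seq nat_alphabet) := interleave_tree T y.
have pU : char_fun (Phi p) U.
  have test n : (p (cmk (fun i => cnth n i.*2) ((csize n).+1./2)).*2 == 1) &&
      all (fun i => ~~ odd i || (cnth n i == p i./2.*2.+1)) (iota 0 (csize n)) <->
      U (CodeSeq.decode n).
    have := @char_fun_scode nat_alphabet _ _ (mkseq (fun i => cnth n i.*2) ((csize n).+1./2)) pT.
    rewrite /scode map_id => ->; rewrite eqb1; split=> [/andP[/asboolP Tn /allP odds]|].
      split=> // i ilt oddi; have := odds i; rewrite mem_iota => /(_ ilt).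
      by rewrite oddi /= py => /eqP.
    move=> [Tn odds]; apply/andP; split; first exact/asboolP.
    apply/allP => i; rewrite mem_iota => /= ilt; rewrite -implybE; apply/implyP => oddi.
    by rewrite py; apply/eqP; exact: odds.
  apply: (char_funE (fun n => erefl)) => [s Us|n /test Un].
    by apply/test; rewrite decode_scode map_id.
  by exists (CodeSeq.decode n) => //; rewrite /scode map_id CodeSeq.decodeK.
have treeU : tree U.
  split; first by exists [::]; split=> //; exact: tree_nil treeT.
  move=> s t [Tst odds]; split.
    rewrite (mkseq_evens (prefix_prefix s t)).
    by apply: tree_mkseq treeT _ Tst; rewrite size_cat; lia.
  move=> i ilt oddi; rewrite -odds ?size_cat ?nth_cat ?ilt //; lia.
have pathsU z : paths U z <-> pts A (evenpart z) /\ oddpart z = y.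
  rewrite -TA; split=> [Uz|[Tz zy] n].
    split=> [n|].
      have [+ _] := Uz n.*2; rewrite size_mkseq uphalf_double.
      rewrite (@eq_in_mkseq _ _ (evenpart z)) // => i ilt.
      by rewrite nth_mkseq; [|lia].
    apply/funext => n; have [_ /(_ n.*2.+1)] := Uz n.+1.*2.
    rewrite size_mkseq nth_mkseq /=; last by lia.
    by rewrite odd_double uphalf_double /oddpart => -> //; lia.
  split.
    rewrite size_mkseq; have := Tz (uphalf n).
    rewrite (@eq_in_mkseq _ (evenpart z) (fun i => nth 0 (mkseq z n) i.*2)) // => i ilt.
    by rewrite nth_mkseq; [|lia].
  move=> i; rewrite size_mkseq => ilt oddi; rewrite nth_mkseq // -zy /oddpart.
  by congr z; have := odd_double_half i; lia.
have dUC : pts (pathSet U) = [set (interleave x y : seqspace nat_alphabet)].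
  apply/seteqP; split=> z.
    move=> /pathsU; rewrite Ax => -[/= <- <-]; apply/funext => n.
    by rewrite /interleave /evenpart /oddpart; case: ifP => oddn; congr z;
      have := odd_double_half n; lia.
  by move=> /= ->; apply/pathsU; rewrite !interleaveK Ax.
exists (pathSet U); split; first exact: pathSet_name; first by eexists; exact: dUC.
move=> q z qz zE; split=> //.
have {}qz : q = z by apply/funext => n; exact: qz.
have {}zE : z = interleave x y.
  by have : pts (pathSet U) z; [rewrite [pts _]zE|rewrite dUC].
exists (x, y); split.
  rewrite qz zE; split; first by rewrite -/(evenpart _) interleaveK.
  by rewrite -/(oddpart _) interleaveK.
by split=> //=; rewrite Ax.
Qed.

(** * Listing the paths of a countable tree *)

Section RankComparison.

(* [split s t0 t1]: the nodes [t0] and [t1] are incompatible extensions of [s]. *)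
Variable split : nat -> nat -> nat -> Prop.
Hypothesis split_trans : forall s t0 t1 a b, split s t0 t1 -> split t0 a b -> split s a b.

Definition derivative (X : set nat) : set nat :=
  [set s | exists t0 t1, [/\ split s t0 t1, X t0 & X t1]].

(** For the nodes of a tree this excludes a perfect subtree, and so expresses that there are only
    countably many paths. *)
Hypothesis scattered : forall X, X `<=` derivative X -> X = set0.

(* Countable ordinals suffice, as there are only countably many nodes.        *)
Inductive ord := OZero | OLim of (nat -> ord).

(** [OLim f] acts as the least ordinal above all [f n]; a constant family gives the successor. *)
Fixpoint Der (a : ord) : set nat :=
  if a is OLim f then [set s | forall n, derivative (Der (f n)) s] else setT.

Lemma derivative_mono X Y : X `<=` Y -> derivative X `<=` derivative Y.
Proof. by move=> XY s [t0 [t1 [st /XY Yt0 /XY Yt1]]]; exists t0, t1. Qed.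

Lemma derivative_Der a : derivative (Der a) `<=` Der a.
Proof.
case: a => [//|f] s [t0 [t1 [st Dt0 _]]] n.
by have [a [b [tab Da Db]]] := Dt0 n; exists a, b; split=> //; exact: split_trans st tab.
Qed.

(** Linearity of the stages without an order on [ord]: the first case says that [b] is strictly
    beyond [a], the second that it is not. *)
Lemma Der_cmp a b : Der b `<=` derivative (Der a) \/ Der a `<=` Der b.
Proof.
(* The comparison is proved in both directions at once, as the induction on [c] uses each for the
   other. *)
suff cmp c : forall d, (Der d `<=` derivative (Der c) \/ Der c `<=` Der d) /\
    (Der c `<=` derivative (Der d) \/ Der d `<=` Der c).
  exact: (cmp a b).1.
elim: c => [|f IHf] d.
  split; last by right.
  elim: d => [|g IHg]; first by right.
  have [sub|/existsNP[m nsub]] := pselect (forall m, setT `<=` derivative (Der (g m))).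
    by right=> s _ n; exact: sub.
  left=> s /(_ m); apply: derivative_mono; by [].
have cmp2 e : Der (OLim f) `<=` derivative (Der e) \/ Der e `<=` Der (OLim f).
  have [sub|/existsNP[m nsub]] := pselect (forall m, Der e `<=` derivative (Der (f m))).
    by right=> s es n; exact: sub.
  left=> s /(_ m); apply: derivative_mono.
  by have [[//|]] := IHf m e.
split; last exact: cmp2.
case: d => [|g]; first by right.
have [sub|/existsNP[m nsub]] :=
  pselect (forall m, Der (OLim f) `<=` derivative (Der (g m))).
  by right=> s fs n; exact: sub.
left=> s /(_ m); apply: derivative_mono.
by have [|] := cmp2 (g m).
Qed.

(** The intersection [K] of all stages is itself reached: each of the countably many nodes outside
    [K] misses some stage, and [OLim] of these stages is contained in [K]. One more step shows that
    [K] lies in its own derivative. *)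
Lemma Der_exhaust s : exists a, ~ Der a s.
Proof.
pose K := [set s | forall a, Der a s].
suff K0 : K = set0 by apply/existsNP => Ds; have : K s by []; rewrite K0.
apply: scattered => t Kt.
have [f fP] : exists f : nat -> ord, forall r, ~ K r -> ~ Der (f r) r.
  suff /choice[f fP] : forall r, exists a, ~ K r -> ~ Der a r by exists f.
  move=> r; have [Kr|/existsNP[a Da]] := pselect (K r); first by exists OZero.
  by exists a.
have Df : Der (OLim f) `<=` K.
  by move=> r Dr; apply: contrapT => /fP; apply; exact/derivative_Der/Dr.
have := Kt (OLim (fun _ => OLim f)) => /(_ 0).
exact: derivative_mono.
Qed.

(* [rank_lt r s]: the rank of [r] is less than that of [s].                   *)
Definition rank_lt r s := exists a, Der a s /\ ~ Der a r.

Definition rank_rec (L : nat -> nat -> Prop) := forall r s,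
  L r s <-> exists t0 t1, [/\ split s t0 t1, ~ L t0 r & ~ L t1 r].

Lemma rank_ltxx s : ~ rank_lt s s.
Proof. by move=> [a []]. Qed.

(** Descending from a stage that [r] misses, one meets a stage that [r] survives but whose
    derivative it does not: the rank of [r]. *)
Lemma exact_rank r : exists a, Der a r /\ ~ derivative (Der a) r.
Proof.
have [a] := Der_exhaust r; elim: a => [|f IHf] Da; first by case: Da.
have /existsNP[n Dn] : ~ forall n, derivative (Der (f n)) r by [].
have [Dfn|] := pselect (Der (f n) r); last exact: IHf.
by exists (f n).
Qed.

Lemma rank_lt_rec : rank_rec rank_lt.
Proof.
move=> r s; split.
  move=> [a [Das Dar]]; elim: a Das Dar => [//|f IHf] Das Dar.
  have /existsNP[n Dn] : ~ forall n, derivative (Der (f n)) r by [].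
  have [t0 [t1 [st Dt0 Dt1]]] := Das n.
  exists t0, t1; split=> // -[b [Dbr Dbt]].
    by have [/(_ _ Dbr)//|/(_ _ Dt0)] := Der_cmp (f n) b.
  by have [/(_ _ Dbr)//|/(_ _ Dt1)] := Der_cmp (f n) b.
move=> [t0 [t1 [st nt0 nt1]]]; have [a [Dar Dar']] := exact_rank r.
exists (OLim (fun _ => a)); split=> [n|/(_ 0)//].
exists t0, t1; split=> //.
  by apply: contrapT => Dt; apply: nt0; exists a.
by apply: contrapT => Dt; apply: nt1; exists a.
Qed.

(** Smaller rank implies [L] by induction on the separating stage. Conversely, of two incompatible
    extensions of [s] one has smaller rank than [s]. If [r] did not have smaller rank than [s], this
    extension would also be below [r], contradicting [~ L t r] for both extensions. *)
Lemma rank_rec_uniq L : rank_rec L -> forall r s, L r s <-> rank_lt r s.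
Proof.
move=> Lrec.
have lt_of r t0 t1 : split r t0 t1 -> rank_lt t0 r \/ rank_lt t1 r.
  move=> rt; apply: contrapT => /not_orP[nt0 nt1]; apply: (@rank_ltxx r).
  by apply/rank_lt_rec; exists t0, t1.
have ltL a : forall r s, Der a s -> ~ Der a r -> L r s.
  elim: a => [|f IHf] r s Das Dar; first by case: Dar.
  have /existsNP[n Dn] : ~ forall n, derivative (Der (f n)) r by [].
  have [t0 [t1 [st Dt0 Dt1]]] := Das n.
  apply/Lrec; exists t0, t1.
  suff nL t : Der (f n) t -> ~ L t r by split=> //; exact: nL.
  move=> Dt /Lrec[r0 [r1 [rr nL0 nL1]]].
  have [Dr0|nD] := pselect (Der (f n) r0); last by apply: nL0; exact: IHf Dt nD.
  have [Dr1|nD] := pselect (Der (f n) r1); last by apply: nL1; exact: IHf Dt nD.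
  by apply: Dn; exists r0, r1.
move=> r s; split=> [/Lrec[t0 [t1 [st nL0 nL1]]]|[a [Das Dar]]]; last exact: ltL Das Dar.
apply: contrapT => nrs.
have trans t : rank_lt t s -> rank_lt t r.
  move=> [a [Das Dat]]; exists a; split=> //; apply: contrapT => Dar.
  by apply: nrs; exists a.
by have [/trans[a [Dar Dat]]|/trans[a [Dar Dat]]] := lt_of _ _ _ st;
  [apply: nL0|apply: nL1]; apply: ltL Dat.
Qed.

(** Well-foundedness, by induction on a stage that [x n] misses. Either another member misses an
    earlier stage, or all of them lie in a stage whose derivative omits [x n], which is then of
    minimal rank. *)
Lemma rank_lt_stable (x : nat -> nat) : exists n, forall m, n <= m -> ~ rank_lt (x m) (x n).
Proof.
have [a Da] := Der_exhaust (x 0).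
suff : forall n, ~ Der a (x n) -> exists n, forall m, n <= m -> ~ rank_lt (x m) (x n).
  by move/(_ 0 Da).
elim: a {Da} => [n|f IHf n Dn]; first by case.
have /existsNP[i Di] : ~ forall i, derivative (Der (f i)) (x n) by [].
have [Dx|/existsNP[m /IHf]//] := pselect (forall m, Der (f i) (x m)).
exists n => m _ [b [Dbn Dbm]].
by have [/(_ _ Dbn)//|/(_ _ (Dx m))] := Der_cmp (f i) b.
Qed.

End RankComparison.

(** * Least witnesses as canonical Skolem functions *)

Section LeastWitness.

(** Shifted by one, so that [0] records that there is no witness. Taking the least one makes the
    Skolem function unique. *)
Definition lw (P : pred nat) : nat :=
  if pselect (exists k, P k) is left exP then (ex_minn exP).+1 else 0.

Definition is_lw (P : pred nat) n :=
  if n is k.+1 then P k /\ forall j, j < k -> ~~ P j else forall k, ~~ P k.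

Lemma lwP P : is_lw P (lw P).
Proof.
rewrite /lw; case: pselect => [exP|nP] /=; last first.
  by move=> k; apply/negP => Pk; apply: nP; exists k.
case: ex_minnP => m Pm min_m; split=> // j; apply: contraTN => /min_m.
by rewrite -leqNgt.
Qed.

Lemma is_lw_uniq P m n : is_lw P m -> is_lw P n -> m = n.
Proof.
case: m n => [|m] [|n] //= => [nP [Pn _]|[Pm _] nP|[Pm nPm] [Pn nPn]].
- by have := nP n; rewrite Pn.
- by have := nP m; rewrite Pm.
- by case: (ltngtP m n) => [/nPn|/nPm|->//]; rewrite ?Pm ?Pn.
Qed.

Lemma lw_eq0 P : (lw P == 0) = ~~ `[< exists k, P k >].
Proof.
have := lwP P; case: (lw P) => [|k] /= HP; apply/esym.
  by apply/asboolPn => -[k Pk]; have := HP k; rewrite Pk.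
by apply/negbTE/negPn/asboolP; exists k; case: HP.
Qed.

Lemma lw_ext P Q : P =1 Q -> lw P = lw Q.
Proof. by move=> /funext ->. Qed.

End LeastWitness.

(** The condition at [c = <m, k>] concerns the single candidate [k] for [z m]; all of them together
    say that [z m] is [lw (V m)] for every [m]. *)
Definition lw_ok (V : nat -> nat -> bool) (z : baire) (c : nat) : bool :=
  ((z (pfst c) == (psnd c).+1) ==> V (pfst c) (psnd c)) &&
  (((z (pfst c) == 0) || ((psnd c).+1 < z (pfst c))) ==> ~~ V (pfst c) (psnd c)).

(** * The tree whose paths are the least-witness functions *)

Section LwTree.
Variables (V : baire -> nat -> nat -> bool) (B : nat -> nat).
Hypothesis B_gt : forall c, pfst c < B c.
Hypothesis V_use : forall z z' c, (forall i, i < B c -> z i = z' i) ->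
  V z (pfst c) (psnd c) = V z' (pfst c) (psnd c).

Definition lw_spec (z : baire) := forall m, z m = lw (V z m).

(** The condition at [c] reads [z] only below [B c], so a node is tested against it only once it is
    longer than that. *)
Definition lw_tree : set (seq nat) := [set s | forall c, c < size s -> B c < size s ->
  lw_ok (V (nth 0 s)) (nth 0 s) c].

Lemma lw_ok_use z z' c : (forall i, i < B c -> z i = z' i) ->
  lw_ok (V z) z c = lw_ok (V z') z' c.
Proof. by move=> zz'; rewrite /lw_ok (V_use zz') zz'. Qed.

Lemma lw_spec_ok z : lw_spec z <-> forall c, lw_ok (V z) z c.
Proof.
split=> [zV c|ok m].
  have := lwP (V z (pfst c)); rewrite -zV /lw_ok; case: (z _) => [|n] /=.
    by move=> nV; rewrite nV.
  move=> [Vn nV]; rewrite eqSS; apply/andP; split; apply/implyP.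
    by move=> /eqP <-.
  exact: nV.
apply: is_lw_uniq (lwP _); case zm: (z m) => [|n] /=.
  by move=> k; have := ok (cpair m k); rewrite /lw_ok !pairE zm /=.
split=> [|j jn]; first by have := ok (cpair m n); rewrite /lw_ok !pairE zm eqxx => /andP[].
by have := ok (cpair m j); rewrite /lw_ok !pairE zm [_.+1 < _]jn orbT => /andP[].
Qed.

Lemma lw_tree_tree : tree (lw_tree : set (seq nat_alphabet)).
Proof.
split; first by exists [::].
move=> s t st c cs Bs; have := st c; rewrite size_cat => /(_ (ltn_addr _ cs) (ltn_addr _ Bs)).
rewrite (@lw_ok_use _ (nth 0 s)) // => i ilt.
by rewrite nth_cat (ltn_trans ilt).
Qed.

Lemma lw_tree_paths (z : baire) :
  paths (lw_tree : set (seq nat_alphabet)) z <-> lw_spec z.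
Proof.
have agree n c : B c < n -> lw_ok (V (nth 0 (mkseq z n))) (nth 0 (mkseq z n)) c =
    lw_ok (V z) z c.
  move=> Bn; apply: lw_ok_use => i ilt; rewrite nth_mkseq //; exact: ltn_trans Bn.
split=> [pz|/lw_spec_ok zV n c].
  apply/lw_spec_ok => c; have := pz (c + B c).+1 c; rewrite size_mkseq agree; last by lia.
  by apply; lia.
by rewrite size_mkseq => cn Bn; rewrite agree.
Qed.

End LwTree.

(** * The Skolem stack for ranks, branches and cardinality *)

Definition pref s t := (csize s <= csize t) &&
  all (fun i => cnth s i == cnth t i) (iota 0 (csize s)).

Lemma prefE s t : pref s t = prefix (CodeSeq.decode s) (CodeSeq.decode t).
Proof.
rewrite /pref /csize /cnth; set u := CodeSeq.decode s; set v := CodeSeq.decode t.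
rewrite prefixE; apply/andP/eqP => [[le_uv /allP uv]|uv].
  apply: (@eq_from_nth _ 0) => [|i]; rewrite size_takel // => ilt.
  by rewrite nth_take //; apply/eqP; rewrite eq_sym uv // mem_iota.
have le_uv : size u <= size v by rewrite -uv size_take; case: ltnP => // /ltnW.
by split=> //; apply/allP => i; rewrite mem_iota => ilt; rewrite -uv nth_take.
Qed.

Definition splitb (p : baire) s k :=
  [&& p (pfst k) == 1, p (psnd k) == 1, pref s (pfst k), pref s (psnd k),
      ~~ pref (pfst k) (psnd k) & ~~ pref (psnd k) (pfst k)].

(** The node of length [|s| + t + 1] is long enough to have an entry at place [t]; the predecessor
    undoes the shift in [lw]. *)
Definition zentry (z : baire) s t := cnth (z (cpair 1 (cpair s t.+1))).-1 t.

(* The five levels of the Skolem stack over a tree [p]: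
   - [z <0, <r, s>>] witnesses that [r] has smaller rank than [s];
   - [z <1, <s, l>>] is a node of length [|s| + l] above [s] of the same rank;
   - [z <2, s>] bounds the lengths of these nodes, [0] if there is no bound;
   - [z <3, j>] witnesses that the tree has [j] paths;
   - [z <4, 0>] is the least number of paths that fails, plus one.            *)
Definition rankV (p z : baire) m k : bool :=
  if pfst m == 0 then
    [&& splitb p (psnd (psnd m)) k, z (cpair 0 (cpair (pfst k) (pfst (psnd m)))) == 0
      & z (cpair 0 (cpair (psnd k) (pfst (psnd m)))) == 0]
  else if pfst m == 1 then
    [&& p k == 1, pref (pfst (psnd m)) k,
        csize k == csize (pfst (psnd m)) + psnd (psnd m)
      & z (cpair 0 (cpair k (pfst (psnd m)))) == 0]
  else if pfst m == 2 then z (cpair 1 (cpair (psnd m) k)) == 0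
  else if pfst m == 3 then
    (csize (pfst k) == psnd m) && sep (fun s => z (cpair 2 s) == 0) (zentry z) k
  else if pfst m == 4 then z (cpair 3 k) == 0 else false.

(** [rankV] at [c] reads only indices [<a, x>] and [<a, <x, y>>] with [a <= 4] and [x, y <= c + 4],
    and pairing is monotone. *)
Definition rankB c := (cpair c.+4 (cpair c.+4 c.+4)).+1.

Lemma rankB_gt c : pfst c < rankB c.
Proof.
by have := pfst_le c; have := cpair_ge c.+4 (cpair c.+4 c.+4); rewrite /rankB; lia.
Qed.

Lemma rankB_idx c a y : a <= 4 -> y <= cpair c.+4 c.+4 -> cpair a y < rankB c.
Proof. by move=> a4 yc; rewrite ltnS cpair_mono //; lia. Qed.

Lemma cnth_le n i : cnth n i <= n.
Proof.
have [ilt|ige] := ltnP i (csize n); last by rewrite /cnth nth_default.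
have /allP/(_ (cnth n i) (mem_nth 0 ilt)) := CodeSeq.ltn_code (CodeSeq.decode n).
by rewrite CodeSeq.decodeK => /ltnW.
Qed.

Lemma eq_in_sep b b' X X' k :
  (forall i, b (cnth (pfst k) i) = b' (cnth (pfst k) i)) ->
  (forall i t, t < psnd k -> X (cnth (pfst k) i) t = X' (cnth (pfst k) i) t) ->
  sep b X k = sep b' X' k.
Proof.
move=> bb' XX'; rewrite /sep; apply: eq_in_all => i _; rewrite bb'; congr (_ && _).
apply: eq_in_all => j _; apply: eq_in_has => t; rewrite mem_iota => /= tlt.
by rewrite !XX'.
Qed.

Lemma rankV_use p z z' c : (forall i, i < rankB c -> z i = z' i) ->
  rankV p z (pfst c) (psnd c) = rankV p z' (pfst c) (psnd c).
Proof.
move=> zz'.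
have m_le : psnd (pfst c) <= c by exact: leq_trans (psnd_le _) (pfst_le _).
have m1_le : pfst (psnd (pfst c)) <= c by exact: leq_trans (pfst_le _) m_le.
have k_le := psnd_le c.
have k1_le : pfst (psnd c) <= c by exact: leq_trans (pfst_le _) k_le.
have k2_le : psnd (psnd c) <= c by exact: leq_trans (psnd_le _) k_le.
have c_le x : x <= c.+4 -> x <= cpair c.+4 c.+4.
  by move=> xc; have := cpair_ge c.+4 c.+4; lia.
have zz2 a x y : a <= 4 -> x <= c.+4 -> y <= c.+4 ->
    z (cpair a (cpair x y)) = z' (cpair a (cpair x y)).
  by move=> a4 xc yc; apply/zz'/rankB_idx => //; exact: cpair_mono.
have zz1 a x : a <= 4 -> x <= c.+4 -> z (cpair a x) = z' (cpair a x).
  by move=> a4 /c_le xc; apply/zz'/rankB_idx.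
rewrite /rankV !zz2 ?zz1 //; try lia.
have -> // : sep (fun s => z (cpair 2 s) == 0) (zentry z) (psnd c) =
  sep (fun s => z' (cpair 2 s) == 0) (zentry z') (psnd c).
apply: eq_in_sep => [i|i t tlt].
  by rewrite zz1 //; have := cnth_le (pfst (psnd c)) i; lia.
by rewrite /zentry zz2 //; have := cnth_le (pfst (psnd c)) i; lia.
Qed.

Lemma prefix_inj_map (T1 T2 : eqType) (f : T1 -> T2) (s t : seq T1) :
  injective f -> prefix (map f s) (map f t) = prefix s t.
Proof. by move=> f_inj; rewrite !prefixE size_map -map_take (inj_eq (inj_map f_inj)). Qed.

(** * The stack over a tree with countably many paths *)

Section RankStack.
Variables (S : alphabet) (p : baire) (T : set (seq S)).
Hypotheses (treeT : tree T) (pT : char_fun p T) (countableT : countable (paths T)).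

Let split s t0 t1 := splitb p s (cpair t0 t1) : Prop.

Lemma splitE s t0 t1 : split s t0 t1 <-> [/\ p t0 == 1, p t1 == 1, pref s t0,
  pref s t1 & ~~ pref t0 t1 && ~~ pref t1 t0].
Proof.
rewrite /split /splitb !pairE; split=> [/and5P[-> -> -> -> ->]//|[-> -> -> -> ->]//].
Qed.

Lemma pref_trans s t r : pref s t -> pref t r -> pref s r.
Proof. by rewrite !prefE; exact: prefix_trans. Qed.

Lemma split_trans s t0 t1 a b : split s t0 t1 -> split t0 a b -> split s a b.
Proof.
move=> /splitE[_ _ st0 _ _] /splitE[pa pb t0a t0b ab]; apply/splitE; split=> //.
  exact: pref_trans t0a.
exact: pref_trans t0b.
Qed.

Lemma prefix_mkseq (x : nat -> S) s n :
  prefix s (mkseq x n) = (size s <= n) && (s == mkseq x (size s)).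
Proof.
rewrite prefixE; apply/eqP/andP => [sx|[sn /eqP ->]].
  have sn : size s <= n.
    by rewrite -(size_mkseq x n) -{1}sx size_take; case: ltnP => // /ltnW.
  by split=> //; rewrite -{1}sx /mkseq -map_take take_iota (minn_idPl sn).
by rewrite size_mkseq /mkseq -map_take take_iota (minn_idPl sn).
Qed.

(** Cantor's diagonal argument: above each node of a set contained in its derivative there are two
    incompatible ones, and at most one of them follows the path [f n]. Avoiding [f 0], [f 1], and so
    on in turn gives a path outside the enumeration. *)
Lemma scattered X : X `<=` derivative split X -> X = set0.
Proof.
move=> Xd; apply: contrapT => /eqP/set0P[s0 Xs0].
pose Y : set (seq S) := [set t | T t /\ X (scode t)].
have Y_node s : X s -> p s == 1 -> exists2 t, Y t & s = scode t.
  by move=> Xs /(char_fun_eq1 pT)[t Tt st]; exists t => //; rewrite /Y /= -st.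
have prefS (t t' : seq S) : pref (scode t) (scode t') = prefix t t'.
  by rewrite prefE !decode_scode; exact/prefix_inj_map/enc_inj.
have [t0 Yt0] : exists t, Y t.
  have [a [b [/splitE[pa _ _ _ _] Xa _]]] := Xd _ Xs0.
  by have [t Yt _] := Y_node _ Xa pa; exists t.
have Ysplit t : Y t -> exists a b,
    [/\ Y a, Y b, prefix t a, prefix t b & ~~ prefix a b && ~~ prefix b a].
  move=> [_ /Xd[a' [b' [/splitE[pa pb ta tb ab] Xa Xb]]]].
  have [a Ya aE] := Y_node _ Xa pa; have [b Yb bE] := Y_node _ Xb pb; exists a, b.
  by move: ta tb ab; rewrite aE bE !prefS.
have Ystep (x : seqspace S) t : Y t ->
    exists a, [/\ Y a, prefix t a, size t < size a & a != mkseq x (size a)].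
  move=> /Ysplit[a [b [Ya Yb ta tb /andP[nab nba]]]].
  have lt_size c d : prefix t c -> prefix t d -> ~~ prefix c d -> size t < size c.
    move=> tc td; apply: contraR; rewrite -leqNgt => le_ct.
    suff -> : c = t by [].
    apply/eqP; rewrite eq_sym; move: tc; rewrite prefixE => /eqP <-.
    by rewrite take_oversize.
  have [aE|] := eqVneq a (mkseq x (size a)); last by exists a; split=> //; exact: lt_size nab.
  exists b; split=> //; first exact: lt_size nba.
  apply/eqP => bE; have [le_ab|/ltnW le_ba] := leqP (size a) (size b).
    by move: nab; rewrite bE prefix_mkseq le_ab -aE eqxx.
  by move: nba; rewrite aE prefix_mkseq le_ba -bE eqxx.
have [f fP] : exists f : nat -> seqspace S, paths T `<=` range f.
  have [A0|[f]] := pfcard_geP countableT; last by exists f; rewrite image_eq.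
  by exists (fun _ _ => point); rewrite A0.
have [h hP] : exists h : nat -> seq S -> seq S, forall n t, Y t ->
    [/\ Y (h n t), prefix t (h n t), size t < size (h n t)
      & h n t != mkseq (f n) (size (h n t))].
  have /choice[h hP] : forall nt : nat * seq S, exists a, Y nt.2 ->
      [/\ Y a, prefix nt.2 a, size nt.2 < size a & a != mkseq (f nt.1) (size a)].
    move=> [n t] /=; have [/(Ystep (f n))[a Ya]|nY] := pselect (Y t); first by exists a.
    by exists t.
  by exists (fun n t => h (n, t)) => n t; exact: (hP (n, t)).
pose g := fix g n := if n is n'.+1 then h n' (g n') else t0.
have Yg n : Y (g n) by elim: n => [//|n /(hP n)[Yh _ _ _]]; exact: Yh.
have size_g n : n <= size (g n).
  by elim: n => // n IHn; apply: leq_ltn_trans IHn _; have [_ _ lt _] := hP n _ (Yg n); exact: lt.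
have pref_g m n : m <= n -> prefix (g m) (g n).
  move=> /subnKC <-; elim: (n - m) => [|k IHk]; first by rewrite addn0 prefix_refl.
  rewrite addnS; have [_ pre _ _] := hP (m + k) _ (Yg (m + k)).
  exact: (prefix_trans IHk pre).
pose x : seqspace S := fun i => nth point (g i.+1) i.
have gx n : g n = mkseq x (size (g n)).
  apply: (@eq_from_nth _ point) => [|i ilt]; first by rewrite size_mkseq.
  rewrite nth_mkseq // /x; have [le_in|lt_ni] := leqP i.+1 n.
    have /prefixP[r ->] := pref_g _ _ le_in.
    by rewrite nth_cat size_g.
  have /prefixP[r ->] := pref_g _ _ (ltnW lt_ni).
  by rewrite nth_cat ilt.
have Tx : paths T x.
  move=> n; apply: tree_mkseq treeT (size_g n) _; rewrite -gx.
  by have [] := Yg n.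
have [n _ fn] := fP x Tx.
have [_ _ _] := hP n _ (Yg n); rewrite fn -[h n (g n)]/(g n.+1).
by rewrite -gx eqxx.
Qed.

Notation rlt := (rank_lt split).

Lemma lw_spec_rank z : lw_spec (rankV p) z ->
  forall r s, z (cpair 0 (cpair r s)) != 0 <-> rlt r s.
Proof.
move=> zV; apply: (rank_rec_uniq split_trans scattered) => r s.
rewrite zV lw_eq0 negbK; split=> [/asboolP[k]|[t0 [t1 [st]]]].
  rewrite /rankV !pairE /= => /and3P[sk z0 z1]; exists (pfst k), (psnd k).
  by rewrite /split cpairK z0 z1.
move=> /negP/negPn z0 /negP/negPn z1; apply/asboolP; exists (cpair t0 t1).
by rewrite /rankV !pairE /= z0 z1 !andbT.
Qed.

Definition agree j (z z' : baire) := forall m, pfst m < j -> z m = z' m.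

(** Levels above 0 refer only to lower levels. Level 0 refers to itself, hence the assumption
    [0 < j]. *)
Lemma agree_lw j z z' : 0 < j -> agree j z z' ->
  agree j.+1 (fun m => lw (rankV p z m)) (fun m => lw (rankV p z' m)).
Proof.
move=> j0 zz' m mj; apply: lw_ext => k.
have zE a y : a < j -> z (cpair a y) = z' (cpair a y).
  by move=> aj; apply: zz'; rewrite pfstE.
rewrite /rankV !(zE 0) //.
case: eqP => // m0; case: eqP => // m1; case: eqP => [m2|m2].
  by rewrite zE // -ltnS -m2.
case: eqP => [m3|m3].
  congr (_ && _); apply: eq_in_sep => [i|i t _].
    by rewrite zE // -ltnS -m3.
  by rewrite /zentry zE // -ltnS -m3 ltnW.
by case: eqP => // m4; rewrite zE // -ltnS -m4.
Qed.

(** Level 0 is filled with the least witnesses for the true rank comparison, which satisfies the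
    recursion. *)
Lemma lw_spec_ex : exists z, lw_spec (rankV p) z.
Proof.
pose F (z : baire) : baire := fun m => lw (rankV p z m).
pose W m k := [&& splitb p (psnd (psnd m)) k,
  ~~ `[< rlt (pfst k) (pfst (psnd m)) >] & ~~ `[< rlt (psnd k) (pfst (psnd m)) >]].
pose z0 m := if pfst m == 0 then lw (W m) else 0.
have z0E r s : (z0 (cpair 0 (cpair r s)) == 0) = ~~ `[< rlt r s >].
  rewrite /z0 pfstE /= lw_eq0; congr (~~ _); apply: asbool_equiv_eq.
  rewrite (rank_lt_rec split_trans scattered).
  split=> [[k]|[t0 [t1 [st nt0 nt1]]]].
    rewrite /W !pairE => /and3P[sk /asboolPn n0 /asboolPn n1].
    by exists (pfst k), (psnd k); rewrite /split cpairK.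
  exists (cpair t0 t1); rewrite /W !pairE.
  by apply/and3P; split=> //; exact/asboolPn.
have a0 : agree 1 z0 (F z0).
  move=> m; rewrite ltnS leqn0 => m0; rewrite /z0 /F m0.
  by apply: lw_ext => k; rewrite /rankV m0 !z0E.
have aF n : agree n.+1 (iter n F z0) (F (iter n F z0)).
  by elim: n => [|n IHn]; [exact: a0|exact: agree_lw].
(* Each application of [F] settles one more level, and indices with a first component beyond the
   levels have no witnesses. *)
exists (iter 5 F z0) => m; have [m5|m5] := ltnP (pfst m) 6; first exact: (aF 5).
have out z : F z m = 0.
  apply/eqP; rewrite /F lw_eq0; apply/asboolPn => -[k].
  by rewrite /rankV; do !(case: eqP => [mE|_]; first by rewrite mE in m5).
by rewrite -/(F _ m) out /= out.
Qed.

(** On level 0 the recursion determines which values are nonzero, and these determine the least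
    witnesses; the other levels follow one after another. *)
Lemma lw_spec_uniq z z' : lw_spec (rankV p) z -> lw_spec (rankV p) z' -> z = z'.
Proof.
move=> zV z'V.
have a1 : agree 1 z z'.
  move=> m; rewrite ltnS leqn0 => m0; rewrite zV z'V; apply: lw_ext => k.
  have zE r s : (z (cpair 0 (cpair r s)) == 0) = (z' (cpair 0 (cpair r s)) == 0).
    apply: negb_inj; apply/idP/idP; first by move/(lw_spec_rank zV)/(lw_spec_rank z'V).
    by move/(lw_spec_rank z'V)/(lw_spec_rank zV).
  by rewrite /rankV m0 !zE.
have aS n : agree n.+1 z z'.
  elim: n => [//|n IHn] m mn; rewrite zV z'V.
  exact: (agree_lw (ltn0Sn _) IHn).
by apply/funext => m; exact: (aS (pfst m)).
Qed.

Section Solution.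
Variable z : baire.
Hypothesis zV : lw_spec (rankV p) z.

Lemma z1P s l k : z (cpair 1 (cpair s l)) = k.+1 ->
  [/\ p k == 1, pref s k, csize k = csize s + l & ~ rlt k s].
Proof.
move=> zE; have := lwP (rankV p z (cpair 1 (cpair s l))); rewrite -zV zE /= => -[+ _].
rewrite /rankV !pairE /= => /and4P[pk sk /eqP kl z0]; split=> //.
by move/(lw_spec_rank zV); rewrite z0.
Qed.

(** Two incompatible extensions of [s] whose rank is not smaller would make the rank of [s] smaller
    than itself. *)
Lemma same_rank_pref s t t' : p t == 1 -> p t' == 1 -> pref s t -> pref s t' ->
  ~ rlt t s -> ~ rlt t' s -> csize t <= csize t' -> pref t t'.
Proof.
move=> pt pt' st st' nt nt' le_tt'.
have [|] : pref t t' \/ pref t' t.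
  apply: contrapT => /not_orP[/negP n1 /negP n2]; apply: (@rank_ltxx split s).
  apply/(rank_lt_rec split_trans scattered); exists t, t'; split=> //.
  by apply/splitE; rewrite n1 n2.
by [].
rewrite !prefE prefixE => /eqP tt'.
suff -> : CodeSeq.decode t' = CodeSeq.decode t by exact: prefix_refl.
by rewrite -[LHS]tt' take_oversize.
Qed.

Lemma z1_ex s l k : p k == 1 -> pref s k -> csize k = csize s + l -> ~ rlt k s ->
  z (cpair 1 (cpair s l)) = k.+1.
Proof.
move=> pk sk kl nk; case zE: (z _) => [|k'].
  have := lwP (rankV p z (cpair 1 (cpair s l))); rewrite -zV zE /= => /(_ k).
  rewrite /rankV !pairE /= pk sk kl eqxx /=.
  by move=> /(lw_spec_rank zV).
have [pk' sk' k'l nk'] := z1P zE; congr _.+1; apply: (can_inj CodeSeq.decodeK).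
have := same_rank_pref pk' pk sk' sk nk' nk; rewrite k'l kl leqnn => /(_ isT).
rewrite prefE prefixE => /eqP <-; rewrite take_oversize //.
by rewrite -[leqRHS]/(csize k') k'l -kl.
Qed.

Lemma z2P s : z (cpair 2 s) == 0 <-> forall l, z (cpair 1 (cpair s l)) != 0.
Proof.
rewrite zV lw_eq0; split=> [/asboolPn nk l|zs].
  by apply/negP => zl; apply: nk; exists l; rewrite /rankV !pairE.
by apply/asboolPn => -[l]; rewrite /rankV !pairE /= => zl; have := zs l; rewrite zl.
Qed.

(** The witnesses for all lengths form a chain by [same_rank_pref], and the path is their union. *)
Lemma branch_path s : z (cpair 2 s) == 0 ->
  exists2 x, paths T x & forall t, zentry z s t = enc (x t).
Proof.
move=> /z2P zs.
have /choice[t tP] : forall l, exists t : seq S, [/\ T t,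
    z (cpair 1 (cpair s l)) = (scode t).+1, pref s (scode t) & ~ rlt (scode t) s].
  move=> l; have := zs l; case zE: (z _) => [//|k] _; have [pk sk _ nk] := z1P zE.
  by have [t Tt kt] := char_fun_eq1 pT pk; exists t; rewrite -kt.
have size_t l : size (t l) = csize s + l.
  have [_ /z1P[_ _ <- _] _ _] := tP l.
  by rewrite /csize decode_scode size_map.
have pref_t l l' : l <= l' -> prefix (t l) (t l').
  move=> le_ll'; have [Tt zt st nt] := tP l; have [Tt' zt' st' nt'] := tP l'.
  have [pt _ _ _] := z1P zt; have [pt' _ _ _] := z1P zt'.
  have := same_rank_pref pt pt' st st' nt nt'.
  rewrite prefE !decode_scode prefix_inj_map; last exact: enc_inj.
  by apply; rewrite /csize !decode_scode !size_map !size_t leq_add2l.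
pose x : seqspace S := fun i => nth point (t i.+1) i.
have tx n : mkseq x n = take n (t n).
  apply: (@eq_from_nth _ point) => [|i]; rewrite size_mkseq.
    by rewrite size_takel // size_t leq_addl.
  move=> ilt; rewrite nth_mkseq // nth_take // /x.
  have /prefixP[r ->] := pref_t _ _ ilt.
  by rewrite nth_cat size_t ifT //; lia.
exists x => [n|i].
  by have [Tt _ _ _] := tP n; rewrite tx; apply: (treeT.2 _ (drop n (t n))); rewrite cat_take_drop.
have [_ zt _ _] := tP i.+1; rewrite /zentry zt /cnth /= decode_scode (nth_map point) //.
by rewrite size_t; lia.
Qed.

(** By [rank_lt_stable] the ranks along [x] stop decreasing; from that node [s] on, the nodes of [x]
    are the witnesses on level 1. *)
Lemma path_branch x : paths T x ->
  exists s, z (cpair 2 s) == 0 /\ forall t, zentry z s t = enc (x t).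
Proof.
move=> Tx; pose y n := scode (mkseq x n).
have [n nP] := rank_lt_stable split_trans scattered y.
have csize_y m : csize (y m) = m by rewrite /csize decode_scode size_map size_mkseq.
have yE l : z (cpair 1 (cpair (y n) l)) = (y (n + l)).+1.
  apply: z1_ex; rewrite ?csize_y //; last by apply: nP; exact: leq_addr.
    by rewrite (char_fun_scode _ pT) asboolT.
  rewrite prefE !decode_scode /mkseq iotaD !map_cat; exact: prefix_prefix.
exists (y n); split; first by apply/z2P => l; rewrite yE.
move=> t; rewrite /zentry yE /cnth /= decode_scode (nth_map point) ?nth_mkseq ?size_mkseq //; lia.
Qed.

End Solution.

End RankStack.

(** * Listing a countable closed set by unique choice *)

Definition rank_tree_fun (p : baire) : baire := fun n =>
  all (fun c => (rankB c < csize n) ==> lw_ok (rankV p (cnth n)) (cnth n) c)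
      (iota 0 (csize n)).

Lemma comp_rank_tree_fun D : ucomputable D rank_tree_fun.
Proof.
by rewrite /rank_tree_fun /lw_ok /rankV /splitb /pref /sep /zentry /rankB; comp.
Qed.

Lemma rank_tree_fun_char p : char_fun (rank_tree_fun p)
  (lw_tree (rankV p) rankB : set (seq nat_alphabet)).
Proof.
have test n : all (fun c => (rankB c < csize n) ==> lw_ok (rankV p (cnth n)) (cnth n) c)
    (iota 0 (csize n)) <-> lw_tree (rankV p) rankB (CodeSeq.decode n).
  split=> [/allP ok c cn Bc|ok].
    by have := ok c; rewrite mem_iota => /(_ cn)/implyP; apply.
  by apply/allP => c; rewrite mem_iota => /= cn; apply/implyP => Bc; exact: ok.
apply: (char_funE (fun n => erefl)) => [s Us|n /test Un].
  by apply/test; rewrite decode_scode map_id.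
by exists (CodeSeq.decode n) => //; rewrite /scode map_id CodeSeq.decodeK.
Qed.

Lemma List_UC (S : alphabet) : lesW (List S) UC_baire.
Proof.
pose b (z : baire) s := z (cpair 2 s) == 0.
(* With [N] paths the least number that fails is [N + 1], so [z <4, 0>] is [N + 2] and its
   predecessor is the code [N + 1] of the cardinality. With infinitely many paths it is 0, and so is
   its predecessor. *)
pose Psi (z : baire) : baire := interleave (fun _ => (z (cpair 4 0)).-1)
  (bseq_of (b z) (fun s t => if b z s then zentry z s t else enc (point : S))).
apply/lesWE; exists setT, setT, rank_tree_fun, Psi; split.
- exact: comp_rank_tree_fun.
- by rewrite /Psi /bseq_of /b /zentry; apply: comp_interleave; comp.
move=> p A [T [treeT pT TA]] cA; split=> //.
have countT : countable (paths T) by rewrite TA.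
have treeU := lw_tree_tree rankB_gt (@rankV_use p).
have pathsU := lw_tree_paths rankB_gt (@rankV_use p).
have [z zV] := lw_spec_ex treeT pT countT.
have dUC : pts (pathSet (lw_tree (rankV p) rankB : set (seq nat_alphabet))) =
    [set (z : seqspace nat_alphabet)].
  apply/seteqP; split=> [y /pathsU yV|y ->]; last exact/pathsU.
  exact: (lw_spec_uniq treeT pT countT) zV.
exists (pathSet (lw_tree (rankV p) rankB : set (seq nat_alphabet))); split.
- exact: pathSet_name treeU (rank_tree_fun_char p).
- by exists z.
move=> q y qy yE; split=> //.
have {qy yE} -> : q = z.
  have -> : q = y by apply/funext => n; exact: qy.
  by have : pts (pathSet (lw_tree (rankV p) rankB : set (seq nat_alphabet))) y;
    [rewrite [pts _]yE|rewrite dUC].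
move=> {q y}.
have [x xP] : exists x : nat -> seqspace S, forall s, b z s ->
    paths T (x s) /\ forall t, zentry z s t = enc (x s t).
  suff /choice[x xP] : forall s, exists x : seqspace S, b z s ->
      paths T x /\ forall t, zentry z s t = enc (x t) by exists x.
  move=> s; have [/(branch_path treeT pT countT zV)[x Tx xE]|nb] := boolP (b z s).
    by exists x.
  by exists (fun=> point).
pose u : rep_bseq S := fun s => (b z s, if b z s then x s else fun=> point).
have Au : pts A = listed u.
  rewrite -TA; apply/seteqP; split=> y.
    move=> Ty; have [s [bs sE]] := path_branch treeT pT countT zV Ty.
    have [Tx xE] := xP s bs.
    exists s => //=; rewrite [b z s]bs; apply/funext => t.
    by apply: (@enc_inj S); rewrite -xE sE.
  by move=> [s /= bs <-]; rewrite bs; case: (xP s bs).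
have bu i : b z i = (u i).1 by [].
have Xu i t : b z i -> zentry z i t = enc ((u i).2 t).
  by move=> bi; rewrite /u /= bi; case: (xP i bi).
have z3P j : z (cpair 3 j) != 0 <-> exists s : seq (seqspace S),
    [/\ uniq s, size s = j & [set` s] `<=` pts A].
  rewrite zV lw_eq0 negbK; split=> [/asboolP[k]|[s [uniq_s <-]]].
    rewrite /rankV !pairE /= => /andP[/eqP kj /(sep_uniq bu Xu)[uniq_s s_u]].
    by eexists; split; [exact: uniq_s|rewrite size_map|rewrite Au].
  rewrite Au => s_u; have [k ks sepk] := uniq_sep bu Xu uniq_s s_u.
  by apply/asboolP; exists k; rewrite /rankV !pairE /= ks eqxx.
exists ((z (cpair 4 0)).-1, u); split.
  apply: prod_nameI => //; apply: bseq_of_name => // i t.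
  by rewrite /u /=; case: ifP => // bi; case: (xP i bi).
split=> //=; have := lwP (rankV p z (cpair 4 0)); rewrite -zV.
have V4 j : rankV p z (cpair 4 0) j = (z (cpair 3 j) == 0) by rewrite /rankV !pairE.
case: (z (cpair 4 0)) => [|k] /= z4.
  left; split=> //; apply: eq_card_nat => // -[n An].
  have [s [uniq_s size_s sA]] := (z3P n.+1).1 (z4 n.+1).
  by have [] := uniq_subset_finite uniq_s sA An; rewrite size_s ltnn.
right; case: z4; rewrite V4 => zk /(_ k.-1); rewrite V4.
case: k zk => [|k] zk zk'.
  by have /negP[] : z (cpair 3 0) != 0 by apply/z3P; exists [::].
split=> //; rewrite subn1 /=.
have [s [uniq_s size_s sA]] := (z3P k).1 (zk' (ltnSn k)).
suff -> : pts A = [set` s] by rewrite -size_s; exact: card_uniq.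
apply/seteqP; split=> // y Ay; apply: contrapT => /negP ys.
have /negP[] : z (cpair 3 k.+1) != 0; last exact: zk.
apply/z3P; exists (y :: s); rewrite /= ys size_s; split=> // t /=.
by rewrite inE => /orP[/eqP ->//|/sA].
Qed.

(** * Continuity and the separations *)

Definition upto (N : nat) (p q : baire) := forall i, i < N -> p i = q i.

Lemma upto_refl N p : upto N p p.
Proof. by []. Qed.

Lemma upto_sym N p q : upto N p q -> upto N q p.
Proof. by move=> pq i /pq. Qed.

Lemma upto_trans N p q r : upto N p q -> upto N q r -> upto N p r.
Proof. by move=> pq qr i iN; rewrite pq ?qr. Qed.

Lemma upto_leq M N p q : M <= N -> upto N p q -> upto M p q.
Proof. by move=> MN pq i iM; apply/pq/(leq_trans iM). Qed.

Lemma upto_interleave N p p' q q' :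
  upto N p p' -> upto N q q' -> upto N (interleave p q) (interleave p' q').
Proof.
by move=> pp' qq' i iN; rewrite /interleave; case: ifP => _; [apply: qq'|apply: pp']; lia.
Qed.

(** Use principle, by induction on the program; for [Mu] the use is the maximum over the finitely
    many values tested. *)
Lemma eval_use p c m n : eval p c m n -> exists N, forall p', upto N p p' -> eval p' c m n.
Proof.
elim: c m n => [||||
  |a IHa b IHb|a IHa b IHb|a IHa b IHb|a IHa] m n /=; try by exists 0.
- by move=> ->; exists m.+1 => p' ->.
- move=> [i [j [/IHa[N1 aN1] /IHb[N2 bN2] ->]]]; exists (maxn N1 N2) => p' pp'.
  exists i, j; split=> //; [apply: aN1|apply: bN2]; apply: upto_leq pp'.
    exact: leq_maxl.
  exact: leq_maxr.
- move=> [k /IHb[N1 bN1] /IHa[N2 aN2]]; exists (maxn N1 N2) => p' pp'.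
  exists k; [apply: bN1|apply: aN2]; apply: upto_leq pp'.
    exact: leq_maxl.
  exact: leq_maxr.
- case: (Cantor.of_nat m) => x k; elim: k n => [|k IHk] n /=; first exact: IHa.
  move=> [r /IHk[N1 rN1] /IHb[N2 bN2]]; exists (maxn N1 N2) => p' pp'.
  exists r; [apply: rN1|apply: bN2]; apply: upto_leq pp'.
    exact: leq_maxl.
  exact: leq_maxr.
- move=> [/IHa[N1 aN1] lt].
  have /choice[N NP] : forall k, exists N, k < n -> exists r, forall p',
      upto N p p' -> eval p' a (cpair m k) r.+1.
    move=> k; have [/lt[r /IHa[N aN]]|_] := boolP (k < n); last by exists 0.
    by exists N => _; exists r.
  exists (maxn N1 (\max_(k < n) N k)) => p' pp'; split.
    by apply: aN1; apply: upto_leq pp'; exact: leq_maxl.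
  move=> k kn; have [r rP] := NP k kn; exists r; apply: rP.
  apply: upto_leq pp'; apply: leq_trans (leq_maxr _ _).
  exact: (leq_bigmax (Ordinal kn)).
Qed.

Lemma computable_cont F : computable F -> forall p q, F p = Some q -> forall M,
  exists N, forall p' q', upto N p p' -> F p' = Some q' -> upto M q q'.
Proof.
move=> [c cF] p q Fp; elim=> [|M [N NP]]; first by exists 0.
have [N' N'P] := eval_use (cF p q Fp M).
exists (maxn N N') => p' q' pp' Fp' i; rewrite ltnS leq_eqVlt => /predU1P[->|iM].
  apply: eval_inj (cF _ _ Fp' M); apply: N'P; apply: upto_leq pp'; exact: leq_maxr.
by apply: (NP p') => //; apply: upto_leq pp'; exact: leq_maxl.
Qed.

(** Baire category argument: if no [C i] contained a basic open set, one could extend a finite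
    prefix step by step, leaving the [i]-th set for good at step [pickle i]. *)
Lemma closed_cover_baire (I : countType) (C : I -> set baire) :
  (forall i x, ~ C i x -> exists N, forall x', upto N x x' -> ~ C i x') ->
  (forall x, exists i, C i x) ->
  exists i x0 N, forall x, upto N x0 x -> C i x.
Proof.
move=> Cclosed Ccover; apply: contrapT => nC.
have step i (xN : baire * nat) : exists yM : baire * nat, [/\ xN.2 < yM.2,
    upto xN.2 xN.1 yM.1 & forall y, upto yM.2 yM.1 y -> ~ C i y].
  case: xN => x N /=.
  have [y [xy nCy]] : exists y, upto N x y /\ ~ C i y.
    apply: contrapT => nx; apply: nC; exists i, x, N => y xy.
    by apply: contrapT => nCy; apply: nx; exists y.
  have [M MP] := Cclosed i y nCy; exists (y, (maxn M N.+1)); split=> //=.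
    exact: leq_maxr.
  by move=> y' yy'; apply: MP; apply: upto_leq yy'; exact: leq_maxl.
have /choice[h hP] : forall nxN : nat * (baire * nat), exists yM : baire * nat,
    [/\ nxN.2.2 < yM.2, upto nxN.2.2 nxN.2.1 yM.1 &
      forall i, unpickle nxN.1 = Some i -> forall y, upto yM.2 yM.1 y -> ~ C i y].
  move=> [n xN] /=; case: (unpickle n) => [i|].
    by have [yM [? ? yMP]] := step i xN; exists yM; split=> // _ [<-].
  by exists (xN.1, xN.2.+1); split.
pose g := fix g n := if n is m.+1 then h (m, g m) else ((fun=> 0) : baire, 0).
have g_step n : [/\ (g n).2 < (g n.+1).2, upto (g n).2 (g n).1 (g n.+1).1 &
    forall i, unpickle n = Some i -> forall y, upto (g n.+1).2 (g n.+1).1 y -> ~ C i y].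
  exact: hP (n, g n).
have g_mono m n : m <= n -> (g m).2 <= (g n).2 /\ upto (g m).2 (g m).1 (g n).1.
  move=> /subnKC <-; elim: (n - m) => [|k [IH1 IH2]]; first by rewrite addn0.
  have [lt up _] := g_step (m + k); rewrite addnS; split.
    exact: leq_trans IH1 (ltnW lt).
  by apply: upto_trans IH2 _; exact: upto_leq up.
have g_ge n : n <= (g n).2.
  by elim: n => // n IHn; have [lt _ _] := g_step n; exact: leq_ltn_trans lt.
pose y : baire := fun i => (g i.+1).1 i.
have gy n : upto (g n).2 (g n).1 y.
  move=> i ilt; rewrite /y; have [le_in|lt_ni] := leqP i.+1 n.
    by rewrite (g_mono _ _ le_in).2 // g_ge.
  by rewrite (g_mono _ _ (ltnW lt_ni)).2.
have [i Ci] := Ccover y.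
have [_ _ /(_ i)] := g_step (pickle i); rewrite pickleK => /(_ erefl y); apply=> //.
Qed.

(** * Compactness of Cantor space *)

Section Konig.

Implicit Types (T : set (seq bool_alphabet)) (s t : seq bool_alphabet).

Definition extendible T s := exists2 x, paths T x & mkseq x (size s) = s.

Lemma konig T s : tree T ->
  (forall L, size s <= L -> exists t, [/\ size t = L, prefix s t & T t]) ->
  extendible T s.
Proof.
move=> treeT; pose ext r := forall L, size r <= L ->
  exists t, [/\ size t = L, prefix r t & T t].
rewrite -/(ext s) => ext_s.
(* If both one-letter extensions failed, then no node above [r] could reach the larger of the two
   levels of failure. *)
have step r : ext r -> exists b : bool, ext (rcons r b).
  move=> ext_r; apply: contrapT => /forallNP next.
  have /choice[L LP] : forall b : bool, exists L, size (rcons r b) <= L /\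
      forall t, size t = L -> prefix (rcons r b) t -> ~ T t.
    move=> b; have /existsNP[L /not_implyP[rL nt]] := next b.
    exists L; split=> // t tL rt Tt; apply: nt; by exists t.
  have LT b := (LP b).1; have Lt := (LP true).1; have Lf := (LP false).1.
  rewrite !size_rcons in Lt Lf.
  have [|t [tL /prefixP[t' def_t] Tt]] := ext_r (maxn (L true) (L false)); first by lia.
  case: t' def_t => [|b t'] def_t.
    have := leq_trans Lt (leq_maxl _ (L false)).
    by rewrite -tL def_t cats0 ltnn.
  have bL : L b <= size t by rewrite tL; case: (b); [exact: leq_maxl|exact: leq_maxr].
  apply: (LP b).2 (take (L b) t) _ _ _.
  - by rewrite size_takel.
  - rewrite prefixE -take_min (minn_idPl (LT b)) def_t -cat_rcons.
    by rewrite take_size_cat.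
  by apply: (treeT.2 _ (drop (L b) t)); rewrite cat_take_drop.
have /choice[h hP] : forall r, exists b : bool, ext r -> ext (rcons r b).
  move=> r; have [/step[b]|nr] := pselect (ext r); first by exists b.
  by exists true.
pose g := fix g n : seq bool_alphabet := if n is m.+1 then rcons (g m) (h (g m)) else s.
have ext_g n : ext (g n) by elim: n => [//|n /hP]; exact.
have size_g n : size (g n) = size s + n.
  by elim: n => [|n IHn]; rewrite ?addn0 //= size_rcons IHn addnS.
have pref_g m n : m <= n -> prefix (g m) (g n).
  move=> /subnKC <-; elim: (n - m) => [|k IHk]; first by rewrite addn0 prefix_refl.
  by rewrite addnS; apply: (prefix_trans IHk); exact: prefix_rcons.
pose x : seqspace bool_alphabet := fun i => nth point (g i.+1) i.
have gx n : mkseq x (size (g n)) = g n.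
  apply: (@eq_from_nth _ point) => [|i]; rewrite size_mkseq // => ilt.
  rewrite nth_mkseq // /x; have [le_in|lt_ni] := leqP i.+1 n.
    have /prefixP[r ->] := pref_g _ _ le_in.
    by rewrite nth_cat size_g ifT //; lia.
  have /prefixP[r ->] := pref_g _ _ (ltnW lt_ni).
  by rewrite nth_cat ilt.
exists x; last exact: (gx 0).
move=> n; apply: (tree_mkseq treeT (n := size (g n))); first by rewrite size_g leq_addl.
rewrite gx; have [t [/eqP tg gt Tt]] := ext_g n _ (leqnn _).
by move: gt; rewrite prefixE take_oversize ?(eqP tg) // => /eqP <-.
Qed.

(** By [konig] a string that is on no path has no extension in [T] at some level [L]. There are only
    finitely many binary strings of that length, so a finite part of the name attests it. *)
Lemma extendible_use T r s : tree T -> char_fun r T -> ~ extendible T s ->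
  exists M, forall r' T', char_fun r' T' -> upto M r r' -> ~ extendible T' s.
Proof.
move=> treeT rT next.
have [L [sL LP]] : exists L, size s <= L /\
    forall t, size t = L -> prefix s t -> ~ T t.
  apply: contrapT => nL; apply/next/konig => // L sL; apply: contrapT => nt.
  apply: nL; exists L; split=> // t tL st Tt; apply: nt; by exists t.
exists (\max_(t : L.-tuple bool) (scode (t : seq bool_alphabet))).+1.
move=> r' T' rT' rr' [x Tx xs].
have xL : size (mkseq x L) == L by rewrite size_mkseq.
have lt_M := leq_bigmax (Tuple xL : L.-tuple bool)
  (F := fun t : L.-tuple bool => scode (t : seq bool_alphabet)).
have := rr' _ lt_M; rewrite (char_fun_scode _ rT) (char_fun_scode _ rT').
rewrite (asboolT (Tx L)) asboolF //; apply: LP; first exact: size_mkseq.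
by rewrite prefix_mkseq sL xs eqxx.
Qed.

End Konig.

(** * Comb-shaped trees *)

Section Comb.

Definition cantor0 : seqspace bool_alphabet := fun=> false.
Definition cantor1 (k : nat) : seqspace bool_alphabet := fun i => i == k.

Lemma cantor1_inj : injective cantor1.
Proof.
by move=> k l /(congr1 (fun x => x k)); rewrite /cantor1 eqxx => /esym/eqP.
Qed.

Variable R : nat -> nat -> Prop.
Hypothesis R_anti : forall k m n, m <= n -> R k n -> R k m.

(* [R k n]: the [k]-th tooth has reached level [n].                           *)
Definition comb : set (seq bool_alphabet) := [set t | t = mkseq cantor0 (size t) \/
  exists k, R k (size t) /\ t = mkseq (cantor1 k) (size t)].

Lemma comb_tree : tree comb.
Proof.
split; first by exists [::]; left.
have pre x (s t : seq bool_alphabet) :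
    s ++ t = mkseq x (size (s ++ t)) -> s = mkseq x (size s).
  have := prefix_prefix s t => /[swap] ->; rewrite prefix_mkseq.
  by move=> /andP[_ /eqP].
move=> s t [/pre|[k [Rk /pre sk]]]; first by left.
by right; exists k; split=> //; apply: R_anti Rk; rewrite size_cat leq_addr.
Qed.

Lemma comb_paths : paths comb = cantor0 |` (cantor1 @` [set k | forall n, R k n]).
Proof.
apply/seteqP; split=> [x Rx|x [->|[k Rk <-]] n]; last first.
- by right; exists k; rewrite size_mkseq.
- by left; rewrite size_mkseq.
have [|/existsNP[k xk]] := pselect (forall k, x k = false).
  by move=> x0; left; apply/funext.
right; have Rn n : k < n -> R k n /\ mkseq x n = mkseq (cantor1 k) n.
  move=> kn; have := Rx n; rewrite /comb /= size_mkseq => -[|[l [Rl xl]]].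
    by move=> /(congr1 (fun s => nth false s k)); rewrite !nth_mkseq.
  suff <- : l = k by [].
  have := congr1 (fun s => nth false s k) xl; rewrite !nth_mkseq // /cantor1.
  by case: eqP.
exists k => [n|].
  by apply: (@R_anti k n (maxn n k.+1)); [exact: leq_maxl|apply: (Rn _ _).1; exact: leq_maxr].
apply/funext => i; have [|_ xi] := Rn (maxn i.+1 k.+1); first exact: leq_maxr.
have := congr1 (fun s => nth false s i) xi.
by rewrite !nth_mkseq //; exact: leq_maxl.
Qed.

End Comb.

Definition char_of (S : alphabet) (T : set (seq S)) : baire :=
  fun n => `[< exists2 s, T s & n = scode s >].

Lemma char_of_char (S : alphabet) (T : set (seq S)) : char_fun (char_of T) T.
Proof. by []. Qed.

Lemma size_scode (S : alphabet) (s : seq S) : size s <= scode s.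
Proof. by have := csize_le (scode s); rewrite /csize decode_scode size_map. Qed.

Lemma char_of_upto (S : alphabet) N (T T' : set (seq S)) :
  (forall s, size s < N -> T s <-> T' s) -> upto N (char_of T) (char_of T').
Proof.
move=> TT' n nN; congr nat_of_bool; apply: asbool_equiv_eq.
have TTn s : n = scode s -> T s <-> T' s.
  by move=> ns; apply: TT'; apply: leq_ltn_trans nN; rewrite ns size_scode.
by split=> -[s Ts ns]; exists s => //; apply/(TTn s ns).
Qed.

Definition seq_of (S : alphabet) (u : nat -> seqspace S) : baire :=
  fun n => enc (u (pfst n) (psnd n)).

Lemma seq_of_name (S : alphabet) (u : rep_seq (rep_seqspace S)) : name (seq_of u) u.
Proof. by move=> i n; rewrite /seq_of !pairE. Qed.

(** Members of the set, in particular ones that extend a prescribed finite part, can be put in front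
    of a list. *)
Lemma range_prepend (T : Type) (u w : nat -> T) n : (forall i, range u (w i)) ->
  range (fun i => if i < n then w i else u (i - n)) = range u.
Proof.
move=> wu; apply/seteqP; split=> _ [i _ <-].
  by case: ifP => // _; exists (i - n).
by exists (i + n); rewrite // ifF ?addnK //; lia.
Qed.

Lemma cantor_extends (s : seq bool_alphabet) :
  exists x : seqspace bool_alphabet, mkseq x (size s) = s.
Proof. by exists (nth point s); exact: mkseq_nth. Qed.

(** * [List_lt_omega] is not reducible to [wList_le_omega] *)

Section ListNotwList.

(** The surviving teeth are the [<i, c>] with [i] the last nonzero place of [x] and [c < x i]. Hence
    the set is always finite, but no prefix of [x] bounds its size. *)
Let R (x : baire) k n :=
  (pfst k < n -> psnd k < x (pfst k)) /\ forall i, i < n -> pfst k < i -> x i = 0.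

Lemma last_nonzero_anti x k m n : m <= n -> R x k n -> R x k m.
Proof.
move=> mn [R1 R2]; split=> [km|i im ki]; first by apply: R1; lia.
by apply: R2; lia.
Qed.

Let K (x : baire) := [set k | forall n, R x k n].

Lemma KP x k : K x k <-> psnd k < x (pfst k) /\ forall i, pfst k < i -> x i = 0.
Proof.
split=> [Kk|[k1 k2] n]; last by split=> // i _; exact: k2.
split=> [|i ki]; first by have [+ _] := Kk (pfst k).+1; apply.
by have [_ +] := Kk i.+1; apply.
Qed.

Lemma finite_K x : finite_set (K x).
Proof.
have [->|/set0P[k0 /KP[k01 k02]]] := eqVneq (K x) set0; first exact: finite_set0.
apply: sub_finite_set (finite_image (fun c => cpair (pfst k0) c) (finite_II (x (pfst k0)))).
move=> k /KP[k1 k2]; exists (psnd k); last first.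
  rewrite -[RHS]cpairK; congr cpair; case: (ltngtP (pfst k) (pfst k0)) => [/k2|/k02|//].
    by move=> k00; rewrite k00 in k01.
  by move=> k00; rewrite k00 in k1.
case: (ltngtP (pfst k) (pfst k0)) => [/k2|/k02|<-//].
  by move=> k00; rewrite k00 in k01.
by move=> k00; rewrite k00 in k1.
Qed.

Let A (x : baire) := pathSet (comb (R x)).
Let p (x : baire) := char_of (comb (R x)).

Lemma p_upto N x x' : upto N x x' -> upto N (p x) (p x').
Proof.
move=> xx'; apply: char_of_upto => s sN.
have RR' y y' k : upto N y y' -> R y k (size s) -> R y' k (size s).
  move=> yy' [R1 R2]; split=> [ks|i si ki]; first by rewrite -yy' ?R1 //; exact: ltn_trans sN.
  by rewrite -yy' ?R2 //; exact: ltn_trans sN.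
by split=> -[s0|[k [Rk sk]]]; [left|right; exists k; split=> //; apply: RR' Rk|
  left|right; exists k; split=> //; apply: RR' Rk; apply: upto_sym].
Qed.

Lemma List_lt_omega_not_wList : ~ leW List_lt_omega wList_le_omega.
Proof.
move=> [Phi [Psi [/computable_cont cPhi /computable_cont cPsi red]]].
have /choice[rT rTP] : forall x, exists rT : baire * set (seq bool_alphabet),
    [/\ Phi (p x) = Some rT.1, tree rT.2, char_fun rT.1 rT.2,
      (exists u : nat -> seqspace bool_alphabet, paths rT.2 = range u) &
      forall q u, name q (u : rep_seq rep_cantor) -> paths rT.2 = range u ->
      exists s y, [/\ Psi (interleave (p x) q) = Some s,
        name s (y : rep_fseq rep_cantor) & pts (A x) = [set` y]]].
  move=> x; have [||r [B [Phir [T [treeT rT TB]] domB solB]]] := red (p x) (A x).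
  - exists (comb (R x)); split=> //; exact: comb_tree (@last_nonzero_anti x).
  - rewrite /= comb_paths; last exact: last_nonzero_anti.
    rewrite finite_setU; split; first exact: finite_set1.
    exact/finite_image/finite_K.
  exists (r, T); split=> //=; rewrite TB.
    by have [u Bu] := wList_le_omega_nonempty domB; exists u.
  by move=> q u qu Bu; exact: solB qu Bu.
pose B x := paths (rT x).2.
(* Every list that begins with the finite part [F] makes [Psi] announce the length [n]. *)
pose secure (F : seq (seq bool)) n x := forall x' (u : nat -> seqspace bool_alphabet) s,
  upto (size F) x x' ->
  (forall i, i < size F -> mkseq (u i) (size (nth [::] F i)) = nth [::] F i) ->
  Psi (interleave x' (seq_of u)) = Some s -> s 0 = n.
(* This is closed in [x]: security depends on [size F] values of the name, and non-extendibility is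
   an open condition by [extendible_use]. *)
pose C (Fn : seq (seq bool) * nat) : set baire := [set x |
  (forall i, i < size Fn.1 -> extendible (rT x).2 (nth [::] Fn.1 i : seq bool_alphabet)) /\
  secure Fn.1 Fn.2 (p x)].
have [||[F n] [x0 [N CN]]] := @closed_cover_baire _ C.
- move=> [F n] x nC.
  have [extF|/existsNP[i /not_implyP[iF nexti]]] := pselect (forall i, i < size F ->
      extendible (rT x).2 (nth [::] F i : seq bool_alphabet)).
    have nsec : ~ secure F n (p x) by move=> sec; apply: nC.
    exists (size F) => x' xx' [_ sec]; apply: nsec => y u s xy.
    apply: sec; apply: upto_trans xy; exact/p_upto/upto_sym.
  have [Phix treex rx _ _] := rTP x.
  have [M MP] := extendible_use treex rx nexti.
  have [N NP] := cPhi _ _ Phix M.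
  exists N => x' xx' [/= /(_ i iF) exti _].
  have [Phix' treex' rx' _ _] := rTP x'.
  by apply: MP rx' _ exti; apply: NP Phix'; exact: p_upto.
- move=> x; have [Phix treex rx [u Bu] /(_ _ _ (seq_of_name u) Bu)] := rTP x.
  move=> [s [y [Psis sy Ay]]].
  have [N NP] := cPsi _ _ Psis 1.
  exists (mkseq (fun i => mkseq (u i) N) N, s 0); split=> [i|x' u' s' /=].
    rewrite size_mkseq => iN; rewrite /extendible nth_mkseq // size_mkseq.
    by exists (u i); rewrite // Bu; exists i.
  rewrite size_mkseq => xx' uu' Psis'.
  apply/esym; apply: (NP (interleave x' (seq_of u'))) => //.
  apply: upto_interleave => // i iN; congr nat_of_bool.
  have iN1 := leq_ltn_trans (pfst_le i) iN; have iN2 := leq_ltn_trans (psnd_le i) iN.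
  have := uu' _ iN1; rewrite nth_mkseq // size_mkseq.
  by move=> /(congr1 (fun t => nth false t (psnd i))); rewrite !nth_mkseq.
(* Inside the basic open set, [N] becomes the last nonzero place with value [n.+1]. This gives
   [n.+1] teeth, too many for a list of length [n]. *)
pose x1 : baire := fun i => if i < N then x0 i else if i == N then n.+1 else 0.
have [extF secF] : C (F, n) x1 by apply: CN => i iN; rewrite /x1 iN.
have [_ _ _ [u0 Bu0] solx1] := rTP x1.
have [w wP] : exists w : nat -> seqspace bool_alphabet, forall i, range u0 (w i) /\
    (i < size F -> mkseq (w i) (size (nth [::] F i)) = nth [::] F i).
  suff /choice[w wP] : forall i, exists x : seqspace bool_alphabet, range u0 x /\
    (i < size F -> mkseq x (size (nth [::] F i)) = nth [::] F i) by exists w.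
  move=> i; have [/extF[x Bx xE]|_] := boolP (i < size F); last first.
    by exists (u0 0); split=> //; exists 0.
  by exists x; rewrite -Bu0.
(* A genuine list of the paths that begins with [F], so [Psi] is bound to announce [n]. *)
pose u i := if i < size F then w i else u0 (i - size F).
have [||s [y [Psis [sy _] Ay]]] := solx1 (seq_of u) u.
- exact: seq_of_name.
- by rewrite Bu0 range_prepend // => i; case: (wP i).
have sn : s 0 = n.
  apply: secF Psis => // i iF; rewrite /u iF; exact: (wP i).2.
suff : n.+1 <= size y by rewrite -sy sn ltnn.
have <- : size [seq cantor1 (cpair N c) | c <- iota 0 n.+1] = n.+1 by rewrite size_map size_iota.
apply: uniq_leq_size.
  rewrite map_inj_uniq ?iota_uniq // => c d /cantor1_inj /(congr1 psnd).
  by rewrite !pairE.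
move=> _ /mapP[c + ->]; rewrite mem_iota => /= cn.
suff : pts (A x1) (cantor1 (cpair N c)) by rewrite Ay.
rewrite /= comb_paths; last exact: last_nonzero_anti.
right; exists (cpair N c) => //; apply/KP; rewrite !pairE /x1 ltnn eqxx; split=> // i Ni.
by rewrite ltnNge (ltnW Ni) /= gtn_eqF.
Qed.

End ListNotwList.

(** * [wList_le_omega] is not reducible to [List_lt_omega] *)

Section wListNotList.

(** The tooth [k] survives if [x k = 0]; otherwise it dies at level [x k]. *)
Let R (x : baire) k n := x k = 0 \/ n < x k.

Lemma alive_anti x k m n : m <= n -> R x k n -> R x k m.
Proof. by move=> mn [xk|nx]; [left|right; exact: leq_ltn_trans nx]. Qed.

Let A (x : baire) := pathSet (comb (R x)).
Let p (x : baire) := char_of (comb (R x)).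

Lemma A_mem x k : pts (A x) (cantor1 k) <-> x k = 0.
Proof.
rewrite /= comb_paths; last exact: alive_anti.
split=> [[/(congr1 (fun y => y k))|[l Rl /cantor1_inj <-]]|xk].
- by rewrite /cantor1 /cantor0 eqxx.
- by have [//|] := Rl (x l); rewrite ltnn.
by right; exists k => // n; left.
Qed.

(** Turning a zero into a large value kills a tooth so late that the prefix of the name does not
    show it. *)
Lemma p_upto_late N x x' :
  (forall i, i < N -> x' i = x i \/ x i = 0 /\ N <= x' i) -> upto N (p x) (p x').
Proof.
move=> xx'; apply: char_of_upto => s sN.
have zero k : size s <= k -> mkseq (cantor1 k) (size s) = mkseq cantor0 (size s).
  by move=> sk; apply: eq_in_mkseq => i si; rewrite /cantor1 /cantor0; apply/eqP; lia.
split=> -[s0|[k [Rk sk]]]; try by left.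
  have [ks|/zero sk0] := ltnP k (size s); last by left; rewrite -sk0.
  right; exists k; split=> //; have [xk|[xk Nx']] := xx' k (ltn_trans ks sN).
    by rewrite /R xk.
  by right; exact: leq_trans sN Nx'.
have [ks|/zero sk0] := ltnP k (size s); last by left; rewrite -sk0.
right; exists k; split=> //; have [xk|[xk Nx']] := xx' k (ltn_trans ks sN).
  by rewrite /R -xk.
by left.
Qed.

Let fseq_canon (y : seq (seqspace bool_alphabet)) : baire :=
  fseq_of (size y) (fun i n => enc (nth cantor0 y i n : bool_alphabet)).

Lemma wList_not_List_lt_omega : ~ leW wList_le_omega List_lt_omega.
Proof.
move=> [Phi [Psi [/computable_cont cPhi /computable_cont cPsi red]]].
have /choice[d dP] : forall x, exists d : (baire * set (seq bool_alphabet)) *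
    (seq (seqspace bool_alphabet) * (baire * (nat -> seqspace bool_alphabet))),
    [/\ [/\ Phi (p x) = Some d.1.1, tree d.1.2, char_fun d.1.1 d.1.2 &
      paths d.1.2 = [set` d.2.1]] &
      [/\ Psi (interleave (p x) (fseq_canon d.2.1)) = Some d.2.2.1,
        name d.2.2.1 (d.2.2.2 : rep_seq rep_cantor) & pts (A x) = range d.2.2.2]].
  move=> x; have [||r [B [Phir [T [treeT rT TB]] domB solB]]] := red (p x) (A x).
  - exists (comb (R x)); split=> //; exact: comb_tree (@alive_anti x).
  - rewrite /= comb_paths; last exact: alive_anti.
    split; last by exists cantor0; left.
    apply: (@sub_countable _ _ _ (range (fun n => if n is k.+1 then cantor1 k else cantor0))).
      apply: subset_card_le => _ [->|[k _ <-]]; first by exists 0.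
      by exists k.+1.
    exact: card_le_trans (card_image_le _ _) (countableP _).
  have [y By] := List_lt_omega_nonempty domB.
  have [|o [u [Psio ou Au]]] := solB (fseq_canon y) y _ By.
    exact: (@fseq_of_name bool_alphabet _ _ _ cantor0).
  by exists ((r, T), (y, (o, u))); split=> //=; split=> //; rewrite TB.
pose sq x := (d x).2.1; pose B x := (d x).1.2.
(* [U] consists of one string for each entry of the finite list, isolating it among the paths; this
   is the finite advice. *)
pose D (U : seq (seq bool_alphabet)) : set baire := [set x | size U = size (sq x) /\
  forall i, i < size U ->
    mkseq (nth cantor0 (sq x) i) (size (nth [::] U i)) = nth [::] U i /\
    forall w, paths (B x) w -> mkseq w (size (nth [::] U i)) = nth [::] U i ->
        w = nth cantor0 (sq x) i].
(* The closure of [D U], so that the category argument applies; points of [D U] itself are recovered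
   arbitrarily close by. *)
pose C U : set baire := [set x | forall N, exists2 x', upto N x x' & D U x'].
have [||U [x0 [N CN]]] := @closed_cover_baire _ C.
- move=> U x /existsNP[N nN]; exists N => x' xx' /(_ N)[y x'y Dy].
  by apply: nN; exists y => //; exact: upto_trans x'y.
- move=> x; have [[_ _ _ Bx] _] := dP x; have [m mP] := separating_depth (sq x).
  exists [seq mkseq y m | y <- sq x] => N; exists x => //.
  split=> [|i]; rewrite size_map // => isz.
  rewrite (nth_map cantor0) // size_mkseq; split=> // w.
  rewrite /B Bx => /= ws; apply: mP => //; exact: mem_nth.
(* The tooth [N] is made to survive, so that the answer must list [cantor1 N], at some position
   [i]. *)
pose x1 : baire := fun i => if i == N then 0 else x0 i.
have [|x x1x [Usz UP]] := CN x1 _ N.+1; first by move=> i iN; rewrite /x1 ltn_eqF.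
have xN : x N = 0 by rewrite -x1x // /x1 eqxx.
have [[Phix treex rx Bx] [Psix ox Ax]] := dP x.
have [i ui] : exists i, (d x).2.2.2 i = cantor1 N.
  by have /A_mem := xN; rewrite Ax => -[i _ ui]; exists i.
have [N1 N1P] := cPsi _ _ Psix (cpair i N).+1.
(* [N1] is the use of [Psi] for the value at place [N] of entry [i], and [n1] is a precision that
   also covers the strings in [U]. [n2] suffices to refute every non-extendible string of length
   [n1], and [n3] is the use of [Phi] for that. *)
pose n1 := N1 + \max_(t <- U) size t.
have /choice[L LP] : forall v : seq bool_alphabet, exists M, ~ extendible (B x) v ->
    forall r' T', char_fun r' T' -> upto M (d x).1.1 r' -> ~ extendible T' v.
  move=> v; have [ext|next] := pselect (extendible (B x) v); first by exists 0.
  by have [M MP] := extendible_use treex rx next; exists M.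
pose n2 := \max_(v : n1.-tuple bool) L v.
have [n3 n3P] := cPhi _ _ Phix n2.
pose M := maxn N1 (maxn n3 N.+1).
(* The tooth [N] now dies at level [M.+1], beyond everything that was read. *)
pose x2 : baire := fun j => if j == N then M.+1 else x j.
have [|x' x2x' [U'sz U'P]] := CN x2 _ M.
  move=> j jN; rewrite /x2 ltn_eqF // -x1x; last exact: ltnW.
  by rewrite /x1 ltn_eqF.
have xx' : upto M (p x) (p x').
  apply: p_upto_late => j jM; rewrite -x2x' // /x2.
  by case: eqP => [->|_]; [right|left].
have [[Phix' treex' rx' Bx'] [Psix' ox' Ax']] := dP x'.
have rr' : upto n2 (d x).1.1 (d x').1.1.
  by apply: n3P Phix'; apply: upto_leq xx'; rewrite /M; lia.
(* If the [a]-th entries differed within [n1], the prefix of the new one would not be extendible in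
   [B x], as the string in [U] isolates the old one. The names of the two trees agree far enough to
   refute it for [x'] too. *)
have sq_eq a n : a < size U -> n < n1 ->
    nth cantor0 (sq x) a n = nth cantor0 (sq x') a n.
  move=> aU nn1; set y := nth _ (sq x) a; set y' := nth _ (sq x') a.
  suff yy' : mkseq y n1 = mkseq y' n1.
    by have := congr1 (fun t => nth false t n) yy'; rewrite !nth_mkseq.
  apply: contrapT => nyy'.
  have Ua_n1 : size (nth [::] U a) <= n1.
    apply: leq_trans (leq_addl _ _).
    exact: (leq_bigmax_seq _ (mem_nth [::] aU) isT).
  have [y'U _] := U'P a aU; have [_ yuniq] := UP a aU.
  have next : ~ extendible (B x) (mkseq y' n1).
    move=> [w Bw]; rewrite size_mkseq => wy'; apply: nyy'; rewrite -wy'; congr mkseq.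
    apply/esym/yuniq => //; rewrite -y'U size_mkseq -(subnKC Ua_n1) in wy' *.
    move: wy'; rewrite /mkseq !iotaD !map_cat => /(congr1 (take (size (nth [::] U a)))).
    by rewrite !take_size_cat // size_map size_iota.
  apply: (LP _ next _ _ rx').
    apply: upto_leq rr'.
    have vn1 : size (mkseq y' n1) == n1 by rewrite size_mkseq.
    exact: (leq_bigmax (F := fun v : n1.-tuple bool => L v) (Tuple vn1)).
  exists y'; last by rewrite size_mkseq.
  by rewrite Bx' /=; apply: mem_nth; rewrite -U'sz.
have qq' : upto N1 (fseq_canon (sq x)) (fseq_canon (sq x')).
  move=> j jN1; rewrite /fseq_canon /fseq_of -Usz -U'sz; case: eqP => // _.
  have [aU|aU] := ltnP (pfst j.-1) (size U); last by rewrite !nth_default // -?Usz -?U'sz.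
  rewrite sq_eq //; apply: leq_ltn_trans (psnd_le _) _; rewrite /n1; lia.
have uu' : (d x').2.2.2 i N = true.
  have := N1P _ _ (upto_interleave (upto_leq _ xx') qq') Psix' (cpair i N) (ltnSn _).
  rewrite [LHS](ox i N) [RHS](ox' i N) ui /cantor1 eqxx => /(_ (leq_maxl _ _)).
  by case: (_ i N).
have : pts (A x') ((d x').2.2.2 i) by rewrite Ax'; exists i.
rewrite /= comb_paths; last exact: alive_anti.
case=> [u0|[k Rk uk]]; first by rewrite u0 in uu'.
have kN : k = N by move: uu'; rewrite -uk /cantor1 => /eqP.
have x'N : x' N = M.+1 by rewrite -x2x' /x2 ?eqxx // /M; lia.
by have := Rk (x' k); rewrite kN /R ltnn x'N; case.
Qed.

End wListNotList.

(** The value at [n] depends only on values below [n], so the fixed point is built by recursion,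
    [h n] being its first [n] values. It provides a tree defined from its own name. *)
Lemma upto_fixpoint (G : baire -> baire) :
  (forall p q n, upto n p q -> G p n = G q n) -> exists p, G p = p.
Proof.
move=> GP; pose h := fix h n := if n is m.+1 then rcons (h m) (G (nth 0 (h m)) m) else [::].
have size_h n : size (h n) = n by elim: n => //= n IHn; rewrite size_rcons IHn.
pose p : baire := fun n => G (nth 0 (h n)) n.
have hp n : upto n (nth 0 (h n)) p.
  elim: n => //= n IHn i; rewrite ltnS leq_eqVlt nth_rcons size_h.
  by case: ltngtP => // [/IHn -> //|-> _].
by exists p; apply/funext => n; apply: GP; exact/upto_sym.
Qed.

(** * Unique choice is not reducible to listing in Cantor space *)

Section UCNotList.

Variables Phi Psi : baire -> option baire.
Hypotheses (cPhi : computable Phi) (cPsi : computable Psi).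

Let canon k (u : rep_bseq bool_alphabet) : baire :=
  interleave (fun=> k) (bseq_of (fun i => (u i).1) (fun i n => enc ((u i).2 n))).

Lemma canon_name k u : name (canon k u) ((k, u) : rep_prod rep_nat (rep_bseq bool_alphabet)).
Proof. by apply: prod_nameI => //; exact: bseq_of_name. Qed.

Lemma canon_upto N k (u v : rep_bseq bool_alphabet) :
  (forall i, i < N -> (u i).1 = (v i).1 /\ mkseq (u i).2 N = mkseq (v i).2 N) ->
  upto N (canon k u) (canon k v).
Proof.
move=> uv; apply: upto_interleave => // i iN.
have [b_eq x_eq] := uv _ (leq_ltn_trans (pfst_le i) iN).
rewrite /bseq_of b_eq; case: ifP => // _; congr enc.
have iN2 : (psnd i)./2 < N by have := psnd_le i; lia.
have := congr1 (fun t => nth point t (psnd i)./2) x_eq.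
by rewrite !nth_mkseq.
Qed.

Let fragment (k : nat) : seq (bool * seq bool) := odflt [::] (unpickle k).
Let node (k : nat) : seq bool := odflt [::] (unpickle k).

Let matches (F : seq (bool * seq bool)) (u : rep_bseq bool_alphabet) :=
  forall i, i < size F -> (u i).1 = (nth (false, [::]) F i).1 /\
    mkseq (u i).2 (size (nth (false, [::]) F i).2) = (nth (false, [::]) F i).2.

(* [2 * s + 1] asks whether the tree [Phi p] fails to extend the string coded
   by [s]; [2 * k] asks for a finite part of a list of the paths of [Phi p]
   from which [Psi], when told that there are [k - 1] paths, outputs [0] at
   position [2 * k].                                                          *)
Let V (p z : baire) (m k : nat) : bool :=
  if odd m then
    `[< forall p' r' (T' : set (seq bool_alphabet)), upto k p p' ->
        Phi p' = Some r' -> char_fun r' T' -> ~ extendible T' (node m./2) >]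
  else
    all (fun bs => bs.1 ==> (z (pickle bs.2).*2.+1 == 0)) (fragment k) &&
    `[< forall p' u s, upto (size (fragment k)) p p' -> matches (fragment k) u ->
        Psi (interleave p' (canon m./2 u)) = Some s -> s m = 0 >].

(** Bounds at once the places of [z] that [V] reads at [c] and the prefix of [p] on which it
    depends; the latter makes the self-reference possible. *)
Let B (c : nat) := (pfst c + psnd c + size (fragment (psnd c)) +
  \max_(bs <- fragment (psnd c)) (pickle bs.2).*2.+1).+1.

Lemma B_gt c : pfst c < B c.
Proof. by rewrite /B; lia. Qed.

Lemma V_use p z z' c : (forall i, i < B c -> z i = z' i) ->
  V p z (pfst c) (psnd c) = V p z' (pfst c) (psnd c).
Proof.
rewrite /V /B => zz'; case: ifP => // _.
congr (_ && _); apply: eq_in_all => bs bsF; rewrite zz' //.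
rewrite ltnS; apply: leq_trans (leq_addl _ _).
exact: (leq_bigmax_seq _ bsF isT).
Qed.

Lemma V_upto p p' z c : upto (B c) p p' -> V p z (pfst c) (psnd c) = V p' z (pfst c) (psnd c).
Proof.
move=> pp'; rewrite /V; case: ifP => _.
  apply: asbool_equiv_eq.
  have {}pp' : upto (psnd c) p p' by apply: upto_leq pp'; rewrite /B; lia.
  split=> H q r' T' qq'; apply: H; first exact: (upto_trans pp' qq').
  exact: (upto_trans (upto_sym pp') qq').
congr (_ && _); apply: asbool_equiv_eq.
have {}pp' : upto (size (fragment (psnd c))) p p'.
  by apply: upto_leq pp'; rewrite /B; lia.
split=> H q u s qq'; apply: H; first exact: (upto_trans pp' qq').
exact: (upto_trans (upto_sym pp') qq').
Qed.

(** Odd places do not refer to [z], and even places refer only to odd ones, so two applications of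
    [F] to any start give the solution. *)
Lemma lw_spec_V p : exists! z, lw_spec (V p) z.
Proof.
pose F z : baire := fun m => lw (V p z m).
have Fodd z z' m : odd m -> F z m = F z' m.
  by move=> om; apply: lw_ext => k; rewrite /V om.
have Feven z z' : (forall m, odd m -> z m = z' m) -> F z = F z'.
  move=> zz'; apply/funext => m; apply: lw_ext => k; rewrite /V.
  case: ifP => // om; congr (_ && _).
  by apply: eq_all => bs; rewrite zz' //= odd_double.
exists (F (F (fun=> 0))); split=> [m|z zV].
  by rewrite -[RHS]/(F _ m); congr (_ m); apply: Feven => n; exact: Fodd.
have zF : z = F z by apply/funext => m; exact: zV.
rewrite [RHS]zF; apply: Feven => m om.
by rewrite zV; exact: Fodd.
Qed.

(** Whether [s] is a node depends on [p] only below [size s], which is at most the code of [s]. So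
    [upto_fixpoint] yields a name that occurs in the definition of its own tree. *)
Lemma self_referential_tree : exists p z, [/\ 
  char_fun p (lw_tree (V p) B : set (seq nat_alphabet)), lw_spec (V p) z &
  paths (lw_tree (V p) B : set (seq nat_alphabet)) = [set (z : seqspace nat_alphabet)]].
Proof.
have [|p pE] := @upto_fixpoint
  (fun p => char_of (lw_tree (V p) B : set (seq nat_alphabet))).
  move=> p q n pq; apply: (char_of_upto (N := n.+1)) => // s; rewrite ltnS => sn.
  have okE c : B c < size s -> lw_ok (V p (nth 0 s)) (nth 0 s) c =
      lw_ok (V q (nth 0 s)) (nth 0 s) c.
    move=> Bs; rewrite /lw_ok (@V_upto p q) //; apply: upto_leq pq.
    exact: leq_trans (ltnW Bs) sn.
  by split=> Ts c cs Bs; have := Ts c cs Bs; rewrite okE.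
have [z [zV zuniq]] := lw_spec_V p.
exists p, z; split=> //; first by rewrite -{1}pE; exact: char_of_char.
apply/seteqP; split=> y.
  by move=> /(lw_tree_paths B_gt (@V_use p))/zuniq.
by move=> ->; apply/(lw_tree_paths B_gt (@V_use p)).
Qed.

Lemma UC_not_List : ~ (forall p x, name p x -> dom UC_baire x ->
  exists r z, [/\ Phi p = Some r, name r z, dom (List bool_alphabet) z &
    forall q w, name q w -> sol (List bool_alphabet) z w ->
    exists s y, [/\ Psi (interleave p q) = Some s, name s y & sol UC_baire x y]]).
Proof.
have [p [z [pT zV pathsT]]] := self_referential_tree.
have treeT : tree (lw_tree (V p) B : set (seq nat_alphabet)).
  exact: lw_tree_tree B_gt (@V_use p).
move=> /(_ p _ (pathSet_name treeT pT))[].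
  by exists z.
move=> r [A [Phip [T [treeA rA TA]] cA red]].
(* The odd places of the solution [z] thus decide which strings extend to paths of the tree [T]
   named by [Phi p]. *)
have oddP s : z (pickle s).*2.+1 == 0 <-> extendible T (s : seq bool_alphabet).
  split=> [|[x Tx xs]].
    rewrite zV lw_eq0 => /asboolPn nV; apply: contrapT => next; apply: nV.
    have [M MP] := extendible_use treeA rA next.
    have [N NP] := computable_cont cPhi Phip M.
    exists N; rewrite /V /= odd_double uphalf_double /node pickleK.
    by apply/asboolP => p' r' T' pp' Phip' rT'; apply: MP rT' _; exact: NP Phip'.
  rewrite zV lw_eq0; apply/asboolPn => -[l]; rewrite /V /= odd_double uphalf_double /node pickleK.
  move=> /asboolP/(_ p r T (@upto_refl _ _) Phip rA); apply.
  by exists x.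
have [[k u] solA] := List_nonempty cA.
have solE v : listed v = listed u -> exists s,
    Psi (interleave p (canon k v)) = Some s /\ s =1 z.
  move=> vu; have [||s [y [Psis sy xy]]] := red (canon k v) (k, v).
  - exact: canon_name.
  - by case: solA => Au ?; split=> //=; rewrite vu.
  exists s; split=> // n; rewrite [s n]sy /=.
  suff -> : y = z by [].
  have : paths (lw_tree (V p) B : set (seq nat_alphabet)) y by rewrite [paths _]xy.
  by rewrite pathsT.
have Tu : paths T = listed u by rewrite TA; case: solA.
have [s [Psis sz]] := solE u erefl.
(* If [z] is 0 at [2 * k], then [Psi] outputs 0 there from the list [u]. A finite part of [u]
   already forces this and is a witness, against the value 0. *)
case z0: (z k.*2) => [|f].
  have := lwP (V p z k.*2); rewrite -zV z0 /=.
  have [N NP] := computable_cont cPsi Psis k.*2.+1.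
  pose F := mkseq (fun i => ((u i).1, mkseq (u i).2 N : seq bool)) N.
  have sizeF : size F = N by rewrite size_mkseq.
  move=> /(_ (pickle F)); rewrite /V odd_double doubleK /fragment pickleK; case/negP.
  apply/andP; split.
    apply/allP => bs /(nthP (false, [::]))[i]; rewrite sizeF => iN <-.
    rewrite nth_mkseq //=; apply/implyP => ui; apply/oddP.
    by exists (u i).2; rewrite ?size_mkseq // Tu; exists i.
  apply/asboolP => p' v s' pp' vF Psis'; rewrite sizeF in pp'.
  rewrite -z0 -sz; apply/esym; apply: NP Psis' _ (ltnSn _).
  apply: upto_interleave => //; apply: canon_upto => i iN.
  have := vF i; rewrite sizeF nth_mkseq // size_mkseq => /(_ iN)[-> ->] //.
(* Otherwise the fragment coded by [f] forces the output 0. It extends to a full list [v] of the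
   same set, for which [Psi] has to output the nonzero value [z k.*2]. *)
have := lwP (V p z k.*2); rewrite -zV z0 /= => -[+ _].
rewrite /V odd_double doubleK; set F := fragment f => /andP[/allP compatF /asboolP secF].
have [w wP] : exists w : rep_bseq bool_alphabet, forall i, i < size F ->
   [/\ (w i).1 = (nth (false, [::]) F i).1,
     mkseq (w i).2 (size (nth (false, [::]) F i).2) = (nth (false, [::]) F i).2 &
     (w i).1 -> listed u (w i).2].
  suff /choice[w wP] : forall i, exists bx : bool * seqspace bool_alphabet, i < size F ->
     [/\ bx.1 = (nth (false, [::]) F i).1,
       mkseq bx.2 (size (nth (false, [::]) F i).2) = (nth (false, [::]) F i).2 &
       bx.1 -> listed u bx.2] by exists w.
  move=> i; have [iF|_] := boolP (i < size F); last by exists (u 0).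
  have := compatF _ (mem_nth (false, [::]) iF); case: (nth _ F i) => -[] t /=.
    by move=> /oddP[x Tx xt]; exists (true, x) => _; split=> //= _; rewrite -Tu.
  by move=> _; have [x xt] := cantor_extends t; exists (false, x).
pose v : rep_bseq bool_alphabet := fun i => if i < size F then w i else u (i - size F).
have vu : listed v = listed u.
  apply/seteqP; split=> x [i /=].
    rewrite /v; case: ifP => [iF wi <-|_ ui <-]; last by exists (i - size F).
    by have [_ _] := wP i iF; exact.
  by move=> ui <-; exists (i + size F); rewrite /v /= ifF ?addnK //; lia.
have [s' [Psis' s'z]] := solE v vu.
have vF : matches F v by move=> i iF; rewrite /v iF; have [] := wP i iF.
by have := secF p v s' (@upto_refl _ _) vF Psis'; rewrite s'z z0.
Qed.

End UCNotList.

(** * The diagram *)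

Lemma wList_le_omega_eqsW : eqsW wList_le_omega (wList bool_alphabet).
Proof.
split; first exact: wList_le_omega_wList.
exact: lesW_trans (lesW_prod_id_r _) wList_prod_id_wList_le_omega.
Qed.

Lemma cylinder_wList_bool : cylinder (wList bool_alphabet).
Proof.
apply: cylinderP.
exact: lesW_trans wList_prod_id_wList_le_omega wList_le_omega_wList.
Qed.

Lemma UC_eqsW_wList : eqsW UC_baire (wList nat_alphabet).
Proof.
by split; [exact: UC_wList|exact: lesW_trans (wList_List _) (List_UC _)].
Qed.

Lemma wList_eqsW_List : eqsW (wList nat_alphabet) (List nat_alphabet).
Proof.
by split; [exact: wList_List|exact: lesW_trans (List_UC _) UC_wList].
Qed.

Theorem theorem3p10 :
  (incomparableW List_lt_omega wList_le_omega /\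
   eqW wList_le_omega (wList bool_alphabet)) /\
  (ltW wList_le_omega (List bool_alphabet) /\
   ltW List_lt_omega (List bool_alphabet)) /\
  (ltW (List bool_alphabet) UC_baire /\
   eqW UC_baire (wList nat_alphabet) /\
   eqW (wList nat_alphabet) (List nat_alphabet)) /\
  (cylinder List_lt_omega /\
   cylinder wList_le_omega /\
   cylinder (wList bool_alphabet) /\
   cylinder (List bool_alphabet) /\
   cylinder UC_baire /\
   cylinder (wList nat_alphabet) /\
   cylinder (List nat_alphabet)) /\
  (eqsW wList_le_omega (wList bool_alphabet) /\
   lesW wList_le_omega (List bool_alphabet) /\
   lesW List_lt_omega (List bool_alphabet) /\
   lesW (List bool_alphabet) UC_baire /\
   eqsW UC_baire (wList nat_alphabet) /\
   eqsW (wList nat_alphabet) (List nat_alphabet)).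
Proof.
have wList_le_omega_List : lesW wList_le_omega (List bool_alphabet).
  exact: lesW_trans wList_le_omega_wList (wList_List _).
have cylUC : cylinder UC_baire by apply: cylinderP; exact: UC_prod_id_UC.
have cyl_wList : cylinder (wList nat_alphabet).
  by apply: eqsW_cylinder cylUC; case: UC_eqsW_wList.
have eqsW_eqW X Y Z W (f : problem X Y) (g : problem Z W) : eqsW f g -> eqW f g.
  by case=> fg gf; split; exact: lesW_leW.
split; [|split; [|split; [|split]]].
- split; last exact/eqsW_eqW/wList_le_omega_eqsW.
  by split; [exact: List_lt_omega_not_wList|exact: wList_not_List_lt_omega].
- split; split; try exact: lesW_leW wList_le_omega_List.
  + move=> /(leW_trans (lesW_leW List_lt_omega_List)).
    exact: List_lt_omega_not_wList.
  + exact: lesW_leW List_lt_omega_List.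
  + move=> /(leW_trans (lesW_leW wList_le_omega_List)).
    exact: wList_not_List_lt_omega.
- split; last by split; apply: eqsW_eqW; [exact: UC_eqsW_wList|exact: wList_eqsW_List].
  split; first exact: lesW_leW (List_UC _).
  by move=> [Phi [Psi [cPhi cPsi red]]]; exact: UC_not_List cPhi cPsi red.
- split; first by apply: cylinderP; exact: List_lt_omega_prod_id.
  split; first exact: eqsW_cylinder wList_le_omega_eqsW cylinder_wList_bool.
  split; first exact: cylinder_wList_bool.
  split; first by apply: cylinderP; exact: List_prod_id_List.
  split; first exact: cylUC.
  split; first exact: cyl_wList.
  by apply: eqsW_cylinder cyl_wList; case: wList_eqsW_List.
- split; first exact: wList_le_omega_eqsW.
  split; first exact: wList_le_omega_List.
  split; first exact: List_lt_omega_List.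
  split; first exact: List_UC.
  by split; [exact: UC_eqsW_wList|exact: wList_eqsW_List].
Qed.
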